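(* Let $d\in\{2,3\}$. There exist absolute constants $c_0,m_0,C>0$ such that the following holds. Let $\nu>0$, $\overline\psi\ge0$, $\iota\in\{+,-\}$, $\mathbf k\in\mathbb R^d\setminus\{0\}$ and $k=|\mathbf k|$. Suppose that $f=h(p,t)e^{i\mathbf k\cdot x}$ solves the linearized PDE $$\partial_tf+p\cdot\nabla_xf-\nu\Delta_pf-d\,\overline\psi\,\nabla u:p\otimes p=0$$ with $f(\cdot,0)=f^{\rm in}=h^{\rm in}(p)e^{i\mathbf k\cdot x}$, where $u$ is determined from $f$ by $$-\Delta u+\nabla q=\operatorname{div}\Sigma,\quad\operatorname{div}u=0,\quad\Sigma(x,t)=\iota\int_{S^{d-1}}p\otimes p\,f(x,p,t)\,dp .$$ Let $$\mu_{\nu,k}=\begin{cases}\nu & k\ge\nu\\ \dfrac{k^2}{\nu}& k\le\nu.\end{cases}$$ If $\iota=+$ or $\overline\psi\le m_0\,\mu_{\nu,k}$, then $$\|h(\cdot,t)\|_{L^2_p}\le C e^{-c_0\mu_{\nu,k}t}\|h^{\rm in}\|_{L^2_p}\qquad\text{for all }t>0 .$$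
   Context: $S^{d-1}$ is the unit sphere, $\Delta_p$ its Laplacian, and $dp$ is the normalized measure on $S^{d-1}$ ($\int_{S^{d-1}}dp=1$). $(\nabla u)_{ij}=\partial_{x_j}u_i$, $A:B=\sum_{ij}A_{ij}B_{ij}$. For single-mode $f$, the velocity is the single-mode solution $u=\widehat u\,e^{i\mathbf k\cdot x}$ with $\widehat u=i|\mathbf k|^{-1}(I-\bar{\mathbf k}\otimes\bar{\mathbf k})\widehat\Sigma\,\bar{\mathbf k}$, $\bar{\mathbf k}=\mathbf k/|\mathbf k|$, $\Sigma=\widehat\Sigma e^{i\mathbf k\cdot x}$. Functions are complex valued. ''Absolute'' constants may depend on $d$ only. *)

(* Defs.v *)
From HB Require Import structures.
From mathcomp Require Import all_boot all_order all_algebra.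
From mathcomp Require Import all_classical all_reals all_analysis.
From mathcomp.real_closed Require Import complex.

Set Implicit Arguments.
Unset Strict Implicit.
Unset Printing Implicit Defensive.

Import Order.TTheory GRing.Theory Num.Theory.
Import numFieldNormedType.Exports.

Local Open Scope classical_set_scope.
Local Open Scope ring_scope.
Local Open Scope complex_scope.

Section Calculus.
Context {R : realType}.

Definition cis (a : R) : R[i] := cos a +i* sin a.

(* R[i] carries no normed R-module structure, so complex-valued functions of
   real variables are differentiated componentwise. *)
Definition cderive {V : normedModType R} (F : V -> R[i]) (x v : V) : R[i] :=
  'D_v (fun y => complex.Re (F y)) x +i* 'D_v (fun y => complex.Im (F y)) x.

Definition cdifferentiable {V : normedModType R} (F : V -> R[i]) (x : V) :=
  differentiable (fun y => complex.Re (F y)) x /\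
  differentiable (fun y => complex.Im (F y)) x.

Context {d : nat}.
Implicit Types (x y p : 'rV[R]_d) (t : R).

Definition basis (j : 'I_d) : 'rV[R]_d := delta_mx 0 j.

Definition dotp x y : R := \sum_j x 0 j * y 0 j.

(* The library norm on 'rV[R]_d is the sup norm. *)
Definition enorm x : R := Num.sqrt (dotp x x).

Definition partial (j : 'I_d) (F : 'rV[R]_d -> R[i]) x : R[i] :=
  cderive F x (basis j).

Definition laplacian (F : 'rV[R]_d -> R[i]) x : R[i] :=
  \sum_j partial j (partial j F) x.

End Calculus.

(* A function on S^(d-1) is represented by a function on 'rV[R]_d of which only
   the values on unit vectors are ever used. *)
Section Sphere.
Context {R : realType} {d : nat}.
Implicit Types (x y p : 'rV[R]_d) (t : R).

Definition on_sphere p : Prop := enorm p = 1.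

Definition unit_dir x : 'rV[R]_d := (enorm x)^-1 *: x.

(* Laplace-Beltrami operator: at unit vectors it agrees with the Euclidean
   Laplacian of the extension that is constant along rays. *)
Definition sphere_laplacian (g : 'rV[R]_d -> R[i]) p : R[i] :=
  laplacian (fun x => g (unit_dir x)) p.

Definition circle_pt (a : R) : 'rV[R]_d :=
  \row_(j < d) [:: cos a; sin a]`_j.

(* z.1 is the azimuth, z.2 the polar angle. *)
Definition sphere2_pt (z : R * R) : 'rV[R]_d :=
  \row_(j < d) [:: sin z.2 * cos z.1; sin z.2 * sin z.1; cos z.2]`_j.

Definition circle_dom : set R := `[0, 2 * pi]%classic.
Definition sphere2_dom : set (R * R) := `[0, 2 * pi]%classic `*` `[0, pi]%classic.

Local Notation leb := (@lebesgue_measure R).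
Local Notation leb2 := (leb \x leb)%E.

(* Integration against the normalized surface measure, in angular coordinates;
   the branch d <> 2 is meaningful for d = 3 only. *)
Definition sphere_int (g : 'rV[R]_d -> R) : R :=
  if d == 2%N then (2 * pi)^-1 * \int[leb]_(a in circle_dom) g (circle_pt a)
  else (4 * pi)^-1 *
       \int[leb2]_(z in sphere2_dom) (g (sphere2_pt z) * sin z.2).

Definition sphere_cint (g : 'rV[R]_d -> R[i]) : R[i] :=
  sphere_int (fun p => complex.Re (g p)) +i*
  sphere_int (fun p => complex.Im (g p)).

Definition sphere_measurable (g : 'rV[R]_d -> R) : Prop :=
  if d == 2%N then measurable_fun circle_dom (fun a => g (circle_pt a))
  else measurable_fun sphere2_dom (fun z => g (sphere2_pt z)).

Definition sphere_integrable (g : 'rV[R]_d -> R) : Prop :=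
  if d == 2%N then leb.-integrable circle_dom (fun a => (g (circle_pt a))%:E)
  else leb2.-integrable sphere2_dom
         (fun z => (g (sphere2_pt z) * sin z.2)%:E).

Definition sqmod (z : R[i]) : R := complex.Re z ^+ 2 + complex.Im z ^+ 2.

Definition sphere_L2 (g : 'rV[R]_d -> R[i]) : Prop :=
  [/\ sphere_measurable (fun p => complex.Re (g p)),
      sphere_measurable (fun p => complex.Im (g p)) &
      sphere_integrable (fun p => sqmod (g p))].

Definition L2norm (g : 'rV[R]_d -> R[i]) : R :=
  Num.sqrt (sphere_int (fun p => sqmod (g p))).

(* G is C^2 in x and C^1 in t on (R^d minus the origin) x (0, +oo). *)
Definition C21 (G : 'rV[R]_d -> R -> R) : Prop :=
  let D j (F : 'rV[R]_d -> R) x := 'D_(basis j) F x in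
  forall x t, x != 0 -> 0 < t ->
  [/\ derivable (G x) t 1,
      differentiable (fun y => G y t) x &
      forall j, differentiable (D j (fun y => G y t)) x] /\
  [/\ {for (x, t), continuous (fun z : 'rV[R]_d * R => G z.1 z.2)},
      {for (x, t), continuous (fun z : 'rV[R]_d * R => 'D_1 (G z.1) z.2)},
      forall j, {for (x, t), continuous
        (fun z : 'rV[R]_d * R => D j (fun y => G y z.2) z.1)} &
      forall i j, {for (x, t), continuous
        (fun z : 'rV[R]_d * R => D i (D j (fun y => G y z.2)) z.1)}].

Definition sphere_C21 (h : 'rV[R]_d -> R -> R[i]) : Prop :=
  C21 (fun x t => complex.Re (h (unit_dir x) t)) /\
  C21 (fun x t => complex.Im (h (unit_dir x) t)).

(* Initial data are attained in L^2: the solution is C^(2,1) for t > 0 and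
   right-continuous into L^2 at t = 0. *)
Definition attains (h : 'rV[R]_d -> R -> R[i]) (hin : 'rV[R]_d -> R[i]) : Prop :=
  (forall p, on_sphere p -> h p 0 = hin p) /\
  L2norm (fun p => h p t - hin p) @[t --> 0^'+] --> (0 : R).

End Sphere.

Section Equation.
Context {R : realType} {d : nat}.
Implicit Types (x y p : 'rV[R]_d) (t : R).

Definition mode (kv x : 'rV[R]_d) : R[i] := cis (dotp kv x).

Definition stress (iota : R) (f : 'rV[R]_d -> 'rV[R]_d -> R -> R[i])
    (x : 'rV[R]_d) (t : R) : 'M[R[i]]_d :=
  \matrix_(i, j)
    (iota%:C * sphere_cint (fun p => (p 0 i * p 0 j)%:C * f x p t)).

Definition stokes (S : 'rV[R]_d -> 'M[R[i]]_d) (u : 'rV[R]_d -> 'rV[R[i]]_d)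
    : Prop :=
  exists q : 'rV[R]_d -> R[i],
    (forall x, cdifferentiable q x) /\
    (forall x, \sum_j partial j (fun y => u y 0 j) x = 0) /\
    (forall x i,
       - laplacian (fun y => u y 0 i) x + partial i q x
       = \sum_j partial j (fun y => S y i j) x).

(* The velocity gradient is (grad u)_ij = d_j u_i. *)
Definition linearized_pde (nu psi : R) (f : 'rV[R]_d -> 'rV[R]_d -> R -> R[i])
    (u : 'rV[R]_d -> R -> 'rV[R[i]]_d) : Prop :=
  forall x p t, on_sphere p -> 0 < t ->
    cderive (f x p) t 1
    + \sum_j (p 0 j)%:C * partial j (fun y => f y p t) x
    - nu%:C * sphere_laplacian (fun p' => f x p' t) p
    - (d%:R * psi)%:C *
        \sum_i \sum_j partial j (fun y => u y t 0 i) x * (p 0 i * p 0 j)%:C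
    = 0.

Definition rate (nu k : R) : R := if nu <= k then nu else k ^+ 2 / nu.

End Equation.

(* Main.v *)
Require Import Defs.
From HB Require Import structures.
From mathcomp Require Import all_boot all_order all_algebra.
From mathcomp Require Import all_classical all_reals all_analysis.
From mathcomp.real_closed Require Import complex.
From mathcomp Require Import measurable_realfun ring lra.

(** After evaluation at x = 0, the pressure and the velocity can be eliminated
    and the real and imaginary parts a, b of h solve on the sphere
      a_t =   K b + nu Lap a - lam K (v . alpha),
      b_t = - K a + nu Lap b - lam K (v . beta),
    where K p = kv . p, v p is the projection of p orthogonally to kv, alpha and
    beta are the means of K v a and K v b, and lam = d psi iota / |kv|^2.
    In E = |a|^2 + |b|^2 the coupling contributes - 2 lam (|alpha|^2 + |beta|^2),
    which has a good sign for iota = + and is absorbed by diffusion for small psi.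
    Diffusion damps E up to the means m of a, b; the means are damped through the
    first moments j of K a, K b, because
      (m_a j_b - m_b j_a)_t = |j|^2 - |kv|^2 |m|^2 / d + errors,
    an identity in which psi does not occur, 1 and K being orthogonal to K v.
    Hence E + 2 gamma (m_a j_b - m_b j_a) with gamma = c mu / |kv|^2 decays at a
    rate proportional to mu.

    Calculus on the sphere is done with the rotation fields x_i d_j - x_j d_i:
    they have mean zero, the sum of their squares over i < j is the
    Laplace-Beltrami operator, and the Poincare inequality follows from
    one-dimensional inequalities on circles and meridians. *)

Set Implicit Arguments.
Unset Strict Implicit.
Unset Printing Implicit Defensive.

Import Order.TTheory GRing.Theory Num.Theory.
Import numFieldNormedType.Exports.

Local Open Scope classical_set_scope.
Local Open Scope ring_scope.
Local Open Scope complex_scope.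

Local Notation "''e_' j" := (Defs.basis j) (at level 8, j at level 2).

(** * Integration on intervals and rectangles *)

(** Diffusion does not see constants in p, but transport sends a constant to the first harmonic K,
    where diffusion acts. For complex m and j the quantity m_a j_b - m_b j_a is the imaginary part
    of conj(m) j; it records this single step out of the kernel of diffusion for the skew transport
    -iK. Of mu only 0 < mu <= nu and mu nu <= |kv|^2 are used. The first lets errors of size mu
    times a variance be charged to diffusion. The second controls the damping of j by nu, which can
    be far larger than mu, and with the first it keeps the cross term below half of E. These
    constraints force the weight gamma to be proportional to mu / |kv|^2. Half of the Poincare gap
    is reserved for the coupling and half pays for the errors, which fixes both the smallness of psi
    and the constant c. Every error is bounded by variances or by a small multiple of |m|^2, never
    by the whole energy with a large constant. The pressure is an arbitrary differentiable function
    rather than a multiple of the mode, so it is removed by an argument on gradients instead of a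
    comparison of Fourier coefficients. *)

Lemma continuous_pair (T U V : topologicalType) (f : T -> U) (g : T -> V) x :
  {for x, continuous f} -> {for x, continuous g} ->
  {for x, continuous (fun z => (f z, g z))}.
Proof.
by move=> cf cg; exact: (@cvg_pair _ _ _ _ (nbhs (f x)) (nbhs (g x))).
Qed.

Section Rectangle.
Context {R : realType}.
Notation leb := (@lebesgue_measure R).
Notation leb2 := (leb \x leb)%E.

(** The sigma-algebra is the product one, so U has to be exhausted by countably many rectangles:
    each of its points lies in a rational box contained in U, and boxes not contained in U are
    replaced by the empty set, which lets the union run over all quadruples of rationals. *)
Lemma open2_measurable (U : set (R * R)) : open U -> measurable U.
Proof.
move=> oU.
pose Q (q : (rat * rat) * (rat * rat)) : set (R * R) :=
  `]ratr q.1.1, ratr q.1.2[%classic `*` `]ratr q.2.1, ratr q.2.2[%classic.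
pose Q' q := if `[< Q q `<=` U >] then Q q else set0.
have -> : U = \bigcup_q Q' q.
  apply/seteqP; split => [[x y] Uxy|z [q _]]; last first.
    by rewrite /Q'; case: asboolP => // QU /QU.
  have := open_nbhs_nbhs (conj oU Uxy).
  rewrite -nbhs_ballE => -[e /= e0 eU].
  have mid (z : R) : exists r s : rat, (ratr r < z < ratr s) /\
     (z - e < ratr r /\ ratr s < z + e).
    have [|r] := @rat_in_itvoo _ (z - e) z; first lra.
    have [|s] := @rat_in_itvoo _ z (z + e); first lra.
    rewrite !in_itv/= => /andP[s1 s2] /andP[r1 r2].
    by exists r, s; rewrite r2 s1.
  have [r [s [/andP[rx xs] [er es]]]] := mid x.
  have [r' [s' [/andP[ry ys] [er' es']]]] := mid y.
  exists ((r, s), (r', s')) => //; rewrite /Q' asboolT/=.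
    by split; rewrite /= in_itv/=; apply/andP.
  move=> [u v] [/=]; rewrite !in_itv/= => /andP[u1 u2] /andP[v1 v2].
  by apply: eU; split => /=; rewrite /ball/= ltr_distlC; apply/andP; split; lra.
apply: countable_bigcupT_measurable => [|q]; first exact: countableP.
rewrite /Q'.
case: asboolP => // _; exact: measurableX.
Qed.

Lemma continuous2_measurable (f : R * R -> R) :
  continuous f -> measurable_fun setT f.
Proof.
move=> /continuousP cf; apply: (measurability _ (RGenOpens.measurableE R)).
move=> _ [_ [a [b ->] <-]]; rewrite setTI; apply: open2_measurable.
exact/cf/interval_open.
Qed.

Lemma compact_bound (T : topologicalType) (A : set T) (f : T -> R) :
  compact A -> {within A, continuous f} ->
  exists2 M, 0 <= M & forall x, A x -> `|f x| <= M.
Proof.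
move=> cA cf; have [->|/set0P A0] := eqVneq A set0; first by exists 0.
have cn : {within A, continuous (fun x => `|f x|)}.
  by move=> x; apply: continuous_comp; [exact: cf|exact: norm_continuous].
have [c cA' cM] := compact_EVT_max A0 cA cn.
by exists `|f c| => // x Ax; apply: cM; rewrite inE.
Qed.

Lemma rectangle_compact (a b c d : R) :
  compact (`[a, b]%classic `*` `[c, d]%classic : set (R * R)).
Proof. by apply: compact_setX; exact: segment_compact. Qed.

Lemma rectangle_measurable (a b c d : R) :
  measurable (`[a, b]%classic `*` `[c, d]%classic : set (R * R)).
Proof. by apply: measurableX. Qed.

Lemma rectangle_finite (a b c d : R) :
  (leb2 (`[a, b]%classic `*` `[c, d]%classic) < +oo)%E.
Proof.
rewrite product_measure1E//= !lebesgue_measure_itv/=.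
by case: ifP; case: ifP => _ _; rewrite ?mule0 ?mul0e// -EFinB -EFinM ltry.
Qed.

Lemma bounded_within (T : topologicalType) (A : set T) (f : T -> R) :
  compact A -> {within A, continuous f} -> [bounded f x | x in A].
Proof.
move=> cA /(compact_bound cA)[M M0 fM].
exists M; split; first exact: num_real.
by move=> N MN x Ax /=; rewrite (le_trans (fM _ Ax))// ltW.
Qed.

Lemma continuous2_integrable (f : R * R -> R) (a b c d : R) : continuous f ->
  leb2.-integrable (`[a, b]%classic `*` `[c, d]%classic) (EFin \o f).
Proof.
move=> cf; apply: measurable_bounded_integrable.
- exact: rectangle_measurable.
- exact: rectangle_finite.
- by apply: measurable_funTS; exact: continuous2_measurable.
- by apply: bounded_within; [exact: rectangle_compact|exact: continuous_subspaceT].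
Qed.

Lemma continuous_integrable (f : R -> R) (a b : R) : continuous f ->
  leb.-integrable `[a, b] (EFin \o f).
Proof.
move=> cf; apply: continuous_compact_integrable; first exact: segment_compact.
exact: continuous_subspaceT.
Qed.

Lemma fst_continuous_comp (f : R * R -> R) (y : R) : continuous f ->
  continuous (fun x => f (x, y)).
Proof.
move=> cf x; apply: (@continuous_comp _ _ _ (fun x => (x, y))); last exact: cf.
by apply: continuous_pair; [exact: cvg_id|exact: cvg_cst].
Qed.

Lemma snd_continuous_comp (f : R * R -> R) (x : R) : continuous f ->
  continuous (fun y => f (x, y)).
Proof.
move=> cf y; apply: (@continuous_comp _ _ _ (fun y => (x, y))); last exact: cf.
by apply: continuous_pair; [exact: cvg_cst|exact: cvg_id].
Qed.
(** Fubini on the whole plane for f extended by zero: a slice over x outside [[a, b]] vanishes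
    identically, and a slice over x inside it is f restricted to [[c, d]]. *)
Lemma Rintegral_rectangle12 (f : R * R -> R) (a b c d : R) : continuous f ->
  \int[leb2]_(z in `[a, b]%classic `*` `[c, d]%classic) f z =
  \int[leb]_(x in `[a, b]) \int[leb]_(y in `[c, d]) f (x, y).
Proof.
move=> cf; rewrite Rintegral_mkcond [RHS]Rintegral_mkcond /Rintegral.
have i2 := continuous2_integrable a b c d cf.
have mr := rectangle_measurable a b c d.
rewrite -integral12_prod_meas1; last first.
  by have := i2; rewrite integrable_mkcond// restrict_EFin.
congr fine; apply: eq_integral => x _.
rewrite [in RHS]/patch; case: ifPn => xab; last first.
  rewrite /fubini_F integral0_eq// => y _.
  rewrite /patch ifN// notin_setE => -[/= xab' _].
  by move: xab; rewrite notin_setE.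
transitivity (\int[leb]_(y in `[c, d]) (f (x, y))%:E)%E.
  rewrite [RHS]integral_mkcond; apply: eq_integral => y _.
  rewrite /patch; have [ycd|ycd] := boolP (y \in `[c, d]%classic).
    by rewrite ifT// inE; split => /=; exact: set_mem.
  rewrite ifN// notin_setE => -[_ /= ycd']; move: ycd.
  by rewrite notin_setE.
rewrite fineK//; apply: integrable_fin_num => //.
exact: (continuous_integrable c d (@snd_continuous_comp f x cf)).
Qed.

Lemma Rintegral_rectangle21 (f : R * R -> R) (a b c d : R) : continuous f ->
  \int[leb2]_(z in `[a, b]%classic `*` `[c, d]%classic) f z =
  \int[leb]_(y in `[c, d]) \int[leb]_(x in `[a, b]) f (x, y).
Proof.
move=> cf; rewrite Rintegral_mkcond [RHS]Rintegral_mkcond /Rintegral.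
have i2 := continuous2_integrable a b c d cf.
have mr := rectangle_measurable a b c d.
rewrite -integral21_prod_meas1; last first.
  by have := i2; rewrite integrable_mkcond// restrict_EFin.
congr fine; apply: eq_integral => y _.
rewrite [in RHS]/patch; case: ifPn => ycd; last first.
  rewrite /fubini_G integral0_eq// => x _.
  rewrite /patch ifN// notin_setE => -[/= _ ycd'].
  by move: ycd; rewrite notin_setE.
transitivity (\int[leb]_(x in `[a, b]) (f (x, y))%:E)%E.
  rewrite [RHS]integral_mkcond; apply: eq_integral => x _.
  rewrite /patch; have [xab|xab] := boolP (x \in `[a, b]%classic).
    by rewrite ifT// inE; split => /=; exact: set_mem.
  rewrite ifN// notin_setE => -[/= xab' _]; move: xab.
  by rewrite notin_setE.
rewrite fineK//; apply: integrable_fin_num => //.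
exact: (continuous_integrable a b (@fst_continuous_comp f y cf)).
Qed.

Lemma Rintegral_derive (F f : R -> R) (a b : R) : a <= b ->
  (forall x : R, is_derive x (1 : R) F (f x)) -> continuous f ->
  \int[leb]_(x in `[a, b]) f x = F b - F a.
Proof.
move=> ab dF cf; move: ab; rewrite le_eqVlt => /predU1P[->|ab].
  by rewrite set_itv1 Rintegral_set1 subrr.
have cF : continuous F.
  move=> x; apply: differentiable_continuous; apply/derivable1_diffP.
  by case: (dF x).
rewrite /Rintegral (@continuous_FTC2 _ f F)//.
- exact: continuous_subspaceT.
- split; first by move=> x _; case: (dF x).
  + by apply: cvg_at_right_filter; exact: cF.
  + by apply: cvg_at_left_filter; exact: cF.
- by move=> x _; rewrite derive1E; case: (dF x).
Qed.

End Rectangle.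

(** * Pointwise calculus in Euclidean space *)

Section PointwiseContinuity.
Context {R : realType} {T : topologicalType}.
Implicit Types (f g : T -> R) (x : T).

Lemma contM f g x : {for x, continuous f} -> {for x, continuous g} ->
  {for x, continuous (fun z => f z * g z)}.
Proof. exact: continuousM. Qed.

Lemma contD f g x : {for x, continuous f} -> {for x, continuous g} ->
  {for x, continuous (fun z => f z + g z)}.
Proof. by move=> cf cg; exact: cvgD. Qed.

Lemma contB f g x : {for x, continuous f} -> {for x, continuous g} ->
  {for x, continuous (fun z => f z - g z)}.
Proof. by move=> cf cg; exact: cvgB. Qed.

Lemma cont_cst (r : R) x : {for x, continuous (fun=> r)}.
Proof. exact: cvg_cst. Qed.

Lemma cont_sum n (F : 'I_n -> T -> R) x :
  (forall i, {for x, continuous (F i)}) ->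
  {for x, continuous (fun z => \sum_i F i z)}.
Proof.
move=> cF; rewrite /continuous_at; apply: (@cvg_big _ _ +%R) => //.
  exact: add_continuous.
by move=> i _; exact: cF.
Qed.

End PointwiseContinuity.

Section Geometry.
Context {R : realType} {d : nat}.
Implicit Types (x y p w : 'rV[R]_d).

Lemma on_sphereE p : on_sphere p <-> dotp p p = 1.
Proof.
rewrite /on_sphere /enorm; split => [h|->]; last exact: sqrtr1.
have p0 : 0 <= dotp p p by apply: sumr_ge0 => i _; rewrite -expr2 sqr_ge0.
by rewrite -(sqr_sqrtr p0) h expr1n.
Qed.

Lemma dotpZl a x y : dotp (a *: x) y = a * dotp x y.
Proof. by rewrite /dotp mulr_sumr; apply: eq_bigr => i _; rewrite !mxE mulrA. Qed.

Lemma dotpC x y : dotp x y = dotp y x.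
Proof. by apply: eq_bigr => i _; rewrite mulrC. Qed.

Lemma dotpZr a x y : dotp x (a *: y) = a * dotp x y.
Proof. by rewrite dotpC dotpZl dotpC. Qed.

Lemma dotpDl x y p : dotp (x + y) p = dotp x p + dotp y p.
Proof. by rewrite /dotp -big_split; apply: eq_bigr => i _; rewrite !mxE mulrDl. Qed.

Lemma dotpDr x y p : dotp p (x + y) = dotp p x + dotp p y.
Proof. by rewrite dotpC dotpDl dotpC [dotp y _]dotpC. Qed.

Lemma dotp_basisr x j : dotp x ('e_j) = x 0 j.
Proof.
rewrite /dotp (bigD1 j)//= big1 ?addr0 => [|i ij]; last first.
  by rewrite mxE (negbTE ij) andbF mulr0.
by rewrite mxE !eqxx mulr1.
Qed.

Lemma dotp_ge0 x : 0 <= dotp x x.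
Proof. by apply: sumr_ge0 => i _; rewrite -expr2 sqr_ge0. Qed.

Lemma dotp_eq0 x : (dotp x x == 0) = (x == 0).
Proof.
apply/idP/eqP => [|->]; last by rewrite /dotp big1// => i _; rewrite mxE mul0r.
rewrite psumr_eq0 => [/allP h|i _]; last by rewrite -expr2 sqr_ge0.
apply/rowP => i; rewrite mxE; apply/eqP.
by have /= := h i (mem_index_enum _); rewrite mulf_eq0 orbb.
Qed.

Lemma sphere_neq0 p : on_sphere p -> p != 0.
Proof. by move=> /on_sphereE pp; rewrite -dotp_eq0 pp oner_neq0. Qed.

Lemma enorm_gt0 x : x != 0 -> 0 < enorm x.
Proof. by move=> x0; rewrite /enorm sqrtr_gt0 lt_def dotp_eq0 x0 dotp_ge0. Qed.

Lemma enorm_sqr x : enorm x ^+ 2 = dotp x x.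
Proof. by rewrite /enorm sqr_sqrtr// dotp_ge0. Qed.

Lemma unit_dir_id p : on_sphere p -> unit_dir p = p.
Proof. by rewrite /unit_dir => ->; rewrite invr1 scale1r. Qed.

Lemma unit_dirZ (s : R) x : 0 < s -> unit_dir (s *: x) = unit_dir x.
Proof.
move=> s0; rewrite /unit_dir /enorm dotpZl dotpZr mulrA sqrtrM ?mulr_ge0 ?ltW//.
rewrite -expr2 sqrtr_sqr gtr0_norm// scalerA invfM mulrAC mulVf ?mul1r//.
exact: lt0r_neq0.
Qed.

Lemma dotp_continuous w : continuous (dotp w : 'rV[R]_d -> R).
Proof.
move=> x; apply: cont_sum => i; apply: contM; first exact: cont_cst.
exact: coord_continuous.
Qed.

Lemma dotp_diag_continuous : continuous (fun x => dotp x x).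
Proof.
by move=> x; apply: cont_sum => i; apply: contM; exact: coord_continuous.
Qed.

(** Compactness is what later bounds time derivatives uniformly in p. Boundedness refers to the sup
    norm: each squared coordinate is a term of [dotp p p]. *)
Lemma sphere_compact : compact [set p : 'rV[R]_d | on_sphere p].
Proof.
apply: bounded_closed_compact.
  exists 1; split; first exact: num_real.
  move=> M M1 p /= /on_sphereE pp; rewrite /Num.Def.normr/= mx_normrE.
  rewrite (le_trans _ (ltW M1))//; apply: bigmax_le => // -[i j] _ /=.
  rewrite ord1 -(@ler_pXn2r _ 2)// ?nnegrE// expr1n -[leRHS]pp.
  rewrite real_normK ?num_real// /dotp (bigD1 j)//= -expr2 lerDl.
  by apply: sumr_ge0 => k _; rewrite -expr2 sqr_ge0.
rewrite [X in closed X](_ : _ = (fun x => dotp x x) @^-1` [set 1]).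
  apply: preimage_closed; last exact: closed_eq.
  by move=> x _; exact: dotp_diag_continuous.
by apply/seteqP; split => p /on_sphereE.
Qed.

End Geometry.

Section PointwiseDerivative.
Context {R : realType} {V : normedModType R}.
Implicit Types (f g : V -> R) (x v : V).

Lemma is_derive_add f g x v (df dg : R) :
  is_derive x v f df -> is_derive x v g dg ->
  is_derive x v (fun y => f y + g y) (df + dg).
Proof. exact: is_deriveD. Qed.

Lemma is_derive_sub f g x v (df dg : R) :
  is_derive x v f df -> is_derive x v g dg ->
  is_derive x v (fun y => f y - g y) (df - dg).
Proof. exact: is_deriveB. Qed.

Lemma is_derive_opp f x v (df : R) :
  is_derive x v f df -> is_derive x v (fun y => - f y) (- df).
Proof. exact: is_deriveN. Qed.

Lemma is_derive_mul f g x v (df dg : R) :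
  is_derive x v f df -> is_derive x v g dg ->
  is_derive x v (fun y => f y * g y) (f x * dg + g x * df).
Proof. exact: is_deriveM. Qed.

Lemma is_derive_mulr f (c : R) x v (df : R) :
  is_derive x v f df -> is_derive x v (fun y => f y * c) (df * c).
Proof.
move=> hf; apply: (is_derive_eq (is_derive_mul hf (is_derive_cst c x v))).
by rewrite mulr0 add0r mulrC.
Qed.

Lemma is_derive_mull f (c : R) x v (df : R) :
  is_derive x v f df -> is_derive x v (fun y => c * f y) (c * df).
Proof. exact: is_deriveZ. Qed.

Lemma is_derive_sqr f x v (df : R) :
  is_derive x v f df -> is_derive x v (fun y => f y ^+ 2) (2 * f x * df).
Proof.
by move=> hf; apply: (is_derive_eq (is_derive_mul hf hf)); ring.
Qed.

Lemma is_derive_bigsum n (F : 'I_n -> V -> R) (dF : 'I_n -> R) x v :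
  (forall i, is_derive x v (F i) (dF i)) ->
  is_derive x v (fun y => \sum_i F i y) (\sum_i dF i).
Proof.
move=> hF; rewrite (_ : (fun y => _) = \sum_i F i); first exact: is_derive_sum.
by apply/funext => y; rewrite fct_sumE.
Qed.

Lemma is_derive_curve (U : normedModType R) (F : V -> U) (c : R -> V) (t : R)
    (dc : V) :
  differentiable F (c t) -> is_derive t (1 : R) c dc ->
  is_derive t (1 : R) (fun s => F (c s)) ('D_dc F (c t)).
Proof.
move=> dF [cd cv].
have cdiff : differentiable c t by exact/derivable1_diffP.
have comp : differentiable (F \o c) t by exact: differentiable_comp.
apply: DeriveDef; first exact: diff_derivable.
rewrite -[fun s => _]/(F \o c) deriveE// diff_comp//=.
by rewrite deriveE// -cv deriveE.
Qed.

End PointwiseDerivative.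

(** * Integration on the sphere *)

Section Charts.
Context {R : realType}.

Lemma circle_ptE (a : R) :
  circle_pt a = cos a *: 'e_0 + sin a *: 'e_(1) :> 'rV[R]_2.
Proof.
apply/rowP => -[[|[|//]] hi]; rewrite !mxE/= ?mulr0 ?mulr1 ?addr0 ?add0r//.
Qed.

Lemma circle_pt_sphere (a : R) : on_sphere (circle_pt a : 'rV[R]_2).
Proof.
apply/on_sphereE; rewrite /dotp !big_ord_recl big_ord0 !mxE/= addr0 -!expr2.
exact: cos2Dsin2.
Qed.

Lemma circle_pt_continuous : continuous (circle_pt : R -> 'rV[R]_2).
Proof.
rewrite (_ : circle_pt = fun a => cos a *: 'e_0 + sin a *: 'e_(1)); last first.
  by apply/funext => a; exact: circle_ptE.
move=> a; apply: cvgD; apply: cvgZr_tmp;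
  [exact: continuous_cos|exact: continuous_sin].
Qed.

Let e2 : 'I_3 := lift 0 1.

Lemma sphere2_ptE (z : R * R) :
  sphere2_pt z = (sin z.2 * cos z.1) *: 'e_0 + (sin z.2 * sin z.1) *: 'e_(1)
     + cos z.2 *: 'e_(e2) :> 'rV[R]_3.
Proof.
by apply/rowP => -[[|[|[|//]]] hi]; rewrite !mxE/= ?mulr0 ?mulr1 ?addr0 ?add0r.
Qed.

Lemma sphere2_pt_sphere (z : R * R) : on_sphere (sphere2_pt z : 'rV[R]_3).
Proof.
apply/on_sphereE; rewrite /dotp !big_ord_recl big_ord0 !mxE/= addr0 -!expr2.
have := cos2Dsin2 z.1; have := cos2Dsin2 z.2.
rewrite !exprMn => h2 h1; rewrite addrA -mulrDr h1 mulr1 addrC//.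
Qed.

Lemma comp_fst_continuous (f : R -> R) : continuous f ->
  continuous (fun z : R * R => f z.1).
Proof.
by move=> cf z; apply: (@continuous_comp _ _ _ fst); [exact: cvg_fst|exact: cf].
Qed.

Lemma comp_snd_continuous (f : R -> R) : continuous f ->
  continuous (fun z : R * R => f z.2).
Proof.
by move=> cf z; apply: (@continuous_comp _ _ _ snd); [exact: cvg_snd|exact: cf].
Qed.

Lemma sphere2_pt_continuous : continuous (sphere2_pt : R * R -> 'rV[R]_3).
Proof.
rewrite (_ : sphere2_pt = fun z : R * R => (sin z.2 * cos z.1) *: 'e_0
    + (sin z.2 * sin z.1) *: 'e_(1) + cos z.2 *: 'e_(e2)); last first.
  by apply/funext => a; exact: sphere2_ptE.
have [cs cc] := (@continuous_sin R, @continuous_cos R).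
move=> z; apply: cvgD; first apply: cvgD; apply: cvgZr_tmp.
- by apply: contM; [exact: comp_snd_continuous|exact: comp_fst_continuous].
- by apply: contM; [exact: comp_snd_continuous|exact: comp_fst_continuous].
- exact: comp_snd_continuous.
Qed.

(* Functions on the sphere are arbitrary elsewhere, so continuity is only
   required at unit vectors. *)
Definition scont d (g : 'rV[R]_d -> R) : Prop :=
  forall p, on_sphere p -> {for p, continuous g}.

Notation leb := (@lebesgue_measure R).
Notation leb2 := (leb \x leb)%E.

(* A common form for the circle and the 2-sphere, which lets the integral
   calculus be developed once. *)
Record sphere_chart d := SphereChart {
  chart_disp : measure_display;
  chart_type : measurableType chart_disp;
  chart_mu : {measure set chart_type -> \bar R};
  chart_dom : set chart_type;
  chart_pt : chart_type -> 'rV[R]_d;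
  chart_wt : chart_type -> R;
  chart_cst : R;
  chart_dom_measurable : measurable chart_dom;
  chart_sphere : forall z, on_sphere (chart_pt z);
  chart_wt_ge0 : forall z, chart_dom z -> 0 <= chart_wt z;
  chart_wt_measurable : measurable_fun chart_dom chart_wt;
  chart_cst_ge0 : 0 <= chart_cst;
  chart_int : forall g : 'rV[R]_d -> R, sphere_int g =
    chart_cst * \int[chart_mu]_(z in chart_dom) (g (chart_pt z) * chart_wt z);
  chart_integrable : forall g : 'rV[R]_d -> R, sphere_integrable g <->
    chart_mu.-integrable chart_dom (fun z => (g (chart_pt z) * chart_wt z)%:E);
  chart_measurable : forall g : 'rV[R]_d -> R, sphere_measurable g <->
    measurable_fun chart_dom (fun z => g (chart_pt z));
  chart_cont : forall g : 'rV[R]_d -> R, scont g ->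
    sphere_measurable g /\ sphere_integrable g;
  chart_int1 : sphere_int (fun _ : 'rV[R]_d => 1) = 1 :> R }.

Lemma pi2_gt0 : 0 < 2 * pi :> R.
Proof. by rewrite mulr_gt0 ?pi_gt0. Qed.

Lemma Rintegral_sin : \int[leb]_(x in `[0, pi]) sin x = 2 :> R.
Proof.
have -> : \int[leb]_(x in `[0, pi]) sin x = - cos pi - (- cos 0) :> R.
  apply: (@Rintegral_derive _ (fun x => - cos x) sin); first exact: pi_ge0.
    move=> x; rewrite -[sin x]opprK; exact: is_deriveN.
  exact: continuous_sin.
by rewrite cospi cos0 !opprK.
Qed.

Lemma Rintegral_const (a b r : R) : a <= b ->
  \int[leb]_(x in `[a, b]) r = r * (b - a).
Proof.
move=> ab; rewrite mulrBr; apply: (@Rintegral_derive _ (fun x => r * x)) => //.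
  move=> x; rewrite -[X in is_derive _ _ _ X]mulr1.
  exact: (is_deriveZ r (is_derive_id x 1)).
by move=> x; exact: cont_cst.
Qed.

Lemma sphere_chart2 : sphere_chart 2.
Proof.
apply: (@SphereChart 2 _ _ leb circle_dom circle_pt (fun=> 1) (2 * pi)^-1).
- by rewrite /circle_dom.
- exact: circle_pt_sphere.
- by [].
- exact: measurable_cst.
- by rewrite invr_ge0 ltW// pi2_gt0.
- move=> g; rewrite /sphere_int/=; congr (_ * _).
  by apply: eq_Rintegral => z _; rewrite mulr1.
- move=> g; rewrite /sphere_integrable/=.
  by under [in X in _ <-> X]eq_fun do rewrite mulr1.
- by [].
- move=> g cg.
  have cc : continuous (fun a => g (circle_pt a)).
    move=> a; apply: continuous_comp; first exact: circle_pt_continuous.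
    by apply: cg; exact: circle_pt_sphere.
  split; rewrite /sphere_measurable /sphere_integrable/=.
    by apply: measurable_funTS; exact: continuous_measurable_fun.
  exact: continuous_integrable.
- rewrite /sphere_int/= Rintegral_const ?ltW ?pi2_gt0// mul1r subr0 mulVf//.
  by rewrite lt0r_neq0// pi2_gt0.
Qed.

Lemma sphere_chart3 : sphere_chart 3.
Proof.
have cs : continuous (fun z : R * R => sin z.2).
  exact: (comp_snd_continuous (@continuous_sin R)).
apply: (@SphereChart 3 _ _ leb2 sphere2_dom sphere2_pt (fun z => sin z.2) (4 * pi)^-1).
- exact: rectangle_measurable.
- exact: sphere2_pt_sphere.
- move=> z [_ /= zpi]; exact: sin_ge0_pi.
- by apply: measurable_funTS; exact: continuous2_measurable.
- by rewrite invr_ge0 mulr_ge0// pi_ge0.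
- by [].
- by [].
- by [].
- move=> g cg.
  have cc : continuous (fun z => g (sphere2_pt z)).
    move=> a; apply: continuous_comp; first exact: sphere2_pt_continuous.
    by apply: cg; exact: sphere2_pt_sphere.
  split; rewrite /sphere_measurable /sphere_integrable/=.
    by apply: measurable_funTS; exact: continuous2_measurable.
  apply: (@continuous2_integrable _ (fun z => g (sphere2_pt z) * sin z.2)).
  by move=> z; apply: contM; [exact: cc|exact: cs].
- rewrite /sphere_int/= Rintegral_rectangle12; last first.
    by move=> z; apply: contM; [exact: cont_cst|exact: cs].
  transitivity ((4 * pi)^-1 * \int[leb]_(x in `[0 : R, 2 * pi]) (2 : R)).
    congr (_ * _); apply: eq_Rintegral => x _; rewrite -Rintegral_sin.
    by apply: eq_Rintegral => y _; rewrite mul1r.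
  rewrite Rintegral_const ?ltW ?pi2_gt0// subr0.
  have -> : 2 * (2 * pi) = 4 * pi :> R by ring.
  by rewrite mulVf// lt0r_neq0// mulr_gt0// pi_gt0.
Qed.

Lemma sphere_chartP d : d = 2%N \/ d = 3%N -> inhabited (sphere_chart d).
Proof.
by case=> ->; constructor; [exact: sphere_chart2|exact: sphere_chart3].
Qed.

End Charts.

Arguments chart_pt {R d} s _.
Arguments chart_wt {R d} s _.
Arguments chart_mu {R d} s.
Arguments chart_dom {R d} s.
Arguments chart_cst {R d} s.
Arguments chart_integrable {R d} s g.
Arguments chart_dom_measurable {R d} s.

Section SphereIntegral.
Context {R : realType} {d : nat} (hd : d = 2%N \/ d = 3%N).
Implicit Types f g : 'rV[R]_d -> R.
Notation sint := (@sphere_int R d).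

Lemma scont_cst (r : R) : scont (fun _ : 'rV[R]_d => r).
Proof. by move=> p _; exact: cont_cst. Qed.

Lemma scontD f g : scont f -> scont g -> scont (fun p => f p + g p).
Proof. by move=> cf cg p sp; apply: contD; [exact: cf|exact: cg]. Qed.

Lemma scontB f g : scont f -> scont g -> scont (fun p => f p - g p).
Proof. by move=> cf cg p sp; apply: contB; [exact: cf|exact: cg]. Qed.

Lemma scontM f g : scont f -> scont g -> scont (fun p => f p * g p).
Proof. by move=> cf cg p sp; apply: contM; [exact: cf|exact: cg]. Qed.

Lemma scontX f n : scont f -> scont (fun p => f p ^+ n).
Proof.
move=> cf; elim: n => [|n IH].
  by rewrite (_ : (fun p => _) = fun=> 1)//; exact: scont_cst.
rewrite (_ : (fun p => _) = fun p => f p * f p ^+ n); first exact: scontM.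
by apply/funext => p; rewrite exprS.
Qed.

Lemma scont_sum n (F : 'I_n -> 'rV[R]_d -> R) : (forall i, scont (F i)) ->
  scont (fun p => \sum_i F i p).
Proof. by move=> cF p sp; apply: cont_sum => i; exact: cF. Qed.

Lemma scont_dotp (w : 'rV[R]_d) : scont (dotp w).
Proof. by move=> p _; exact: dotp_continuous. Qed.

Lemma scont_coord (i : 'I_d) : scont (fun p : 'rV[R]_d => p 0 i).
Proof. by move=> p _; exact: coord_continuous. Qed.

Lemma scont_integrable f : scont f -> sphere_integrable f.
Proof. by have [ch] := @sphere_chartP R _ hd; move=> /(chart_cont ch)[]. Qed.

Lemma scont_measurable f : scont f -> sphere_measurable f.
Proof. by have [ch] := @sphere_chartP R _ hd; move=> /(chart_cont ch)[]. Qed.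

Lemma sphere_integrableD f g : sphere_integrable f -> sphere_integrable g ->
  sphere_integrable (fun p => f p + g p).
Proof.
have [ch] := @sphere_chartP R _ hd; rewrite !(chart_integrable ch) => fi gi.
apply: eq_integrable (integrableD (chart_dom_measurable ch) fi gi).
  exact: chart_dom_measurable.
by move=> z _; rewrite mulrDl EFinD.
Qed.

Lemma sphere_integrableZ (r : R) f : sphere_integrable f ->
  sphere_integrable (fun p => r * f p).
Proof.
have [ch] := @sphere_chartP R _ hd; rewrite !(chart_integrable ch) => fi.
apply: eq_integrable (integrableZl (chart_dom_measurable ch) r fi).
  exact: chart_dom_measurable.
by move=> z _; rewrite -mulrA EFinM.
Qed.

Lemma sphere_integrable_le f g : sphere_measurable f -> sphere_integrable g ->
  (forall p, on_sphere p -> `|f p| <= g p) -> sphere_integrable f.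
Proof.
have [ch] := @sphere_chartP R _ hd.
rewrite !(chart_integrable ch) (chart_measurable ch) => mf gi fg.
apply: le_integrable gi; first exact: chart_dom_measurable.
  apply/measurable_EFinP; apply: measurable_funM => //.
  exact: chart_wt_measurable.
move=> z zD /=; rewrite lee_fin !normrM.
apply: ler_wpM2r => //; rewrite (le_trans (fg _ (chart_sphere _)))//.
exact: ler_norm.
Qed.

Lemma eq_sint f g : (forall p, on_sphere p -> f p = g p) -> sint f = sint g.
Proof.
have [ch] := @sphere_chartP R _ hd => fg; rewrite !(chart_int ch).
by congr (_ * _); apply: eq_Rintegral => z _; rewrite fg//; exact: chart_sphere.
Qed.

Lemma sintD f g : sphere_integrable f -> sphere_integrable g ->
  sint (fun p => f p + g p) = sint f + sint g.
Proof.
have [ch] := @sphere_chartP R _ hd; rewrite !(chart_integrable ch) => fi gi.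
rewrite !(chart_int ch) -mulrDr; congr (_ * _).
rewrite -RintegralD//; last exact: chart_dom_measurable.
by apply: eq_Rintegral => z _; rewrite mulrDl.
Qed.

Lemma sintZ (r : R) f : sphere_integrable f ->
  sint (fun p => r * f p) = r * sint f.
Proof.
have [ch] := @sphere_chartP R _ hd; rewrite !(chart_integrable ch) => fi.
rewrite !(chart_int ch) mulrCA; congr (_ * _).
rewrite -RintegralZl//; last exact: chart_dom_measurable.
by apply: eq_Rintegral => z _; rewrite mulrA.
Qed.

Lemma sintB f g : sphere_integrable f -> sphere_integrable g ->
  sint (fun p => f p - g p) = sint f - sint g.
Proof.
move=> fi gi; rewrite -mulN1r -sintZ// -sintD//; last exact: sphere_integrableZ.
by apply: eq_sint => p _; rewrite mulN1r.
Qed.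

Lemma sint_ge0 f : (forall p, on_sphere p -> 0 <= f p) -> 0 <= sint f.
Proof.
have [ch] := @sphere_chartP R _ hd => f0; rewrite (chart_int ch).
apply: mulr_ge0; first exact: chart_cst_ge0.
apply: Rintegral_ge0 => z zD; apply: mulr_ge0; last exact: chart_wt_ge0.
by apply: f0; exact: chart_sphere.
Qed.

Lemma le_sint f g : sphere_integrable f -> sphere_integrable g ->
  (forall p, on_sphere p -> f p <= g p) -> sint f <= sint g.
Proof.
move=> fi gi fg; rewrite -subr_ge0 -sintB//.
by apply: sint_ge0 => p sp; rewrite subr_ge0 fg.
Qed.

Lemma sint_cst (r : R) : sint (fun=> r) = r.
Proof.
have [ch] := @sphere_chartP R _ hd; have := chart_int1 ch.
have i1 := scont_integrable (@scont_cst 1).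
by move=> h; rewrite -[RHS]mulr1 -h -sintZ//; apply: eq_sint => p _; rewrite mulr1.
Qed.

Lemma sint_sum n (F : 'I_n -> 'rV[R]_d -> R) : (forall i, scont (F i)) ->
  sint (fun p => \sum_i F i p) = \sum_i sint (F i).
Proof.
elim: n F => [|n IH] F cF.
  by rewrite big_ord0 -[RHS]sint_cst; apply: eq_sint => p _; rewrite big_ord0.
rewrite big_ord_recl -IH// -sintD; last 2 first.
- exact: scont_integrable.
- by apply: scont_integrable; exact: scont_sum.
by apply: eq_sint => p _; rewrite big_ord_recl.
Qed.

Lemma sint_variance f : scont f ->
  sint (fun p => (f p - sint f) ^+ 2) = sint (fun p => f p ^+ 2) - sint f ^+ 2.
Proof.
move=> cf; set m := sint f.
have c2 : scont (fun p => f p ^+ 2) by exact: scontX.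
transitivity (sint (fun p => f p ^+ 2 + (- (2 * m) * f p + m ^+ 2))).
  by apply: eq_sint => p _; ring.
rewrite sintD; last 2 first.
- exact: scont_integrable.
- apply: scont_integrable; apply: scontD; last exact: scont_cst.
  by apply: scontM => //; exact: scont_cst.
rewrite sintD; last 2 first.
- by apply: scont_integrable; apply: scontM => //; exact: scont_cst.
- by apply: scont_integrable; exact: scont_cst.
rewrite sintZ ?sint_cst; last exact: scont_integrable.
by rewrite -/m; ring.
Qed.

(** The mean of (r f + s g)^2 is a nonnegative quadratic form in (r, s). Its value at (-B, A) is A
    (A C - B^2), which settles the case A > 0. *)
Lemma sint_cauchy_schwarz f g : scont f -> scont g ->
  sint (fun p => f p * g p) ^+ 2 <=
  sint (fun p => f p ^+ 2) * sint (fun p => g p ^+ 2).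
Proof.
move=> cf cg.
set A := sint (fun p => f p ^+ 2); set B := sint (fun p => f p * g p).
set C := sint (fun p => g p ^+ 2).
have quad r s : 0 <= r ^+ 2 * A + (2 * r * s) * B + s ^+ 2 * C.
  have : 0 <= sint (fun p => (r * f p + s * g p) ^+ 2).
    by apply: sint_ge0 => p _; rewrite sqr_ge0.
  have i1 : sphere_integrable (fun p => f p ^+ 2).
    by apply: scont_integrable; exact: scontX.
  have i2 : sphere_integrable (fun p => f p * g p).
    by apply: scont_integrable; exact: scontM.
  have i3 : sphere_integrable (fun p => g p ^+ 2).
    by apply: scont_integrable; exact: scontX.
  suff -> : sint (fun p => (r * f p + s * g p) ^+ 2) =
      r ^+ 2 * A + (2 * r * s) * B + s ^+ 2 * C by [].
  transitivity (sint (fun p => r ^+ 2 * f p ^+ 2 + 2 * r * s * (f p * g p) +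
      s ^+ 2 * g p ^+ 2)).
    by apply: eq_sint => p _; ring.
  rewrite sintD; [|by apply: sphere_integrableD; exact: sphere_integrableZ
                  |exact: sphere_integrableZ].
  by rewrite sintD ?sintZ//; exact: sphere_integrableZ.
have A0 : 0 <= A by apply: sint_ge0 => p _; rewrite sqr_ge0.
have [A1|A1] := eqVneq A 0.
  have [->|B0] := eqVneq B 0; first by rewrite expr0n/= A1 mul0r.
  (* With A = 0 the form is linear in r, and this r makes its value -1. *)
  exfalso; have := quad (- (C + 1) / (2 * B)) 1.
  rewrite A1 (_ : _ + _ + _ = -1) ?oppr_ge0 ?ler10//.
  by field; rewrite B0.
have Ap : 0 < A by rewrite lt_def A1.
have := quad (- B) A.
rewrite (_ : _ + _ = A * (A * C - B ^+ 2)); last ring.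
by rewrite pmulr_rge0// subr_ge0.
Qed.

End SphereIntegral.

(** * Differentiation under the spherical integral *)

Section TimeDerivative.
Context {R : realType} {d : nat} (hd : d = 2%N \/ d = 3%N).
Notation sint := (@sphere_int R d).

(** Joint continuity of the time derivative, rather than continuity for each p, yields a majorant
    uniform over the sphere. The origin is left out because the functions concerned are constant
    along rays. *)
Definition time_C1 (f : 'rV[R]_d -> R -> R) : Prop :=
  forall p s, p != 0 -> 0 < s ->
  [/\ derivable (f p) s 1,
      {for (p, s), continuous (fun z : 'rV[R]_d * R => f z.1 z.2)} &
      {for (p, s), continuous (fun z : 'rV[R]_d * R => 'D_1 (f z.1) z.2)}].

Lemma cont_slice (T : topologicalType) (F : 'rV[R]_d * T -> R) p s :
  {for (p, s), continuous F} -> {for p, continuous (fun q => F (q, s))}.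
Proof.
move=> cF; apply: (@continuous_comp _ _ _ (fun q => (q, s))) => //.
by apply: continuous_pair; [exact: cvg_id|exact: cst_continuous].
Qed.

Lemma time_C1_scont f s : time_C1 f -> 0 < s -> scont (f ^~ s).
Proof.
by move=> fC s0 p sp; have [_ /cont_slice + _] := fC p s (sphere_neq0 sp) s0.
Qed.

Lemma is_derive_sint f (t : R) : time_C1 f -> 0 < t ->
  is_derive t (1 : R) (fun s => sint (f ^~ s)) (sint (fun p => 'D_1 (f p) t)).
Proof.
move=> fC t0; have [ch] := @sphere_chartP R _ hd.
pose F s z := f (chart_pt ch z) s * chart_wt ch z.
have dF (s : R) z : 0 < s -> is_derive s (1 : R) (F ^~ z)
    ('D_1 (f (chart_pt ch z)) s * chart_wt ch z).
  move=> s0; have [df _ _] := fC _ _ (sphere_neq0 (chart_sphere z)) s0.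
  have dP : is_derive s (1 : R) (f (chart_pt ch z)) ('D_1 (f (chart_pt ch z)) s).
    exact/derivableP.
  exact: is_derive_mulr.
(* The window from t / 2 to 2 t stays away from time 0, where no regularity is assumed. Its product
   with the sphere is compact, so the time derivative is bounded there by a constant M. *)
have K : compact ([set p : 'rV[R]_d | on_sphere p] `*` `[t / 2, t * 2]%classic).
  by apply: compact_setX; [exact: sphere_compact|exact: segment_compact].
have [|M M0 fM] := @compact_bound _ _ _
    (fun z : 'rV[R]_d * R => 'D_1 (f z.1) z.2) K.
  apply: continuous_in_subspaceT => -[p s] /set_mem[/= sp].
  rewrite in_itv/= => /andP[ts _].
  have s0 : 0 < s by rewrite (lt_le_trans _ ts)// divr_gt0.
  by have [] := fC p s (sphere_neq0 sp) s0.
have itt : `]t / 2, t * 2[%classic t by rewrite /= in_itv/=; lra.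
have ipos (r : R) : `]t / 2, t * 2[%classic r -> 0 < r.
  by rewrite /= in_itv/=; lra.
have intF (s : R) : `]t / 2, t * 2[%classic s ->
    (chart_mu ch).-integrable (chart_dom ch) (EFin \o F s).
  move=> /ipos s0; apply/(chart_integrable ch (f ^~ s)).
  by apply: scont_integrable => //; exact: time_C1_scont.
have dF1 (s : R) z : `]t / 2, t * 2[%classic s -> chart_dom ch z ->
    derivable (F ^~ z) s 1.
  by move=> /ipos s0 _; case: (dF s z s0).
(* The absolute value makes the majorant nonnegative everywhere; the weight has a sign only on the
   chart domain. *)
pose G z := `|M * chart_wt ch z|.
have intG : (chart_mu ch).-integrable (chart_dom ch) (EFin \o G).
  have := scont_integrable hd (@scont_cst R d M).
  by move/(chart_integrable ch) => /integrable_norm.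
have G_ub (s : R) z : `]t / 2, t * 2[%classic s -> chart_dom ch z ->
    `|partial1of2 F s z| <= G z.
  move=> ts _; rewrite partial1of2E (derive_val (is_derive := dF s z (ipos _ ts))).
  rewrite /G !normrM ler_wpM2r// (ger0_norm M0).
  apply: (fM (chart_pt ch z, s)); split; first exact: chart_sphere.
  by move: ts; rewrite /= !in_itv/=; lra.
have mD := chart_dom_measurable ch.
have G0 z : 0 <= G z by rewrite normr_ge0.
have dd := derivable_under_integral mD itt intF dF1 G0 intG G_ub.
have de := differentiation_under_integral mD itt intF dF1 G0 intG G_ub.
rewrite (_ : (fun s => sint (f ^~ s)) = (fun s => chart_cst ch *:
    \int[chart_mu ch]_(z in chart_dom ch) F s z)); last first.
  by apply/funext => s; rewrite (chart_int ch).
apply: is_derive_eq; first exact: (is_deriveZ _ (derivableP dd)).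
rewrite -derive1E de (chart_int ch); congr (_ * _).
apply: eq_Rintegral => z _; rewrite partial1of2E.
by rewrite (derive_val (is_derive := dF t z t0)).
Qed.

End TimeDerivative.

(** * Rotation fields and integration by parts *)

Section DirectionalDerivatives.
Context {R : realType} {d : nat}.
Implicit Types (F G : 'rV[R]_d -> R) (x p v w : 'rV[R]_d).

Lemma derive_sum_basis F x v : differentiable F x ->
  'D_v F x = \sum_j v 0 j * 'D_('e_j) F x.
Proof.
move=> dF; rewrite deriveE// {1}(row_sum_delta v) linear_sum.
by apply: eq_bigr => j _; rewrite linearZ/= deriveE.
Qed.

Lemma is_derive_rV (V : normedModType R) (c : V -> 'rV[R]_d) (t u : V)
    (dc : 'rV[R]_d) :
  (forall j, is_derive t u (fun s => c s 0 j) (dc 0 j)) -> is_derive t u c dc.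
Proof.
move=> h; have dc' : derivable c t u.
  by apply/derivable_mxP => i j; rewrite ord1; case: (h j).
apply: DeriveDef => //; rewrite derive_mx//; apply/rowP => j; rewrite mxE.
by case: (h j).
Qed.

(* Zero-homogeneous extensions are singular at the origin. *)
Definition C1 F := forall x, x != 0 ->
  differentiable F x /\ forall j, {for x, continuous ('D_('e_j) F)}.

Definition C2 F := C1 F /\ forall j, C1 ('D_('e_j) F).

Definition angular F (i j : 'I_d) p : R :=
  p 0 i * 'D_('e_j) F p - p 0 j * 'D_('e_i) F p.

Lemma C1_differentiable F x : C1 F -> x != 0 -> differentiable F x.
Proof. by move=> cF /cF[]. Qed.

Lemma C1_scont F : C1 F -> scont F.
Proof.
by move=> cF p /sphere_neq0 /cF[dF _]; exact: differentiable_continuous.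
Qed.

Lemma C1_dscont F j : C1 F -> scont ('D_('e_j) F).
Proof. by move=> cF p /sphere_neq0 /cF[_]. Qed.

Lemma C2_C1 F : C2 F -> C1 F. Proof. by case. Qed.

Lemma angular_scont F i j : C1 F -> scont (angular F i j).
Proof.
move=> cF; apply: scontB; apply: scontM;
  [exact: scont_coord|exact: C1_dscont|exact: scont_coord|exact: C1_dscont].
Qed.

Lemma C1_is_derive F x v : C1 F -> x != 0 -> is_derive x v F ('D_v F x).
Proof.
by move=> cF x0; apply: derivableP; apply: diff_derivable; exact: C1_differentiable.
Qed.

Lemma neq0_near x : x != 0 -> \forall y \near x, y != 0.
Proof.
rewrite -dotp_eq0 => x0; have := cvgr_neq0 _ (@dotp_diag_continuous R d x) x0.
move=> H; near=> y; rewrite -dotp_eq0; near: y; exact: H.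
Unshelve. all: by end_near.
Qed.

(** Formulas for derivatives are established only off the origin. The complement of the origin is
    open, so they hold near x, and continuity at x carries over. *)
Lemma cont_neq0 (f g : 'rV[R]_d -> R) x : x != 0 ->
  (forall y, y != 0 -> f y = g y) ->
  {for x, continuous g} -> {for x, continuous f}.
Proof.
move=> x0 fg cg; suff : f y @[y --> x] --> g x by rewrite -fg.
apply: cvg_trans cg; apply: near_eq_cvg; first exact: (nbhs_filter x).
change (\forall y \near x, g y = f y).
by near=> y; rewrite fg//; near: y; exact: neq0_near.
Unshelve. all: by end_near.
Qed.

Lemma C1B F G : C1 F -> C1 G -> C1 (fun x => F x - G x).
Proof.
move=> cF cG x x0; have [[dF cF'] [dG cG']] := (cF _ x0, cG _ x0).
split; first exact: differentiableB.
move=> j; apply: (@cont_neq0 _ (fun y => 'D_('e_j) F y - 'D_('e_j) G y)) => //.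
  move=> y y0; apply/derive_val/is_derive_sub; exact: C1_is_derive.
by apply: contB; [exact: cF'|exact: cG'].
Qed.

Lemma C1M F G : C1 F -> C1 G -> C1 (fun x => F x * G x).
Proof.
move=> cF cG x x0; have [[dF cF'] [dG cG']] := (cF _ x0, cG _ x0).
split; first exact: differentiableM.
move=> j; apply: (@cont_neq0 _
  (fun y => F y * 'D_('e_j) G y + G y * 'D_('e_j) F y)) => //.
  move=> y y0; apply/derive_val/is_derive_mul; exact: C1_is_derive.
apply: contD; apply: contM; [exact: differentiable_continuous|exact: cG'
  |exact: differentiable_continuous|exact: cF'].
Qed.

Lemma is_derive_dotp w x v : is_derive x v (dotp w) (dotp w v).
Proof.
apply: is_derive_bigsum => i; apply: is_derive_mull.
have -> : v 0 i = 'D_v (fun y : 'rV[R]_d => y 0 i) x.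
  have := @derive_mx R _ 1 d id x v (@derivable_id _ _ x v).
  by move/rowP => /(_ i); rewrite derive_id mxE.
by apply: derivableP; apply: diff_derivable; exact: differentiable_coord.
Qed.

Lemma derive_dotp w v : 'D_v (dotp w) = fun=> dotp w v.
Proof. by apply/funext => x; apply/derive_val/is_derive_dotp. Qed.

Lemma dotp_differentiable w x : differentiable (dotp w) x.
Proof.
rewrite (_ : dotp w = \sum_i (fun y : 'rV[R]_d => w 0 i * y 0 i)).
  apply: differentiable_sum => i; apply: differentiableM => //.
  exact: differentiable_coord.
by apply/funext => y; rewrite fct_sumE.
Qed.

Lemma C1_cst (r : R) : C1 (fun=> r).
Proof.
move=> x x0; split; first exact: differentiable_cst.
move=> j; rewrite (_ : 'D_('e_j) _ = fun=> 0); first exact: cont_cst.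
by apply/funext => y; apply: derive_cst.
Qed.

Lemma C1_dotp w : C1 (dotp w).
Proof.
move=> x x0; split; first exact: dotp_differentiable.
by move=> j; rewrite derive_dotp; exact: cont_cst.
Qed.

Lemma C2_dotp w : C2 (dotp w).
Proof.
by split=> [|j]; [exact: C1_dotp|rewrite derive_dotp; exact: C1_cst].
Qed.

Lemma C1_coord (i : 'I_d) : C1 (fun x => x 0 i).
Proof.
rewrite (_ : (fun x => _) = dotp ('e_i)); first exact: C1_dotp.
by apply/funext => x; rewrite dotpC dotp_basisr.
Qed.

Lemma C1X F n : C1 F -> C1 (fun x => F x ^+ n).
Proof.
move=> cF; elim: n => [|n IH].
  by rewrite (_ : (fun p => _) = fun=> 1)//; exact: C1_cst.
rewrite (_ : (fun p => _) = fun p => F p * F p ^+ n); first exact: C1M.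
by apply/funext => p; rewrite exprS.
Qed.

Lemma C1_angular F i j : C2 F -> C1 (angular F i j).
Proof.
move=> [_ cF].
exact: (C1B (C1M (@C1_coord i) (cF j)) (C1M (@C1_coord j) (cF i))).
Qed.

Lemma angularM F G i j p : C1 F -> C1 G -> p != 0 ->
  angular (fun x => F x * G x) i j p = F p * angular G i j p + G p * angular F i j p.
Proof.
move=> cF cG p0; rewrite /angular.
have E k : 'D_('e_k) (fun x => F x * G x) p =
    F p * 'D_('e_k) G p + G p * 'D_('e_k) F p.
  by apply/derive_val/is_derive_mul; exact: C1_is_derive.
rewrite !E; move: (F p) (G p) ('D_('e_i) F p) ('D_('e_j) F p) ('D_('e_i) G p).
by move: ('D_('e_j) G p) => *; ring.
Qed.

Lemma angular_antisym F i j p : angular F j i p = - angular F i j p.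
Proof. by rewrite /angular opprB. Qed.

Lemma angular_dotp w i j p : angular (dotp w) i j p = p 0 i * w 0 j - p 0 j * w 0 i.
Proof.
have E k : 'D_('e_k) (dotp w) p = w 0 k.
  by rewrite -dotp_basisr; apply/derive_val/is_derive_dotp.
by rewrite /angular !E.
Qed.

End DirectionalDerivatives.

Section RotationIntegral.
Context {R : realType}.
Notation leb := (@lebesgue_measure R).
Notation leb2 := (leb \x leb)%E.

Definition circle_tan (a : R) : 'rV[R]_2 := \row_(j < 2) [:: - sin a; cos a]`_j.

Lemma is_derive_circle_pt (a : R) :
  is_derive a (1 : R) (circle_pt : R -> 'rV[R]_2) (circle_tan a).
Proof.
apply: is_derive_rV => -[[|[|//]] hj]; rewrite !mxE/=.
  rewrite (_ : (fun s => _) = cos); first exact: is_derive_cos.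
  by apply/funext => s; rewrite mxE.
rewrite (_ : (fun s => _) = sin); first exact: is_derive_sin.
by apply/funext => s; rewrite mxE.
Qed.

(** The azimuthal tangent has length |sin z.2| and is deliberately not normalized: differentiation
    along it is differentiation in z.1, with no division by a quantity vanishing at the poles. *)
Definition sphere2_tan1 (z : R * R) : 'rV[R]_3 :=
  \row_(j < 3) [:: - (sin z.2 * sin z.1); sin z.2 * cos z.1; 0]`_j.

Definition sphere2_tan2 (z : R * R) : 'rV[R]_3 :=
  \row_(j < 3) [:: cos z.2 * cos z.1; cos z.2 * sin z.1; - sin z.2]`_j.

Lemma is_derive_sphere2_pt1 (x y : R) :
  is_derive x (1 : R) (fun s => sphere2_pt (s, y) : 'rV[R]_3) (sphere2_tan1 (x, y)).
Proof.
apply: is_derive_rV => -[[|[|[|//]]] hj]; rewrite !mxE/=.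
- rewrite (_ : (fun s => _) = (fun s => sin y * cos s)); last first.
    by apply/funext => s; rewrite mxE.
  by rewrite -mulrN; apply: is_derive_mull; exact: is_derive_cos.
- rewrite (_ : (fun s => _) = (fun s => sin y * sin s)); last first.
    by apply/funext => s; rewrite mxE.
  by apply: is_derive_mull; exact: is_derive_sin.
- rewrite (_ : (fun s => _) = (fun s => cos y)); last first.
    by apply/funext => s; rewrite mxE.
  exact: is_derive_cst.
Qed.

Lemma is_derive_sphere2_pt2 (x y : R) :
  is_derive y (1 : R) (fun s => sphere2_pt (x, s) : 'rV[R]_3) (sphere2_tan2 (x, y)).
Proof.
apply: is_derive_rV => -[[|[|[|//]]] hj]; rewrite !mxE/=.
- rewrite (_ : (fun s => _) = (fun s => sin s * cos x)); last first.
    by apply/funext => s; rewrite mxE.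
  by apply: is_derive_mulr; exact: is_derive_sin.
- rewrite (_ : (fun s => _) = (fun s => sin s * sin x)); last first.
    by apply/funext => s; rewrite mxE.
  by apply: is_derive_mulr; exact: is_derive_sin.
- rewrite (_ : (fun s => _) = (fun s => cos s)); last first.
    by apply/funext => s; rewrite mxE.
  exact: is_derive_cos.
Qed.

Lemma rectangle_derive1_eq0 (g dg : R * R -> R) (a b c d : R) : a <= b ->
  continuous dg ->
  (forall x y, is_derive x (1 : R) (fun s => g (s, y)) (dg (x, y))) ->
  (forall y, g (b, y) = g (a, y)) ->
  \int[leb2]_(z in `[a, b]%classic `*` `[c, d]%classic) dg z = 0.
Proof.
move=> ab cdg gdg gab; rewrite Rintegral_rectangle21//.
transitivity (\int[leb]_(y in `[c, d]) (0 : R)).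
  apply: eq_Rintegral => y _.
  have cy : continuous (fun x => dg (x, y)) by exact: fst_continuous_comp.
  by rewrite (Rintegral_derive ab (gdg^~ y) cy) gab subrr.
by rewrite /Rintegral integral0.
Qed.

Lemma rectangle_derive2_eq0 (g dg : R * R -> R) (a b c d : R) : c <= d ->
  continuous dg ->
  (forall x y, is_derive y (1 : R) (fun s => g (x, s)) (dg (x, y))) ->
  (forall x, g (x, d) = g (x, c)) ->
  \int[leb2]_(z in `[a, b]%classic `*` `[c, d]%classic) dg z = 0.
Proof.
move=> ab cdg gdg gab; rewrite Rintegral_rectangle12//.
transitivity (\int[leb]_(x in `[a, b]) (0 : R)).
  apply: eq_Rintegral => x _.
  have cx : continuous (fun y => dg (x, y)) by exact: snd_continuous_comp.
  by rewrite (Rintegral_derive ab (gdg x) cx) gab subrr.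
by rewrite /Rintegral integral0.
Qed.

Section Circle.
Variable F : 'rV[R]_2 -> R.
Hypothesis cF : C1 F.

Lemma angular_circle (a : R) : angular F 0 1 (circle_pt a) = 'D_(circle_tan a) F (circle_pt a).
Proof.
have x0 := sphere_neq0 (circle_pt_sphere a).
rewrite (derive_sum_basis _ (C1_differentiable cF x0)).
rewrite !big_ord_recl big_ord0 /angular !mxE/= addr0.
rewrite (_ : lift ord0 ord0 = 1); last exact: val_inj.
by rewrite mulNr addrC.
Qed.

Lemma is_derive_circle_comp (a : R) :
  is_derive a (1 : R) (fun s => F (circle_pt s)) (angular F 0 1 (circle_pt a)).
Proof.
rewrite angular_circle; apply: is_derive_curve; last exact: is_derive_circle_pt.
exact/C1_differentiable/sphere_neq0/circle_pt_sphere.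
Qed.

Lemma scont_circle_comp (g : 'rV[R]_2 -> R) : scont g ->
  continuous (fun a => g (circle_pt a)).
Proof.
move=> cg a; apply: continuous_comp; first exact: circle_pt_continuous.
by apply: cg; exact: circle_pt_sphere.
Qed.

Lemma sint_angular_circle : sphere_int (angular F 0 1) = 0.
Proof.
rewrite /sphere_int/=.
have cr := scont_circle_comp (@angular_scont _ _ F 0 1 cF).
rewrite (Rintegral_derive (ltW pi2_gt0) is_derive_circle_comp cr).
rewrite (_ : circle_pt (2 * pi) = circle_pt 0) ?subrr ?mulr0//.
by rewrite /circle_pt mulr_natl cos2pi sin2pi cos0 sin0.
Qed.

End Circle.

Lemma sum_ord3 (G : 'I_3 -> R) : \sum_j G j = G 0 + G 1 + G (lift 0 1).
Proof.
rewrite !big_ord_recl big_ord0 addr0 addrA.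
by congr (G _ + G _ + G _); exact: val_inj.
Qed.

Section Sphere2.
Variable F : 'rV[R]_3 -> R.
Hypothesis cF : C1 F.

Let e1 : 'I_3 := 1.
Let e2 : 'I_3 := lift 0 1.

Let dF z : differentiable F (sphere2_pt z).
Proof. exact/C1_differentiable/sphere_neq0/sphere2_pt_sphere. Qed.

Let deriveF z (v : 'rV[R]_3) : 'D_v F (sphere2_pt z) =
  v 0 0 * 'D_('e_0) F (sphere2_pt z) + v 0 e1 * 'D_('e_e1) F (sphere2_pt z)
  + v 0 e2 * 'D_('e_e2) F (sphere2_pt z).
Proof.
by rewrite (derive_sum_basis v (dF z)); exact: sum_ord3.
Qed.

Lemma is_derive_sphere2_comp1 (x y : R) :
  is_derive x (1 : R) (fun s => F (sphere2_pt (s, y)))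
    ('D_(sphere2_tan1 (x, y)) F (sphere2_pt (x, y))).
Proof. by apply: is_derive_curve => //; exact: is_derive_sphere2_pt1. Qed.

Lemma is_derive_sphere2_comp2 (x y : R) :
  is_derive y (1 : R) (fun s => F (sphere2_pt (x, s)))
    ('D_(sphere2_tan2 (x, y)) F (sphere2_pt (x, y))).
Proof. by apply: is_derive_curve => //; exact: is_derive_sphere2_pt2. Qed.

Lemma scont_sphere2_comp (g : 'rV[R]_3 -> R) : scont g ->
  continuous (fun z => g (sphere2_pt z)).
Proof.
move=> cg a; apply: continuous_comp; first exact: sphere2_pt_continuous.
by apply: cg; exact: sphere2_pt_sphere.
Qed.

Lemma derive_sphere2_tan1 z :
  'D_(sphere2_tan1 z) F (sphere2_pt z) = angular F 0 e1 (sphere2_pt z).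
Proof.
rewrite deriveF /angular.
move: ('D_('e_0) F (sphere2_pt z)) ('D_('e_e1) F (sphere2_pt z))
  ('D_('e_e2) F (sphere2_pt z)) => a b c.
by rewrite !mxE/=; ring.
Qed.

Lemma derive_sphere2_tan2 z : 'D_(sphere2_tan2 z) F (sphere2_pt z) =
  - (cos z.1 * angular F 0 e2 (sphere2_pt z)
     + sin z.1 * angular F e1 e2 (sphere2_pt z)).
Proof.
rewrite (deriveF z (sphere2_tan2 z)). rewrite /angular.
move: ('D_('e_0) F (sphere2_pt z)) ('D_('e_e1) F (sphere2_pt z))
  ('D_('e_e2) F (sphere2_pt z)) => a b c.
rewrite !mxE/=.
(* The third component of the tangent has to be split between the two rotation planes containing the
   polar axis. *)
have -> : - sin z.2 = - sin z.2 * (cos z.1 ^+ 2 + sin z.1 ^+ 2).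
  by rewrite cos2Dsin2 mulr1.
by ring.
Qed.

(** In angular coordinates this rotation field has a coefficient cot z.2 in the azimuthal direction.
    The surface density sin z.2 removes that singularity, so the weighted field is smooth on the
    whole rectangle. *)
Lemma angular02_sphere2 z : angular F 0 e2 (sphere2_pt z) * sin z.2 =
  cos z.2 * sin z.1 * 'D_(sphere2_tan1 z) F (sphere2_pt z)
  - sin z.2 * cos z.1 * 'D_(sphere2_tan2 z) F (sphere2_pt z).
Proof.
rewrite (deriveF z (sphere2_tan1 z)) (deriveF z (sphere2_tan2 z)). rewrite /angular.
move: ('D_('e_0) F (sphere2_pt z)) ('D_('e_e1) F (sphere2_pt z))
  ('D_('e_e2) F (sphere2_pt z)) => a b c.
rewrite !mxE/=.
rewrite -[cos z.2 * a]mulr1 -(cos2Dsin2 z.1).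
by ring.
Qed.

Lemma angular12_sphere2 z : angular F e1 e2 (sphere2_pt z) * sin z.2 =
  - (cos z.2 * cos z.1 * 'D_(sphere2_tan1 z) F (sphere2_pt z))
  - sin z.2 * sin z.1 * 'D_(sphere2_tan2 z) F (sphere2_pt z).
Proof.
rewrite (deriveF z (sphere2_tan1 z)) (deriveF z (sphere2_tan2 z)). rewrite /angular.
move: ('D_('e_0) F (sphere2_pt z)) ('D_('e_e1) F (sphere2_pt z))
  ('D_('e_e2) F (sphere2_pt z)) => a b c.
rewrite !mxE/=.
rewrite -[cos z.2 * b]mulr1 -(cos2Dsin2 z.1).
by ring.
Qed.

End Sphere2.

End RotationIntegral.

Section RotationIntegral2.
Context {R : realType}.
Notation leb := (@lebesgue_measure R).
Notation leb2 := (leb \x leb)%E.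

(** Divergence theorem in angular coordinates: the azimuthal flux cancels by periodicity, and the
    polar flux because it takes the same value at both poles. *)
Lemma sphere2_divergence (h : 'rV[R]_3 -> R) (g1 dg1 g2 dg2 : R * R -> R) :
  continuous dg1 -> continuous dg2 ->
  (forall x y, is_derive x (1 : R) (fun s => g1 (s, y)) (dg1 (x, y))) ->
  (forall x y, is_derive y (1 : R) (fun s => g2 (x, s)) (dg2 (x, y))) ->
  (forall y, g1 (2 * pi, y) = g1 (0, y)) ->
  (forall x, g2 (x, pi) = g2 (x, 0)) ->
  (forall z, h (sphere2_pt z) * sin z.2 = dg1 z + dg2 z) ->
  sphere_int h = 0.
Proof.
move=> c1 c2 D1 D2 b1 b2 hE; rewrite /sphere_int/=.
transitivity ((4 * pi)^-1 * \int[leb2]_(z in sphere2_dom) (dg1 z + dg2 z)).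
  by congr (_ * _); apply: eq_Rintegral => z _; exact: hE.
rewrite RintegralD.
- rewrite (rectangle_derive1_eq0 _ _ (ltW pi2_gt0) c1 D1 b1).
  by rewrite (rectangle_derive2_eq0 _ _ (pi_ge0 R) c2 D2 b2) addr0 mulr0.
- exact: rectangle_measurable.
- exact: continuous2_integrable.
- exact: continuous2_integrable.
Qed.

Lemma plane_continuousM (f g : R * R -> R) : continuous f -> continuous g ->
  continuous (fun z => f z * g z).
Proof. by move=> cf cg z; apply: contM; [exact: cf|exact: cg]. Qed.

Lemma plane_continuousD (f g : R * R -> R) : continuous f -> continuous g ->
  continuous (fun z => f z + g z).
Proof. by move=> cf cg z; apply: contD; [exact: cf|exact: cg]. Qed.

Lemma plane_continuousN (f : R * R -> R) : continuous f ->
  continuous (fun z => - f z).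
Proof. by move=> cf z; apply: cvgN; exact: cf. Qed.

Lemma cos2piE : cos (2 * pi) = 1 :> R.
Proof. by rewrite mulr_natl cos2pi. Qed.

Lemma sin2piE : sin (2 * pi) = 0 :> R.
Proof. by rewrite mulr_natl sin2pi. Qed.

Lemma sphere2_pt_periodic (y : R) :
  sphere2_pt (2 * pi, y) = sphere2_pt (0, y) :> 'rV[R]_3.
Proof. by rewrite /sphere2_pt/= cos2piE sin2piE cos0 sin0. Qed.

Variable F : 'rV[R]_3 -> R.
Hypothesis cF : C1 F.

Let D1 (z : R * R) : R := 'D_(sphere2_tan1 z) F (sphere2_pt z).
Let D2 (z : R * R) : R := 'D_(sphere2_tan2 z) F (sphere2_pt z).

Let cosx : continuous (fun z : R * R => cos z.1).
Proof. exact: comp_fst_continuous (@continuous_cos R). Qed.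
Let sinx : continuous (fun z : R * R => sin z.1).
Proof. exact: comp_fst_continuous (@continuous_sin R). Qed.
Let cosy : continuous (fun z : R * R => cos z.2).
Proof. exact: comp_snd_continuous (@continuous_cos R). Qed.
Let siny : continuous (fun z : R * R => sin z.2).
Proof. exact: comp_snd_continuous (@continuous_sin R). Qed.

Let cf : continuous (fun z => F (sphere2_pt z)).
Proof. by apply: scont_sphere2_comp; exact: C1_scont. Qed.

Lemma sphere2_D1_continuous : continuous D1.
Proof.
rewrite (_ : D1 = fun z => angular F 0 1 (sphere2_pt z)).
  by apply: scont_sphere2_comp; exact: angular_scont.
by apply/funext => z; exact: derive_sphere2_tan1.
Qed.

Lemma sphere2_D2_continuous : continuous D2.
Proof.
rewrite (_ : D2 = fun z => - (cos z.1 * angular F 0 (lift 0 1) (sphere2_pt z)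
     + sin z.1 * angular F 1 (lift 0 1) (sphere2_pt z))).
  have c i j : continuous (fun z => angular F i j (sphere2_pt z)).
    by apply: scont_sphere2_comp; exact: angular_scont.
  apply: plane_continuousN.
  by apply: plane_continuousD; apply: plane_continuousM => //; exact: c.
by apply/funext => z; exact: derive_sphere2_tan2.
Qed.

Lemma sint_angular01 : sphere_int (angular F 0 1) = 0.
Proof.
apply: (@sphere2_divergence _ (fun z => F (sphere2_pt z) * sin z.2)
  (fun z => D1 z * sin z.2) (fun=> 0) (fun=> 0)).
- by move=> z; apply: contM; [exact: sphere2_D1_continuous|exact: siny].
- by move=> z; exact: cont_cst.
- move=> x y /=; apply: is_derive_mulr; exact: is_derive_sphere2_comp1.
- by move=> x y /=; exact: is_derive_cst.
- by move=> y; rewrite sphere2_pt_periodic.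
- by [].
- by move=> z; rewrite addr0 /D1 derive_sphere2_tan1.
Qed.

(** Rotation fields are divergence free for the surface measure: when the coefficients are moved
    inside the two derivatives, the extra terms are cos z.2 cos z.1 F with opposite signs. The polar
    flux contains sin z.2, so it vanishes at the poles. *)
Lemma sint_angular02 : sphere_int (angular F 0 (lift 0 1)) = 0.
Proof.
apply: (@sphere2_divergence _
  (fun z => cos z.2 * (sin z.1 * F (sphere2_pt z)))
  (fun z => cos z.2 * (sin z.1 * D1 z + F (sphere2_pt z) * cos z.1))
  (fun z => - (cos z.1 * (sin z.2 * F (sphere2_pt z))))
  (fun z => - (cos z.1 * (sin z.2 * D2 z + F (sphere2_pt z) * cos z.2)))).
- by apply: plane_continuousM => //; apply: plane_continuousD;
    apply: plane_continuousM => //; exact: sphere2_D1_continuous.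
- by apply: plane_continuousN; apply: plane_continuousM => //;
    apply: plane_continuousD; apply: plane_continuousM => //;
    exact: sphere2_D2_continuous.
- move=> x y /=; apply: is_derive_mull; apply: is_derive_mul.
  exact: is_derive_sphere2_comp1.
- move=> x y /=; apply: is_derive_opp; apply: is_derive_mull; apply: is_derive_mul.
  exact: is_derive_sphere2_comp2.
- by move=> y; rewrite sphere2_pt_periodic /= sin2piE sin0.
- by move=> x /=; rewrite sinpi sin0 !mul0r.
- move=> z; rewrite angular02_sphere2// -/(D1 z) -/(D2 z).
  by move: (D1 z) (D2 z) (F _) => a b c; ring.
Qed.

Lemma sint_angular12 : sphere_int (angular F 1 (lift 0 1)) = 0.
Proof.
apply: (@sphere2_divergence _
  (fun z => - (cos z.2 * (cos z.1 * F (sphere2_pt z))))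
  (fun z => - (cos z.2 * (cos z.1 * D1 z + F (sphere2_pt z) * - sin z.1)))
  (fun z => - (sin z.1 * (sin z.2 * F (sphere2_pt z))))
  (fun z => - (sin z.1 * (sin z.2 * D2 z + F (sphere2_pt z) * cos z.2)))).
- apply: plane_continuousN; apply: plane_continuousM => //.
  apply: plane_continuousD; apply: plane_continuousM => //.
    exact: sphere2_D1_continuous.
  exact: plane_continuousN.
- by apply: plane_continuousN; apply: plane_continuousM => //;
    apply: plane_continuousD; apply: plane_continuousM => //;
    exact: sphere2_D2_continuous.
- move=> x y /=; apply: is_derive_opp; apply: is_derive_mull; apply: is_derive_mul.
  exact: is_derive_sphere2_comp1.
- move=> x y /=; apply: is_derive_opp; apply: is_derive_mull; apply: is_derive_mul.
  exact: is_derive_sphere2_comp2.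
- by move=> y; rewrite sphere2_pt_periodic /= cos2piE cos0.
- by move=> x /=; rewrite sinpi sin0 !mul0r.
- move=> z; rewrite angular12_sphere2// -/(D1 z) -/(D2 z).
  by move: (D1 z) (D2 z) (F _) => a b c; ring.
Qed.

End RotationIntegral2.

Section IntegrationByParts.
Context {R : realType} {d : nat} (hd : d = 2%N \/ d = 3%N).
Implicit Types F G : 'rV[R]_d -> R.
Notation sint := (@sphere_int R d).

Lemma angular_same F i p : angular F i i p = 0.
Proof. by rewrite /angular subrr. Qed.

(** Infinitesimal form of the rotation invariance of the measure. Antisymmetry leaves one plane in
    dimension two and three in dimension three. *)
Lemma sint_angular F i j : C1 F -> sint (angular F i j) = 0.
Proof.
move=> cF; wlog lij : i j / (i < j)%N => [wl|].
  have [/wl//|ji|/val_inj ->] := ltngtP i j.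
    have -> : sint (angular F i j) = (-1) * sint (angular F j i).
      rewrite -sintZ//; last exact/scont_integrable/angular_scont.
      by apply: eq_sint => // p _; rewrite angular_antisym mulN1r.
    by rewrite wl// mulr0.
  transitivity (sint (fun=> 0)); last exact: sint_cst.
  by apply: eq_sint => // p _; rewrite angular_same.
case: hd => hd'; subst d.
  move: i j lij => [[|[|//]] hi] [[|[|//]] hj]// _.
  have -> : Ordinal hi = 0 by exact: val_inj.
  have -> : Ordinal hj = 1 by exact: val_inj.
  exact: sint_angular_circle.
move: i j lij => [[|[|[|//]]] hi] [[|[|[|//]]] hj]// _.
- have -> : Ordinal hi = 0 by exact: val_inj.
  have -> : Ordinal hj = 1 by exact: val_inj.
  exact: sint_angular01.
- have -> : Ordinal hi = 0 by exact: val_inj.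
  have -> : Ordinal hj = lift 0 1 by exact: val_inj.
  exact: sint_angular02.
- have -> : Ordinal hi = 1 by exact: val_inj.
  have -> : Ordinal hj = lift 0 1 by exact: val_inj.
  exact: sint_angular12.
Qed.

Lemma sint_by_parts F G i j : C1 F -> C1 G ->
  sint (fun p => F p * angular G i j p) = - sint (fun p => angular F i j p * G p).
Proof.
move=> cF cG; apply/eqP; rewrite -subr_eq0 opprK.
rewrite -sintD//; last 2 first.
- by apply: scont_integrable => //; apply: scontM; [exact: C1_scont|exact: angular_scont].
- by apply: scont_integrable => //; apply: scontM; [exact: angular_scont|exact: C1_scont].
rewrite -(@sint_angular (fun x => F x * G x) i j); last exact: C1M.
apply/eqP/eq_sint => // p /sphere_neq0 p0.
by rewrite angularM// [angular F i j p * _]mulrC.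
Qed.

End IntegrationByParts.

(** * The Poincare inequality *)

Section Poincare1D.
Context {R : realType}.
Notation leb := (@lebesgue_measure R).
Notation leb2 := (leb \x leb)%E.
Implicit Types f g df : R -> R.

Lemma line_continuousM f g : continuous f -> continuous g ->
  continuous (fun z => f z * g z).
Proof. by move=> cf cg z; apply: contM; [exact: cf|exact: cg]. Qed.

Lemma line_continuousD f g : continuous f -> continuous g ->
  continuous (fun z => f z + g z).
Proof. by move=> cf cg z; apply: contD; [exact: cf|exact: cg]. Qed.

Lemma line_continuousX f n : continuous f -> continuous (fun z => f z ^+ n).
Proof.
by move=> cf z; apply: (@continuous_comp _ _ _ f (fun x => x ^+ n));
  [exact: cf|exact: exprn_continuous].
Qed.

Lemma Rintegral_itv_le (g : R -> R) (a b s x : R) : continuous g ->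
  (forall y, 0 <= g y) -> a <= s -> x <= b ->
  \int[leb]_(y in `[s, x]) g y <= \int[leb]_(y in `[a, b]) g y.
Proof.
move=> cg g0 as_ xb; rewrite /Rintegral fine_le//.
- by apply: integrable_fin_num => //; exact: continuous_integrable.
- by apply: integrable_fin_num => //; exact: continuous_integrable.
- apply: ge0_subset_integral => //.
  + apply/measurable_EFinP; apply: measurable_funTS.
    exact: continuous_measurable_fun.
  + by move=> y _; rewrite lee_fin.
  + by apply: subset_itv; rewrite bnd_simp.
Qed.

Lemma Rintegral_itv_split (g : R -> R) (a b x : R) : continuous g ->
  a <= x -> x <= b -> \int[leb]_(y in `[a, b]) g y =
  \int[leb]_(y in `[a, x]) g y + \int[leb]_(y in `[x, b]) g y.
Proof.
move=> cg ax xb.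
have := @Rintegral_itvB _ g (BLeft a) (BRight b) x (continuous_integrable a b cg).
rewrite !bnd_simp => /(_ ax xb).
rewrite Rintegral_itv_obnd_cbnd => [<-|]; first by rewrite addrC subrK.
apply: integrableS (continuous_integrable x b cg) => //.
by apply: subset_itvr; rewrite bnd_simp.
Qed.

(* Expand int (f' - D / (b - a))^2 >= 0 over the interval between s and x. *)
Lemma oscillation_le f df (a b s x : R) :
  (forall y : R, is_derive y (1 : R) f (df y)) -> continuous df ->
  a < b -> s \in `[a, b] -> x \in `[a, b] ->
  (f x - f s) ^+ 2 <= (b - a) * \int[leb]_(y in `[a, b]) (df y ^+ 2).
Proof.
move=> fdf cdf ab; wlog sx : s x / s <= x => [wl sab xab|].
  have [/wl|/ltW/wl] := leP s x; first exact.
  by rewrite -[f x - f s]opprB sqrrN; exact.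
rewrite !in_itv/= => /andP[as_ sb] /andP[ax xb].
set D := f x - f s; set t := D / (b - a).
have c2 : continuous (fun y => df y ^+ 2) by exact: line_continuousX.
have := Rintegral_itv_le c2 (fun y => sqr_ge0 (df y)) as_ xb.
set I := \int[leb]_(y in `[a, b]) (df y ^+ 2).
set J := \int[leb]_(y in `[s, x]) (df y ^+ 2) => JI.
have cc (r : R) : continuous (fun _ : R => r) by exact: cst_continuous.
have c1 : continuous (fun y => (- 2 * t) * df y + t ^+ 2).
  by apply: line_continuousD => //; apply: line_continuousM.
have : 0 <= J - 2 * t * D + t ^+ 2 * (x - s).
  have -> : J - 2 * t * D + t ^+ 2 * (x - s) =
      \int[leb]_(y in `[s, x]) (df y ^+ 2 + ((- 2 * t) * df y + t ^+ 2)).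
    rewrite RintegralD//; [|exact: continuous_integrable..].
    have -> : \int[leb]_(y in `[s, x]) ((- 2 * t) * df y + t ^+ 2) =
        (- 2 * t * f x + t ^+ 2 * x) - (- 2 * t * f s + t ^+ 2 * s).
      apply: (@Rintegral_derive _ (fun y => - 2 * t * f y + t ^+ 2 * y)) => //.
      move=> y; apply: is_derive_add.
      rewrite -[X in is_derive _ _ _ X]mulr1.
      exact: (is_deriveZ (t ^+ 2) (is_derive_id y (1 : R))).
    by rewrite -/J /D; ring.
  apply: Rintegral_ge0 => y _.
  by rewrite (_ : _ + _ = (df y - t) ^+ 2) ?sqr_ge0//; ring.
move=> H; have ba : 0 < b - a by rewrite subr_gt0.
have Dt : D = t * (b - a) by rewrite /t mulfVK// lt0r_neq0.
have : t ^+ 2 * (x - s) <= t ^+ 2 * (b - a) by apply: ler_wpM2l; [exact: sqr_ge0|lra].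
move=> H2; rewrite Dt exprMn [(b - a) ^+ 2]expr2 mulrA mulrC ler_pM2l//.
by move: H; rewrite Dt; move: H2; nra.
Qed.

(** The difference of the two sides is affine in u, and at the extremes u = s and u = -s it is s
    times a square; for u in between it is the corresponding convex combination. *)
Lemma hardy_pointwise (s u g h : R) : `|u| <= s ->
  4^-1 * (s * g ^+ 2) <= s * h ^+ 2 + (2^-1 * s * g ^+ 2 + u * g * h).
Proof.
rewrite ler_norml => /andP[us su]; rewrite -subr_ge0.
rewrite (_ : _ - _ = (s + u) / 2 * (g / 2 + h) ^+ 2
  + (s - u) / 2 * (g / 2 - h) ^+ 2); last by field.
by apply: addr_ge0; apply: mulr_ge0; rewrite ?sqr_ge0// divr_ge0//; lra.
Qed.

(** For cos x >= 0 one has (1 - cos x)^2 <= (1 - cos x)(1 + cos x) = (sin x)^2. This makes 1 - cos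
    an admissible multiplier on the half meridian starting at the pole 0. *)
Lemma one_sub_cos_le_sin (x : R) : 0 <= sin x -> 0 <= cos x ->
  `|1 - cos x| <= sin x.
Proof.
move=> s0 c0; have c1 := cos_le1 x.
rewrite ger0_norm ?subr_ge0// -(@ler_pXn2r _ 2)// ?nnegrE ?subr_ge0//.
by have := cos2Dsin2 x; nra.
Qed.

(* Compare with the derivative of (k - cos) f^2 / 2: the multipliers 1 - cos and
   - 1 - cos, used on the two halves of a meridian, both have derivative sin and
   vanish at a pole. *)
Lemma hardy_interval f df (k a b : R) : a <= b ->
  (forall y : R, is_derive y (1 : R) f (df y)) -> continuous df ->
  (forall y, y \in `[a, b] -> `|k - cos y| <= sin y) ->
  (k - cos a) * f a = 0 -> (k - cos b) * f b = 0 ->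
  4^-1 * \int[leb]_(y in `[a, b]) (sin y * f y ^+ 2) <=
  \int[leb]_(y in `[a, b]) (sin y * df y ^+ 2).
Proof.
move=> ab fdf cdf ku fa fb.
have cf : continuous f.
  by move=> y; apply: differentiable_continuous; apply/derivable1_diffP; case: (fdf y).
have cs := @continuous_sin R.
have cu : continuous (fun y => k - cos y).
  by move=> y; apply: contB; [exact: cont_cst|exact: continuous_cos].
have cc (r : R) : continuous (fun _ : R => r) by exact: cst_continuous.
have cA : continuous (fun y => sin y * f y ^+ 2).
  by apply: line_continuousM => //; exact: line_continuousX.
have cB : continuous (fun y => sin y * df y ^+ 2).
  by apply: line_continuousM => //; exact: line_continuousX.
pose P y := (2^-1 * sin y) * f y ^+ 2 + ((k - cos y) * f y) * df y.
have cP : continuous P.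
  by apply: line_continuousD; apply: line_continuousM => //;
    [exact: line_continuousM|exact: line_continuousX|exact: line_continuousM].
have P0 : \int[leb]_(y in `[a, b]) P y = 0.
  pose Q y := (2^-1 * (k - cos y)) * f y ^+ 2.
  have -> : \int[leb]_(y in `[a, b]) P y = Q b - Q a.
    apply: Rintegral_derive => // y.
    have du : is_derive y (1 : R) (fun y => k - cos y) (sin y).
      apply: (is_derive_eq
        (is_derive_sub (is_derive_cst k y (1 : R)) (is_derive_cos y))).
      by rewrite sub0r opprK.
    apply: (is_derive_eq (is_derive_mul (is_derive_mull 2^-1 du)
      (is_derive_sqr (fdf y)))).
    by rewrite /P; field.
  by rewrite /Q !expr2 -!mulrA [(k - cos b) * _]mulrA [(k - cos a) * _]mulrA
    fa fb !mul0r !mulr0 subrr.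
have -> : \int[leb]_(y in `[a, b]) (sin y * df y ^+ 2) =
    \int[leb]_(y in `[a, b]) (sin y * df y ^+ 2 + P y).
  by rewrite RintegralD ?P0 ?addr0//; exact: continuous_integrable.
rewrite -RintegralZl//; last exact: continuous_integrable.
apply: le_Rintegral => //; try apply: continuous_integrable.
- exact: line_continuousM.
- exact: line_continuousD.
- by move=> y yab; exact/hardy_pointwise/ku.
Qed.

(** The meridian is cut at the equator. Subtracting the equatorial value removes the boundary term
    there, and at each pole the multiplier vanishes, so no value of f at a pole enters, where the
    weight sin degenerates. The second half is treated through the reflection of y into pi - y. *)
Lemma hardy_meridian f df :
  (forall y : R, is_derive y (1 : R) f (df y)) -> continuous df ->
  \int[leb]_(y in `[0, pi]) (sin y * (f y - f (pi / 2)) ^+ 2) <=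
  4 * \int[leb]_(y in `[0, pi]) (sin y * df y ^+ 2).
Proof.
move=> fdf cdf; set g := fun y => f y - f (pi / 2).
have gdg (y : R) : is_derive y (1 : R) g (df y).
  by rewrite -[df y]subr0; exact: (is_derive_sub (fdf y) (is_derive_cst _ _ _)).
have cg : continuous g.
  by move=> y; apply: differentiable_continuous; apply/derivable1_diffP; case: (gdg y).
have cs := @continuous_sin R.
have cA : continuous (fun y => sin y * g y ^+ 2).
  by apply: line_continuousM => //; exact: line_continuousX.
have cB : continuous (fun y => sin y * df y ^+ 2).
  by apply: line_continuousM => //; exact: line_continuousX.
have p0 : 0 <= pi / 2 :> R by rewrite divr_ge0// pi_ge0.
have p1 : pi / 2 <= pi :> R by have := pi_ge0 R; lra.
have g0 : g (pi / 2) = 0 by rewrite /g subrr.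
rewrite (Rintegral_itv_split cA p0 p1) (Rintegral_itv_split cB p0 p1).
rewrite -ler_pdivrMl// mulrDr; apply: lerD.
- apply: (@hardy_interval g df 1) => //.
  + move=> y; rewrite in_itv/= => /andP[y0 y1]; apply: one_sub_cos_le_sin.
      by apply: sin_ge0_pi; rewrite y0/= (le_trans y1).
    by apply: cos_ge0_pihalf; rewrite y1 andbT (le_trans _ y0)// oppr_le0.
  + by rewrite cos0 subrr mul0r.
  + by rewrite g0 mulr0.
- apply: (@hardy_interval g df (-1)) => //.
  + move=> y; rewrite in_itv/= => /andP[y0 y1].
    have := @one_sub_cos_le_sin (pi - y).
    have -> : sin (pi - y) = sin y by rewrite sinB sinpi cospi; ring.
    have -> : cos (pi - y) = - cos y by rewrite cosB sinpi cospi; ring.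
    have -> : -1 - cos y = - (1 - - cos y) by ring.
    rewrite normrN; apply; first by apply: sin_ge0_pi; rewrite y1 (le_trans p0).
    rewrite oppr_ge0 -[y](subrK (pi / 2)) cosDpihalf oppr_le0.
    by apply: sin_ge0_pi; lra.
  + by rewrite g0 mulr0.
  + by rewrite cospi opprK addNr mul0r.
Qed.

End Poincare1D.

Section PoincareSphere.
Context {R : realType}.
Notation leb := (@lebesgue_measure R).
Notation leb2 := (leb \x leb)%E.

(** The mean is the best constant in L^2, so a Poincare inequality may be proved with any convenient
    constant, here a value of F at one point. *)
Lemma sint_variance_le d (hd : d = 2%N \/ d = 3%N) (F : 'rV[R]_d -> R) (c : R) :
  scont F -> sphere_int (fun p => F p ^+ 2) - sphere_int F ^+ 2 <=
  sphere_int (fun p => (F p - c) ^+ 2).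
Proof.
move=> cF; rewrite -sint_variance//; set m := sphere_int F.
have cc (r : R) : scont (fun _ : 'rV[R]_d => r) by exact: scont_cst.
have -> : sphere_int (fun p => (F p - c) ^+ 2) =
    sphere_int (fun p => (F p - m) ^+ 2) + (m - c) ^+ 2.
  transitivity (sphere_int (fun p => (F p - m) ^+ 2 +
      (2 * (m - c) * (F p - m) + (m - c) ^+ 2))).
    by apply: eq_sint => // p _; ring.
  have i0 : scont (fun p => F p - m) by exact: scontB.
  have i1 : scont (fun p => 2 * (m - c) * (F p - m)) by exact: scontM.
  rewrite !sintD//; try by apply: scont_integrable => //.
  - rewrite sintZ//; last exact: scont_integrable.
    rewrite sintB//; try exact: scont_integrable.
    by rewrite !sint_cst// -/m subrr mulr0 add0r.
  - by apply: scont_integrable => //; exact: scontX.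
  - by apply: scont_integrable => //; exact: scontD.
by rewrite lerDl sqr_ge0.
Qed.

Lemma poincare_circle (F : 'rV[R]_2 -> R) : C1 F ->
  sphere_int (fun p => F p ^+ 2) - sphere_int F ^+ 2 <=
  (2 * pi) ^+ 2 * sphere_int (fun p => angular F 0 1 p ^+ 2).
Proof.
move=> cF; pose c := F (circle_pt 0).
have hd : 2%N = 2%N \/ 2%N = 3%N by left.
apply: le_trans (sint_variance_le hd c (C1_scont cF)) _.
have p0 := @pi2_gt0 R.
set S := sphere_int (fun p => angular F 0 1 p ^+ 2).
have SE : \int[leb]_(a in circle_dom) (angular F 0 1 (circle_pt a) ^+ 2) =
    2 * pi * S.
  by rewrite /S /sphere_int/= mulVKf ?lt0r_neq0.
have cr : continuous (fun a => angular F 0 1 (circle_pt a)).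
  by apply: scont_circle_comp; exact: angular_scont.
have cf : continuous (fun a => F (circle_pt a)).
  by apply: scont_circle_comp; exact: C1_scont.
rewrite /sphere_int/= mulrC ler_pdivrMr//.
apply: (@le_trans _ _ (\int[leb]_(a in circle_dom) ((2 * pi) ^+ 2 * S))).
  rewrite /circle_dom; apply: le_Rintegral => //.
  - apply: (@continuous_integrable _ (fun a => (F (circle_pt a) - c) ^+ 2)).
    apply: line_continuousX => a; apply: contB; [exact: cf|exact: cont_cst].
  - apply: (@continuous_integrable _ (fun=> (2 * pi) ^+ 2 * S)).
    exact: cst_continuous.
  - move=> a ad; have := @oscillation_le _ (fun s => F (circle_pt s)) _
      0 (2 * pi) 0 a (is_derive_circle_comp cF) cr p0.
    rewrite /circle_dom in SE; rewrite SE subr0 mulrA -expr2; apply.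
    + by rewrite in_itv/= lexx ltW.
    + exact: ad.
by rewrite Rintegral_const ?(ltW p0)// subr0.
Qed.

Section Sphere2.
Variable F : 'rV[R]_3 -> R.
Hypothesis cF : C1 F.

Let f (z : R * R) : R := F (sphere2_pt z).
Let f1 (z : R * R) : R := 'D_(sphere2_tan1 z) F (sphere2_pt z).
Let f2 (z : R * R) : R := 'D_(sphere2_tan2 z) F (sphere2_pt z).
Let I2 (g : R * R -> R) : R := \int[leb2]_(z in sphere2_dom) g z.

Let cf : continuous f.
Proof. by apply: scont_sphere2_comp; exact: C1_scont. Qed.
Let cf1 : continuous f1. Proof. exact: sphere2_D1_continuous. Qed.
Let cf2 : continuous f2. Proof. exact: sphere2_D2_continuous. Qed.
Let csin : continuous (fun z : R * R => sin z.2).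
Proof. exact: comp_snd_continuous (@continuous_sin R). Qed.

Let plane_continuousX (g : R * R -> R) n : continuous g ->
  continuous (fun z => g z ^+ n).
Proof.
by move=> cg z; apply: (@continuous_comp _ _ _ g (fun x => x ^+ n));
  [exact: cg|exact: exprn_continuous].
Qed.

Let I2B g h : continuous g -> continuous h ->
  I2 (fun z => g z - h z) = I2 g - I2 h.
Proof.
move=> cg ch; apply: RintegralB; first exact: rectangle_measurable.
  exact: continuous2_integrable.
exact: continuous2_integrable.
Qed.

Let I2Z (r : R) g : continuous g -> I2 (fun z => r * g z) = r * I2 g.
Proof.
move=> cg; apply: RintegralZl; first exact: rectangle_measurable.
exact: continuous2_integrable.
Qed.

Let plane_cst (r : R) : continuous (fun _ : R * R => r).
Proof. exact: cst_continuous. Qed.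

Let I2_le g h : continuous g -> continuous h -> (forall z, sphere2_dom z -> g z <= h z) ->
  I2 g <= I2 h.
Proof.
move=> cg ch gh; apply: le_Rintegral => //; first exact: rectangle_measurable.
  exact: continuous2_integrable.
exact: continuous2_integrable.
Qed.

Let I2_le1 g h : continuous g -> continuous h ->
  (forall y, y \in `[0, pi] -> \int[leb]_(x in `[0, 2 * pi]) g (x, y) <=
     \int[leb]_(x in `[0, 2 * pi]) h (x, y)) -> I2 g <= I2 h.
Proof.
move=> cg ch gh; rewrite -subr_ge0 -I2B// /I2 Rintegral_rectangle21; last first.
  apply: plane_continuousD => //; exact: plane_continuousN.
apply: Rintegral_ge0 => y y0; rewrite RintegralB//.
- by rewrite subr_ge0; apply: gh.
- by apply: continuous_integrable; exact: fst_continuous_comp.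
- by apply: continuous_integrable; exact: fst_continuous_comp.
Qed.

Let I2_le2 g h : continuous g -> continuous h ->
  (forall x, x \in `[0, 2 * pi] -> \int[leb]_(y in `[0, pi]) g (x, y) <=
     \int[leb]_(y in `[0, pi]) h (x, y)) -> I2 g <= I2 h.
Proof.
move=> cg ch gh; rewrite -subr_ge0 -I2B// /I2 Rintegral_rectangle12; last first.
  apply: plane_continuousD => //; exact: plane_continuousN.
apply: Rintegral_ge0 => y y0; rewrite RintegralB//.
- by rewrite subr_ge0; apply: gh.
- by apply: continuous_integrable; exact: snd_continuous_comp.
- by apply: continuous_integrable; exact: snd_continuous_comp.
Qed.

Let I2_sin : I2 (fun z => sin z.2) = 4 * pi.
Proof.
rewrite /I2 Rintegral_rectangle12//=.
rewrite (_ : (\int[_]_(x in _) _) = \int[leb]_(x in `[0 : R, 2 * pi]) (2 : R)).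
  by rewrite Rintegral_const ?(ltW pi2_gt0)//; ring.
by apply: eq_Rintegral => x _; rewrite Rintegral_sin.
Qed.

Let S1 := I2 (fun z => sin z.2 * f1 z ^+ 2).
Let S2 := I2 (fun z => sin z.2 * f2 z ^+ 2).

(** Averaging over meridians: if each of them carried more than (S2 + e) / (2 pi), the total would
    be at least S2 + e. The slack e > 0 makes the contradiction immediate. *)
Let good_meridian (e : R) : 0 < e -> exists2 x0 : R, x0 \in `[0, 2 * pi] &
  \int[leb]_(y in `[0, pi]) (sin y * f2 (x0, y) ^+ 2) <= (S2 + e) / (2 * pi).
Proof.
move=> e0; apply: contrapT => nex.
have p0 := @pi_gt0 R.
(* This comparison function has integral (S2 + e) / (2 pi) on every meridian, since sin has integral
   2 on [[0, pi]]. *)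
have : I2 (fun z => (S2 + e) / (4 * pi) * sin z.2) <=
       I2 (fun z => sin z.2 * f2 z ^+ 2).
  apply: I2_le2.
  - exact: plane_continuousM.
  - by apply: plane_continuousM => //; exact: plane_continuousX.
  - move=> x x0 /=; rewrite RintegralZl//; last first.
      apply: continuous_integrable; exact: continuous_sin.
    rewrite Rintegral_sin.
    rewrite (_ : _ / _ * 2 = (S2 + e) / (2 * pi)); last first.
      by move: (pi) p0 (S2 + e) => q /lt0r_neq0 q0 r; field.
    have [//|/ltW h] := leP ((S2 + e) / (2 * pi)).
    by case: nex; exists x.
rewrite I2Z// I2_sin -/S2 divfK ?lt0r_neq0 ?mulr_gt0//.
by rewrite leNgt ltrDl e0.
Qed.

(** Each point is joined to the equatorial point of a good meridian by an arc of its parallel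
    followed by an arc of that meridian. The parallel costs an oscillation over an interval of
    length 2 pi, with sin z.2 a constant factor along it; the meridian costs the Hardy constant 4.
    Splitting the square of the sum doubles both. *)
Lemma equatorial_poincare (e : R) : 0 < e -> exists c : R,
  I2 (fun z => sin z.2 * (f z - c) ^+ 2) <=
    8 * pi ^+ 2 * S1 + 8 * (S2 + e).
Proof.
move=> e0; have [x0 x0I hx0] := good_meridian e0.
have p0 := @pi_gt0 R; have pp0 := @pi2_gt0 R.
pose c := f (x0, pi / 2); exists c.
have cf0 : continuous (fun z : R * R => f (x0, z.2)).
  apply: (@comp_snd_continuous _ (fun y => f (x0, y))).
  exact: snd_continuous_comp.
have cA : continuous (fun z : R * R => sin z.2 * (f z - f (x0, z.2)) ^+ 2).
  apply: plane_continuousM => //; apply: plane_continuousX.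
  by apply: plane_continuousD => //; exact: plane_continuousN.
have cB : continuous (fun z : R * R => sin z.2 * (f (x0, z.2) - c) ^+ 2).
  apply: plane_continuousM => //; apply: plane_continuousX.
  by apply: plane_continuousD.
have A : I2 (fun z => sin z.2 * (f z - f (x0, z.2)) ^+ 2) <= 4 * pi ^+ 2 * S1.
  rewrite -I2Z; last first.
    by apply: plane_continuousM => //; exact: plane_continuousX.
  apply: I2_le1 => //.
    apply: plane_continuousM => //.
    by apply: plane_continuousM => //; exact: plane_continuousX.
  move=> y y0 /=.
  have s0 : 0 <= sin y by apply: sin_ge0_pi; move: y0; rewrite in_itv.
  have c1 : continuous (fun x => f1 (x, y)) by exact: fst_continuous_comp.
  have c0 : continuous (fun x => f (x, y)) by exact: fst_continuous_comp.
  rewrite !RintegralZl//; last 3 first.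
  - by apply: continuous_integrable; exact: line_continuousX.
  - apply: continuous_integrable; apply: line_continuousM.
      exact: cst_continuous.
    exact: line_continuousX.
  - apply: continuous_integrable; apply: line_continuousX.
    apply: line_continuousD => //; exact: cst_continuous.
  rewrite mulrCA; apply: ler_wpM2l => //.
  set J := \int[leb]_(x in `[0, 2 * pi]) (f1 (x, y) ^+ 2).
  have -> : 4 * pi ^+ 2 * J = \int[leb]_(x in `[0, 2 * pi]) (2 * pi * J).
    by rewrite Rintegral_const ?(ltW pp0)//; ring.
  apply: le_Rintegral => //.
  - apply: continuous_integrable; apply: line_continuousX.
    apply: line_continuousD => //; exact: cst_continuous.
  - by apply: continuous_integrable; exact: cst_continuous.
  - move=> x xI; have := @oscillation_le _ (fun s => f (s, y)) _
      0 (2 * pi) x0 x ((is_derive_sphere2_comp1 cF)^~ y) c1 pp0 x0I xI.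
    by rewrite subr0.
have B : I2 (fun z => sin z.2 * (f (x0, z.2) - c) ^+ 2) <= 4 * (S2 + e).
  rewrite (_ : 4 * _ = I2 (fun z => ((S2 + e) / pi) * sin z.2)); last first.
    rewrite I2Z// I2_sin; move: (pi) p0 (S2 + e) => q /lt0r_neq0 q0 r.
    by field.
  apply: I2_le2 => //; first exact: plane_continuousM.
  move=> x xI /=.
  have c2 : continuous (fun y => f2 (x0, y)) by exact: snd_continuous_comp.
  apply: le_trans (hardy_meridian (is_derive_sphere2_comp2 cF x0) c2) _.
  rewrite RintegralZl//; last first.
    by apply: continuous_integrable; exact: continuous_sin.
  rewrite Rintegral_sin -ler_pdivlMl//; apply: le_trans hx0 _.
  rewrite le_eqVlt; apply/orP; left; apply/eqP.
  by move: (pi) p0 (S2 + e) => q /lt0r_neq0 q0 r; field.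
(* The sum is written as a difference with factor -2 so that [I2B] applies to it. *)
apply: (@le_trans _ _ (I2 (fun z => 2 * (sin z.2 * (f z - f (x0, z.2)) ^+ 2) -
    (-2) * (sin z.2 * (f (x0, z.2) - c) ^+ 2)))).
  apply: I2_le.
  - apply: plane_continuousM => //; apply: plane_continuousX.
    exact: plane_continuousD.
  - apply: plane_continuousD; first exact: plane_continuousM.
    by apply: plane_continuousN; exact: plane_continuousM.
  - move=> z [_ /=]; rewrite in_itv/= => /sin_ge0_pi s0.
    rewrite -subr_ge0; move: (f z) (f (x0, z.2)) (sin z.2) s0 => a b s s0.
    rewrite (_ : _ - _ = s * (a - 2 * b + c) ^+ 2); last by ring.
    by apply: mulr_ge0 => //; exact: sqr_ge0.
rewrite I2B; [|exact: plane_continuousM..].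
by rewrite !I2Z//; lra.
Qed.

Lemma poincare_sphere2 :
  sphere_int (fun p => F p ^+ 2) - sphere_int F ^+ 2 <=
  (8 * pi ^+ 2 + 8) * (sphere_int (fun p => angular F 0 1 p ^+ 2) +
  sphere_int (fun p => angular F 0 (lift 0 1) p ^+ 2) +
  sphere_int (fun p => angular F 1 (lift 0 1) p ^+ 2)).
Proof.
have hd : 3%N = 2%N \/ 3%N = 3%N by right.
have p4 : 0 < 4 * pi :> R by rewrite mulr_gt0// pi_gt0.
have sintE (g : 'rV[R]_3 -> R) : sphere_int g = (4 * pi)^-1 * I2 (fun z => sin z.2 * g (sphere2_pt z)).
  apply: (congr1 (fun x => (4 * pi)^-1 * x)).
  by apply: eq_Rintegral => z _; rewrite mulrC.
set A := sphere_int (fun p => angular F 0 1 p ^+ 2).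
set B := sphere_int (fun p => angular F 0 (lift 0 1) p ^+ 2).
set C := sphere_int (fun p => angular F 1 (lift 0 1) p ^+ 2).
have S1E : (4 * pi)^-1 * S1 = A.
  rewrite /A sintE; congr (_ * _); apply: eq_Rintegral => z _.
  by rewrite /f1 derive_sphere2_tan1.
have S2E : (4 * pi)^-1 * S2 <= B + C.
  rewrite /B /C -sintD//; try exact/scont_integrable/scontX/angular_scont.
  rewrite sintE; apply: ler_wpM2l; first by rewrite invr_ge0 ltW.
  apply: I2_le.
  - by apply: plane_continuousM => //; exact: plane_continuousX.
  - apply: plane_continuousM => //.
    have cBC : scont (fun p => angular F 0 (lift 0 1) p ^+ 2 +
        angular F 1 (lift 0 1) p ^+ 2).
      by apply: scontD; apply: scontX; exact: angular_scont.
    exact: (scont_sphere2_comp cBC).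
  - move=> z [_ /=]; rewrite in_itv/= => /sin_ge0_pi s0.
    apply: ler_wpM2l => //; rewrite /f2 derive_sphere2_tan2//.
    move: (angular F 0 _ _) (angular F 1 _ _) => a b.
    rewrite -subr_ge0 -[a ^+ 2 + b ^+ 2]mul1r -(cos2Dsin2 z.1).
    by rewrite (_ : _ - _ = (sin z.1 * a - cos z.1 * b) ^+ 2) ?sqr_ge0//; ring.
have A0 : 0 <= A by apply: sint_ge0 => // p _; exact: sqr_ge0.
have BC0 : 0 <= B + C.
  by apply: addr_ge0; apply: sint_ge0 => // p _; exact: sqr_ge0.
apply/ler_addgt0Pr => e e0.
(* The slack is scaled to contribute exactly e after the factor 8 and the normalization by 4 pi. *)
have [|c hc] := @equatorial_poincare (e * (4 * pi) / 8).
  by rewrite divr_gt0// mulr_gt0.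
apply: le_trans (sint_variance_le hd c (C1_scont cF)) _.
rewrite sintE; apply: le_trans.
  by apply: ler_wpM2l hc; rewrite invr_ge0 ltW.
have -> : (4 * pi)^-1 * (8 * pi ^+ 2 * S1 + 8 * (S2 + e * (4 * pi) / 8)) =
    8 * pi ^+ 2 * A + 8 * ((4 * pi)^-1 * S2) + e.
  rewrite -S1E; move: (4 * pi) p4 (8 * pi ^+ 2) => q /lt0r_neq0 q0 r.
  by field.
have := sqr_ge0 (pi : R); move: (pi ^+ 2) => q q0.
by nra.
Qed.

End Sphere2.

Lemma sum_pairs2_ge (S : 'I_2 -> 'I_2 -> R) : (forall i j, 0 <= S i j) ->
  S 0 1 <= \sum_i \sum_j S i j.
Proof.
move=> S0; rewrite !big_ord_recl !big_ord0.
rewrite (_ : lift ord0 ord0 = 1); last exact: val_inj.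
have := S0 0 0; have := S0 1 0; have := S0 1 1.
by move: (S 0 0) (S 0 1) (S 1 0) (S 1 1) => *; lra.
Qed.

Lemma sum_pairs3_ge (S : 'I_3 -> 'I_3 -> R) : (forall i j, 0 <= S i j) ->
  S 0 1 + S 0 (lift 0 1) + S 1 (lift 0 1) <= \sum_i \sum_j S i j.
Proof.
move=> S0; rewrite sum_ord3 !(sum_ord3 (S _)).
have := S0 0 0; have := S0 1 0; have := S0 1 1; have := S0 (lift 0 1) 0.
have := S0 (lift 0 1) 1; have := S0 (lift 0 1) (lift 0 1).
by lra.
Qed.

Lemma poincare d : d = 2%N \/ d = 3%N -> exists2 K : R, 0 < K &
  forall F : 'rV[R]_d -> R, C1 F ->
  sphere_int (fun p => F p ^+ 2) - sphere_int F ^+ 2 <=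
  K * \sum_i \sum_j sphere_int (fun p => angular F i j p ^+ 2).
Proof.
move=> hd; have q0 := sqr_ge0 (pi : R).
(* The constant of the 2-sphere also dominates (2 pi)^2, so it serves both dimensions. *)
exists (8 * pi ^+ 2 + 8); first by lra.
have S0 (F : 'rV[R]_d -> R) i j : 0 <= sphere_int (fun p => angular F i j p ^+ 2).
  by apply: sint_ge0 => // p _; exact: sqr_ge0.
move=> F cF; have {}S0 := S0 F; case: hd => hd; subst d.
  apply: le_trans (poincare_circle cF) _.
  apply: le_trans (ler_wpM2r (S0 0 1) (_ : _ <= 8 * pi ^+ 2 + 8)) _.
    by rewrite exprMn; lra.
  apply: ler_wpM2l; first lra.
  exact: (sum_pairs2_ge S0).
apply: le_trans (poincare_sphere2 cF) _.
apply: ler_wpM2l; first lra.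
exact: (sum_pairs3_ge S0).
Qed.

End PoincareSphere.

(** * The spherical Laplacian and moments of linear functions *)

Section SphereLaplacian.
Context {R : realType} {d : nat} (hd : d = 2%N \/ d = 3%N).
Implicit Types (F G : 'rV[R]_d -> R) (p : 'rV[R]_d).
Notation sint := (@sphere_int R d).

Definition lapl F p : R := \sum_j 'D_('e_j) ('D_('e_j) F) p.

Definition radial_hessian F p : R :=
  \sum_j \sum_l p 0 j * p 0 l * 'D_('e_l) ('D_('e_j) F) p.

Definition homog0 F := forall (s : R) p, 0 < s -> F (s *: p) = F p.

Lemma is_derive_coord p v (i : 'I_d) :
  is_derive p v (fun x : 'rV[R]_d => x 0 i) (v 0 i).
Proof.
have := is_derive_dotp 'e_i p v; rewrite dotpC dotp_basisr.
rewrite (_ : dotp ('e_i) = fun x => x 0 i)//.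
by apply/funext => x; rewrite dotpC dotp_basisr.
Qed.

Lemma derive_angular F i j v p : C2 F -> p != 0 ->
  'D_v (angular F i j) p =
    p 0 i * 'D_v ('D_('e_j) F) p + 'D_('e_j) F p * v 0 i
    - (p 0 j * 'D_v ('D_('e_i) F) p + 'D_('e_i) F p * v 0 j).
Proof.
move=> [_ cF] p0; apply/derive_val.
exact: (is_derive_sub
  (is_derive_mul (is_derive_coord p v i) (C1_is_derive v (cF j) p0))
  (is_derive_mul (is_derive_coord p v j) (C1_is_derive v (cF i) p0))).
Qed.

Lemma sum_delta (f : 'I_d -> R) i : \sum_j (i == j)%:R * f j = f i.
Proof.
rewrite (bigD1 i)//= eqxx mul1r big1 ?addr0// => j ji.
by rewrite eq_sym (negbTE ji) mul0r.
Qed.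

(** Bookkeeping for double sums of symmetric expressions: exchanging i and j shows that a term and
    its transpose contribute equally, so that only the termwise algebra is left to the users. *)
Lemma sum_symmetrized (A B D X : 'I_d -> 'I_d -> R) (sA sB sD sX : R) :
  \sum_i \sum_j A i j = sA -> \sum_i \sum_j B i j = sB ->
  \sum_i \sum_j D i j = sD -> \sum_i \sum_j X i j = sX ->
  \sum_i \sum_j (A i j + A j i - (B i j + B j i) - (D i j + D j i)
    + (X i j + X j i)) = 2 * (sA - sB - sD + sX).
Proof.
move=> <- <- <- <-; have sw (Y : 'I_d -> 'I_d -> R) : \sum_i \sum_j Y j i = \sum_i \sum_j Y i j.
  exact: exchange_big.
have lin (Y Z : 'I_d -> 'I_d -> R) :
    \sum_i \sum_j (Y i j + Z i j) = \sum_i \sum_j Y i j + \sum_i \sum_j Z i j.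
  by under eq_bigr do rewrite big_split; rewrite big_split.
have linN (Y : 'I_d -> 'I_d -> R) :
    \sum_i \sum_j - Y i j = - \sum_i \sum_j Y i j.
  by under eq_bigr do rewrite sumrN; rewrite sumrN.
by rewrite !lin !linN !lin (sw A) (sw B) (sw D) (sw X); ring.
Qed.

(** Casimir identity for the rotation group, over ordered pairs. It has two uses: for
    zero-homogeneous F the radial terms vanish and twice the Laplacian remains, while for linear F
    the second-order terms vanish and the eigenvalue d - 1 appears. *)
Lemma sum_angular2 F p : C2 F -> p != 0 ->
  \sum_i \sum_j angular (angular F i j) i j p =
  2 * (dotp p p * lapl F p - radial_hessian F p
       - (d%:R - 1) * \sum_j p 0 j * 'D_('e_j) F p).
Proof.
move=> cF p0.
pose f j := 'D_('e_j) F p; pose H l j := 'D_('e_l) ('D_('e_j) F) p.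
pose q j := p 0 j.
have E i j : angular (angular F i j) i j p =
    q i ^+ 2 * H j j + q j ^+ 2 * H i i - (q i * q j * H j i + q j * q i * H i j)
    - (q i * f i + q j * f j)
    + ((i == j)%:R * (q i * f j) + (i == j)%:R * (q j * f i)).
  rewrite {1}/angular !derive_angular//.
  have ee a b : 'e_a 0 b = (b == a)%:R :> R by rewrite mxE eqxx.
  rewrite !ee !eqxx [j == i]eq_sym -/(f i) -/(f j) -/(q i) -/(q j).
  rewrite -/(H i i) -/(H i j) -/(H j i) -/(H j j).
  move: (f i) (f j) (q i) (q j) (H i i) (H i j) (H j i) (H j j) => *.
  by rewrite /= mulr1n; ring.
pose A i j := q i ^+ 2 * H j j.
pose B i j := q i * q j * H j i.
pose D (i j : 'I_d) := q i * f i.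
pose X i j := (i == j)%:R * (q i * f j).
transitivity (\sum_i \sum_j (A i j + A j i - (B i j + B j i) - (D i j + D j i)
    + (X i j + X j i))).
  apply: eq_bigr => i _; apply: eq_bigr => j _.
  by rewrite E /A /B /D /X [j == i]eq_sym.
have eA : \sum_i \sum_j A i j = dotp p p * lapl F p.
  rewrite /dotp mulr_suml; apply: eq_bigr => i _; rewrite mulr_sumr.
  by apply: eq_bigr => j _; rewrite /A expr2.
have eB : \sum_i \sum_j B i j = radial_hessian F p by [].
have eD : \sum_i \sum_j D i j = d%:R * \sum_j q j * f j.
  rewrite mulr_sumr; apply: eq_bigr => i _.
  by rewrite sumr_const card_ord mulr_natl.
have eX : \sum_i \sum_j X i j = \sum_j q j * f j.
  by apply: eq_bigr => i _; rewrite /X (sum_delta (fun j => q i * f j)).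
apply: (etrans (sum_symmetrized eA eB eD eX)).
have alg (a b c e : R) : 2 * (a - b - e * c + c) = 2 * (a - b - (e - 1) * c).
  by ring.
exact: alg.
Qed.

(** The curve s -> e^s p has velocity p at s = 0 and never leaves the open ray through p, so
    constancy along the ray can be used for all real s. *)
Lemma derive_radial_eq0 G p : differentiable G p ->
  (forall s, G (expR s *: p) = G p) -> 'D_p G p = 0.
Proof.
move=> dG Gp.
have dc : is_derive (0 : R) (1 : R) (fun s => expR s *: p) p.
  apply: is_derive_rV => j.
  rewrite (_ : (fun s => _) = (fun s => expR s * p 0 j)); last first.
    by apply/funext => s; rewrite mxE.
  apply: (is_derive_eq (is_derive_mulr (p 0 j) (is_derive_expR (0 : R)))).
  by rewrite expR0 mul1r.
have p1 : expR 0 *: p = p by rewrite expR0 scale1r.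
have dG' : differentiable G (expR 0 *: p) by rewrite p1.
have := is_derive_curve dG' dc; rewrite p1.
rewrite (_ : (fun s => _) = fun=> G p); last by apply/funext => s; exact: Gp.
by move=> [_ <-]; rewrite derive_cst.
Qed.

Lemma homog0_gradient F p : C1 F -> homog0 F -> p != 0 ->
  \sum_j p 0 j * 'D_('e_j) F p = 0.
Proof.
move=> cF hF p0; have dF := C1_differentiable cF p0.
rewrite -derive_sum_basis//; apply: derive_radial_eq0 => // s.
by apply: hF; exact: expR_gt0.
Qed.

(** Euler's identity, the vanishing of the sum of x_j d_j F, is differentiated along the ray. The
    product rule gives the radial Hessian plus the same Euler sum, which is again zero. *)
Lemma homog0_hessian F p : C2 F -> homog0 F -> p != 0 -> radial_hessian F p = 0.
Proof.
move=> [cF cF'] hF p0.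
pose E (x : 'rV[R]_d) := \sum_j x 0 j * 'D_('e_j) F x.
have dE : is_derive p p E
    (\sum_j (p 0 j * 'D_p ('D_('e_j) F) p + 'D_('e_j) F p * p 0 j)).
  apply: is_derive_bigsum => j.
  exact: (is_derive_mul (is_derive_coord p p j) (C1_is_derive p (cF' j) p0)).
have difE : differentiable E p.
  rewrite (_ : E = \sum_j (fun x : 'rV[R]_d => x 0 j * 'D_('e_j) F x)).
    apply: differentiable_sum => j; apply: differentiableM.
      exact: differentiable_coord.
    exact: (C1_differentiable (cF' j) p0).
  by apply/funext => y; rewrite fct_sumE.
have := derive_val (is_derive := dE).
rewrite derive_radial_eq0//; last first.
  move=> s; rewrite /E !homog0_gradient// scaler_eq0 negb_or p0 andbT.
  exact: lt0r_neq0 (expR_gt0 s).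
rewrite big_split/= => /esym.
under [X in _ + X]eq_bigr do rewrite mulrC.
rewrite homog0_gradient// addr0 => e0; rewrite -[RHS]e0.
apply: eq_bigr => j _; rewrite derive_sum_basis; last exact: (C1_differentiable (cF' j) p0).
by rewrite mulr_sumr; apply: eq_bigr => l _; rewrite mulrA.
Qed.

Lemma lapl_angular F p : C2 F -> homog0 F -> on_sphere p ->
  lapl F p = 2^-1 * \sum_i \sum_j angular (angular F i j) i j p.
Proof.
move=> cF hF sp; have p0 := sphere_neq0 sp.
rewrite sum_angular2// homog0_hessian// homog0_gradient//; last exact: C2_C1.
move/on_sphereE : sp => ->.
by rewrite mulr0 !subr0 mul1r mulKf.
Qed.

(** G enters only through rotation fields, which are tangent to the sphere; this lets constants,
    linear functions and F itself serve as test functions. *)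
Lemma sint_lapl F G : C2 F -> homog0 F -> C1 G ->
  sint (fun p => G p * lapl F p) =
  - (2^-1 * \sum_i \sum_j sint (fun p => angular G i j p * angular F i j p)).
Proof.
move=> cF hF cG.
have cA i j : scont (fun p => G p * angular (angular F i j) i j p).
  by apply: scontM; [exact: C1_scont|exact/angular_scont/C1_angular].
transitivity (sint (fun p => 2^-1 *
    \sum_i \sum_j G p * angular (angular F i j) i j p)).
  apply: eq_sint => // p sp; rewrite lapl_angular// mulrCA mulr_sumr.
  by congr (_ * _); apply: eq_bigr => i _; rewrite mulr_sumr.
rewrite sintZ//; last first.
  by apply: scont_integrable => //; do 2 apply: scont_sum => ?; exact: cA.
rewrite sint_sum//; last by move=> i; apply: scont_sum => j; exact: cA.
rewrite -mulrN -sumrN; congr (_ * _); apply: eq_bigr => i _.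
rewrite sint_sum// -sumrN; apply: eq_bigr => j _.
by apply: sint_by_parts => //; exact: C1_angular.
Qed.

Lemma lapl_dotp w p : lapl (dotp w) p = 0.
Proof.
by apply: big1 => j _; rewrite derive_dotp; exact: derive_cst.
Qed.

Lemma radial_hessian_dotp w p : radial_hessian (dotp w) p = 0.
Proof.
apply: big1 => j _; apply: big1 => l _.
by rewrite derive_dotp derive_cst mulr0.
Qed.

Lemma sum_angular2_dotp w p : p != 0 ->
  \sum_i \sum_j angular (angular (dotp w) i j) i j p =
  - (2 * (d%:R - 1) * dotp w p).
Proof.
move=> p0; rewrite sum_angular2//; last exact: C2_dotp.
rewrite lapl_dotp radial_hessian_dotp -derive_sum_basis; last exact: dotp_differentiable.
by rewrite (derive_val (is_derive := is_derive_dotp w p p)); ring.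
Qed.

(** Self-adjointness of the spherical Laplacian and its eigenvalue -(d - 1) on linear functions.
    Both rotations are moved to [dotp w] and evaluated there by the Casimir identity, because the
    Euclidean Laplacian of [dotp w] is zero. *)
Lemma sint_dotp_lapl F w : C2 F -> homog0 F ->
  sint (fun p => dotp w p * lapl F p) =
  - ((d%:R - 1) * sint (fun p => dotp w p * F p)).
Proof.
move=> cF hF; rewrite sint_lapl//; last exact: C1_dotp.
have cA i j : scont (fun p => F p * angular (angular (dotp w) i j) i j p).
  apply: scontM; first exact/C1_scont/C2_C1.
  exact/angular_scont/C1_angular/C2_dotp.
have E i j : sint (fun p => angular (dotp w) i j p * angular F i j p) =
    - sint (fun p => F p * angular (angular (dotp w) i j) i j p).
  rewrite sint_by_parts//; last exact: C2_C1; last exact/C1_angular/C2_dotp.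
  by congr (- _); apply: eq_sint => // p _; rewrite mulrC.
under eq_bigr do under eq_bigr do rewrite E.
under eq_bigr do rewrite sumrN -sint_sum//.
rewrite sumrN -sint_sum; [|by []|by move=> i; apply: scont_sum].
rewrite mulrN opprK.
transitivity (2^-1 * sint (fun p => (- (2 * (d%:R - 1))) * (dotp w p * F p))).
  congr (_ * _); apply: eq_sint => // p /sphere_neq0 p0.
  under eq_bigr do rewrite -mulr_sumr.
  by rewrite -mulr_sumr sum_angular2_dotp//; ring.
rewrite sintZ//; first by move: (sint _) => *; field.
apply: scont_integrable => //; apply: scontM; first exact: scont_dotp.
exact/C1_scont/C2_C1.
Qed.

End SphereLaplacian.

Section Moments.
Context {R : realType} {d : nat} (hd : d = 2%N \/ d = 3%N).
Variable kv : 'rV[R]_d.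
Hypothesis kv0 : kv != 0.
Implicit Types (F : 'rV[R]_d -> R) (p w : 'rV[R]_d).
Notation sint := (@sphere_int R d).

Lemma dotp_kv_gt0 : 0 < dotp kv kv.
Proof. by rewrite lt_def dotp_eq0 kv0 dotp_ge0. Qed.

Lemma lagrange_identity w p :
  \sum_i \sum_j (p 0 i * w 0 j - p 0 j * w 0 i) ^+ 2 =
  2 * (dotp p p * dotp w w - dotp w p ^+ 2).
Proof.
pose A i j := p 0 i ^+ 2 * w 0 j ^+ 2.
pose B i j := (w 0 i * p 0 i) * (w 0 j * p 0 j).
pose Z (i j : 'I_d) : R := 0.
have eA : \sum_i \sum_j A i j = dotp p p * dotp w w.
  rewrite /dotp mulr_suml; apply: eq_bigr => i _; rewrite mulr_sumr.
  by apply: eq_bigr => j _; rewrite /A !expr2.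
have eB : \sum_i \sum_j B i j = dotp w p ^+ 2.
  rewrite expr2 {1}/dotp mulr_suml; apply: eq_bigr => i _.
  by rewrite mulr_sumr.
have eZ : \sum_i \sum_j Z i j = 0 by apply: big1 => i _; apply: big1.
transitivity (\sum_i \sum_j (A i j + A j i - (B i j + B j i) - (Z i j + Z j i)
    + (Z i j + Z j i))).
  apply: eq_bigr => i _; apply: eq_bigr => j _.
  by rewrite /A /B /Z; ring.
by apply: (etrans (sum_symmetrized eA eB eZ eZ)); ring.
Qed.

Lemma dotp_cauchy_schwarz w p : dotp w p ^+ 2 <= dotp p p * dotp w w.
Proof.
rewrite -subr_ge0 -(@pmulr_rge0 _ 2)// -lagrange_identity.
by apply: sumr_ge0 => i _; apply: sumr_ge0 => j _; exact: sqr_ge0.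
Qed.

Lemma angular_dotpX n w i j p : p != 0 ->
  angular (fun x => dotp w x ^+ n) i j p =
  n%:R * dotp w p ^+ n.-1 * (p 0 i * w 0 j - p 0 j * w 0 i).
Proof.
move=> p0; have E v : 'D_v (fun x => dotp w x ^+ n) p =
    n%:R * dotp w p ^+ n.-1 * dotp w v.
  elim: n => [|[|n] IH].
  - by rewrite !mul0r; exact: (derive_cst (1 : R) p v).
  - by rewrite mul1r expr0 mul1r; apply/derive_val/is_derive_dotp.
  rewrite (_ : (fun x => _) = (fun x => dotp w x * dotp w x ^+ n.+1)); last first.
    by apply/funext => x; rewrite exprS.
  have cX : C1 (fun x => dotp w x ^+ n.+1) by exact/C1X/C1_dotp.
  rewrite (derive_val (is_derive := is_derive_mul (is_derive_dotp w p v)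
    (C1_is_derive v cX p0))) IH /= [_%:R in RHS]mulrS exprS.
  by move: (dotp w p) (dotp w v) (n.+1%:R) => *; ring.
by rewrite /angular !E !dotp_basisr; ring.
Qed.

(** Rotation in the plane of kv and w: the combination of rotation fields with coefficients kv_i w_j
    maps K^(n+1) to -(n+1) |kv|^2 K^n (w . p) when w is orthogonal to kv, and its mean is zero. The
    cases n = 1 and n = 2 say that K v is orthogonal to 1 and to K. *)
Lemma sint_dotpX_perp n w : dotp kv w = 0 ->
  sint (fun p => dotp kv p ^+ n * dotp w p) = 0.
Proof.
move=> kw; have cX : C1 (fun x => dotp kv x ^+ n.+1) by exact/C1X/C1_dotp.
have sA i j : scont (fun p => kv 0 i * w 0 j *
    angular (fun x => dotp kv x ^+ n.+1) i j p).
  by apply: scontM; [exact: scont_cst|exact: angular_scont].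
have : sint (fun p => \sum_i \sum_j kv 0 i * w 0 j *
    angular (fun x => dotp kv x ^+ n.+1) i j p) = 0.
  rewrite sint_sum//; last by move=> i; apply: scont_sum.
  apply: big1 => i _; rewrite sint_sum//; apply: big1 => j _.
  rewrite sintZ//; last by apply: scont_integrable => //; exact: angular_scont.
  by rewrite sint_angular// mulr0.
have sW : scont (fun p => dotp kv p ^+ n * dotp w p).
  by apply: scontM; [exact/scontX/scont_dotp|exact: scont_dotp].
have -> : sint (fun p => \sum_i \sum_j kv 0 i * w 0 j *
    angular (fun x => dotp kv x ^+ n.+1) i j p) =
    - (n.+1%:R * dotp kv kv) * sint (fun p => dotp kv p ^+ n * dotp w p).
  rewrite -sintZ//; last exact: scont_integrable.
  apply: eq_sint => // p /sphere_neq0 p0.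
  set c := n.+1%:R * dotp kv p ^+ n.
  have -> : - (n.+1%:R * dotp kv kv) * (dotp kv p ^+ n * dotp w p) =
      c * (dotp kv p * dotp kv w - dotp kv kv * dotp w p).
    by rewrite kw /c; ring.
  rewrite {2 3 4}/dotp !mulr_suml -sumrB mulr_sumr; apply: eq_bigr => i _.
  rewrite {1}/dotp !mulr_sumr -sumrB mulr_sumr; apply: eq_bigr => j _.
  by rewrite angular_dotpX//= -/c; ring.
move/eqP; rewrite mulf_eq0 oppr_eq0 mulf_eq0 pnatr_eq0/=.
by rewrite (negbTE (lt0r_neq0 dotp_kv_gt0)) => /eqP.
Qed.

Lemma dim_gt1 : 0 < d%:R - 1 :> R.
Proof. by case: hd => ->; rewrite subr_gt0 ltr1n. Qed.

(** By the Casimir identity -2 (d - 1) times a linear function is a sum of rotation derivatives,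
    hence has mean zero; d > 1 permits the division. *)
Lemma sint_dotp w : sint (dotp w) = 0.
Proof.
have sA i j : scont (angular (angular (dotp w) i j) i j).
  exact/angular_scont/C1_angular/C2_dotp.
have : sint (fun p => \sum_i \sum_j angular (angular (dotp w) i j) i j p) = 0.
  rewrite sint_sum//; last by move=> i; apply: scont_sum.
  apply: big1 => i _; rewrite sint_sum//; apply: big1 => j _.
  by apply: sint_angular => //; exact/C1_angular/C2_dotp.
have -> : sint (fun p => \sum_i \sum_j angular (angular (dotp w) i j) i j p) =
    - (2 * (d%:R - 1)) * sint (dotp w).
  rewrite -sintZ//; last exact/scont_integrable/scont_dotp.
  apply: eq_sint => // p /sphere_neq0 p0.
  by rewrite sum_angular2_dotp// mulNr.
move/eqP; rewrite mulf_eq0 oppr_eq0 mulf_eq0 pnatr_eq0/=.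
by rewrite (negbTE (lt0r_neq0 dim_gt1)) => /eqP.
Qed.

(** The Dirichlet sum of the linear function is computed twice: by parts and the eigenvalue it is 2
    (d - 1) I, and by Lagrange's identity on unit vectors it is 2 (|w|^2 - I). *)
Lemma sint_dotp_sqr w : sint (fun p => dotp w p ^+ 2) = dotp w w / d%:R.
Proof.
have sA i j : scont (angular (angular (dotp w) i j) i j).
  exact/angular_scont/C1_angular/C2_dotp.
have sB i j : scont (fun p => dotp w p * angular (angular (dotp w) i j) i j p).
  by apply: scontM; [exact: scont_dotp|exact: sA].
have sC i j : scont (fun p => angular (dotp w) i j p * angular (dotp w) i j p).
  by apply: scontM; exact/angular_scont/C1_dotp.
have s2 : scont (fun p => dotp w p ^+ 2) by exact/scontX/scont_dotp.
set I := sint (fun p => dotp w p ^+ 2).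
have e1 : \sum_i \sum_j sint (fun p => dotp w p *
    angular (angular (dotp w) i j) i j p) = - (2 * (d%:R - 1)) * I.
  under eq_bigr do rewrite -sint_sum//.
  rewrite -sint_sum//; last by move=> i; apply: scont_sum.
  rewrite -sintZ//; last exact: scont_integrable.
  apply: eq_sint => // p /sphere_neq0 p0.
  under eq_bigr do rewrite -mulr_sumr.
  by rewrite -mulr_sumr sum_angular2_dotp//; ring.
have e2 : \sum_i \sum_j sint (fun p => angular (dotp w) i j p *
    angular (dotp w) i j p) = 2 * (dotp w w - I).
  under eq_bigr do rewrite -sint_sum//.
  rewrite -sint_sum//; last by move=> i; apply: scont_sum.
  rewrite -[dotp w w in RHS](sint_cst hd) -sintB//; last first.
  - exact: scont_integrable.
  - by apply: scont_integrable => //; exact: scont_cst.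
  rewrite -sintZ//; last first.
    by apply: scont_integrable => //; apply: scontB => //; exact: scont_cst.
  apply: eq_sint => // p /on_sphereE pp.
  transitivity (2 * (dotp p p * dotp w w - dotp w p ^+ 2)).
    rewrite -lagrange_identity.
    by apply: eq_bigr => i _; apply: eq_bigr => j _; rewrite angular_dotp expr2.
  by rewrite pp mul1r.
have e3 : - (2 * (d%:R - 1)) * I = - (2 * (dotp w w - I)).
  rewrite -e1 -e2 -sumrN; apply: eq_bigr => i _; rewrite -sumrN.
  apply: eq_bigr => j _; apply: sint_by_parts => //; first exact: C1_dotp.
  exact/C1_angular/C2_dotp.
have d0 : d%:R != 0 :> R by case: hd => ->; rewrite pnatr_eq0.
apply: (mulfI d0); rewrite mulrCA divff// mulr1.
move: e3; clear; move: I (dotp w w) (d%:R : R) => a b c e3.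
have : 2 * (c * a) = 2 * b by rewrite -[LHS]opprK; lra.
by apply: mulfI.
Qed.

End Moments.

(** * The shear force *)

Section Bounds.
Context {R : realType} {d : nat} (hd : d = 2%N \/ d = 3%N).
Variable kv : 'rV[R]_d.
Hypothesis kv0 : kv != 0.
Implicit Types (a b : 'rV[R]_d -> R) (p w : 'rV[R]_d).
Notation sint := (@sphere_int R d).
Notation K := (dotp kv).
Notation k2 := (dotp kv kv).

(** [perp i] is the projection of the i-th basis vector, so that [dotp (perp i) p] is the i-th
    component of the vector v p of the overview, and the vector alpha is [shear a]. *)
Definition perp (i : 'I_d) : 'rV[R]_d := 'e_i - (kv 0 i / k2) *: kv.

Definition shear a i : R := sint (fun p => K p * dotp (perp i) p * a p).

Definition shear_force a p : R := K p * \sum_i dotp (perp i) p * shear a i.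

Definition sphere_variance a : R := sint (fun p => a p ^+ 2) - sint a ^+ 2.

Let k2p : 0 < k2. Proof. exact: dotp_kv_gt0. Qed.
Let k2n : k2 != 0. Proof. exact: lt0r_neq0. Qed.

Lemma dotp_perp i p : dotp (perp i) p = p 0 i - kv 0 i / k2 * K p.
Proof. by rewrite /perp dotpDl -scaleNr dotpZl dotpC dotp_basisr mulNr. Qed.

Lemma perp_orthogonal i : dotp kv (perp i) = 0.
Proof. by rewrite dotpC dotp_perp divfK// subrr. Qed.

Lemma sum_perp_mul p q : \sum_i dotp (perp i) p * dotp (perp i) q =
  dotp p q - K p * K q / k2.
Proof.
under eq_bigr do rewrite !dotp_perp.
transitivity (\sum_i (p 0 i * q 0 i - K q / k2 * (kv 0 i * p 0 i)
    - K p / k2 * (kv 0 i * q 0 i) + K p * K q / k2 ^+ 2 * (kv 0 i * kv 0 i))).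
  by apply: eq_bigr => i _; move: k2n; generalize k2 => c c0; field.
rewrite big_split/= !sumrB -!mulr_sumr -/(dotp kv p) -/(dotp kv q) -/(dotp kv kv).
rewrite -/(dotp p q).
by move: k2n (dotp p q) (K p) (K q); generalize k2 => c c0 *; field.
Qed.

Lemma sphere_variance_ge0 a : scont a -> 0 <= sphere_variance a.
Proof.
move=> ca; rewrite /sphere_variance -sint_variance//.
by apply: sint_ge0 => // p _; exact: sqr_ge0.
Qed.

(** Cauchy-Schwarz for phi against a minus its mean. All moment bounds go through it, so that they
    are paid by the variance alone, the quantity controlled by diffusion. *)
Lemma sint_covariance_le phi a : scont phi -> scont a ->
  (sint (fun p => phi p * a p) - sint phi * sint a) ^+ 2 <=
  sint (fun p => phi p ^+ 2) * sphere_variance a.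
Proof.
move=> cphi ca; have cm : scont (fun p => a p - sint a).
  by apply: scontB => //; exact: scont_cst.
rewrite /sphere_variance -sint_variance//.
apply: le_trans (sint_cauchy_schwarz hd cphi cm).
rewrite le_eqVlt; apply/orP; left; apply/eqP; congr (_ ^+ 2).
rewrite [_ * sint a]mulrC -sintZ//; last exact: scont_integrable.
rewrite -sintB//.
- by apply: eq_sint => // p _; ring.
- by apply: scont_integrable => //; exact: scontM.
- apply: scont_integrable => //; apply: scontM => //; exact: scont_cst.
Qed.

Lemma sphere_dotp_sqr_le w p : on_sphere p -> dotp w p ^+ 2 <= dotp w w.
Proof.
by move=> /on_sphereE pp; have := dotp_cauchy_schwarz w p; rewrite pp mul1r.
Qed.

Lemma first_moment_sqr_le a : scont a -> sint (fun p => K p * a p) ^+ 2 <= k2 * sphere_variance a.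
Proof.
move=> ca; have := sint_covariance_le (@scont_dotp _ _ kv) ca.
rewrite sint_dotp// mul0r subr0 sint_dotp_sqr// => h; apply: le_trans h _.
apply: ler_wpM2r; first exact: sphere_variance_ge0.
rewrite ler_pdivrMr; last by case: hd => ->; rewrite ltr0n.
by rewrite ler_peMr// ?(ltW k2p)//; case: hd => ->; rewrite ler1n.
Qed.

(** The subtracted term is the contribution of the mean of a; in the evolution of the first moment
    it is what damps the mean, and the rest is an error. *)
Lemma second_moment_sqr_le a : scont a ->
  (sint (fun p => K p ^+ 2 * a p) - k2 / d%:R * sint a) ^+ 2 <=
  k2 ^+ 2 * sphere_variance a.
Proof.
move=> ca; have cK : scont (fun p => K p ^+ 2) by exact/scontX/scont_dotp.
have := sint_covariance_le cK ca; rewrite sint_dotp_sqr// => h; apply: le_trans h _.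
apply: ler_wpM2r; first exact: sphere_variance_ge0.
rewrite -[leRHS](sint_cst hd); apply: le_sint => //.
- by apply: scont_integrable => //; exact: scontX.
- by apply: scont_integrable => //; exact: scont_cst.
- move=> p sp; apply: lerXn2r; rewrite ?nnegrE; [exact: sqr_ge0|exact: ltW|].
  exact: (sphere_dotp_sqr_le kv sp).
Qed.

Lemma scont_shear i : scont (fun p => K p * dotp (perp i) p).
Proof. by apply: scontM; exact: scont_dotp. Qed.

Lemma sint_shear i : sint (fun p => K p * dotp (perp i) p) = 0.
Proof.
have := sint_dotpX_perp hd kv0 1 (perp_orthogonal i).
by under eq_fun do rewrite expr1.
Qed.

(** The squares are summed under the integral before they are estimated: the projection of p has
    length at most 1, so the sum of (K v_i)^2 is at most K^2 <= |kv|^2, with no factor d. *)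
Lemma sum_shear_sqr_le a : scont a -> \sum_i shear a i ^+ 2 <= k2 * sphere_variance a.
Proof.
move=> ca; apply: (@le_trans _ _
    (\sum_i sint (fun p => (K p * dotp (perp i) p) ^+ 2) * sphere_variance a)).
  apply: ler_sum => i _; have := sint_covariance_le (@scont_shear i) ca.
  by rewrite sint_shear mul0r subr0.
have cS i : scont (fun p => (K p * dotp (perp i) p) ^+ 2).
  exact/scontX/scont_shear.
rewrite -mulr_suml -sint_sum//; apply: ler_wpM2r; first exact: sphere_variance_ge0.
rewrite -[leRHS](sint_cst hd); apply: le_sint => //.
- by apply: scont_integrable => //; exact: scont_sum.
- by apply: scont_integrable => //; exact: scont_cst.
- move=> p sp; under eq_bigr do rewrite exprMn.
  rewrite -mulr_sumr; under eq_bigr do rewrite expr2.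
  rewrite sum_perp_mul; move/on_sphereE: (sp) => ->.
  have := sphere_dotp_sqr_le kv sp; have := sqr_ge0 (K p).
  move: (K p ^+ 2) => q q0 qk.
  apply: (@le_trans _ _ (q * 1)); last by rewrite mulr1.
  apply: ler_wpM2l => //; rewrite lerBlDr lerDl.
  apply: divr_ge0; last exact: ltW.
  by rewrite -expr2; exact: sqr_ge0.
Qed.

Lemma scont_shear_force a : scont (shear_force a).
Proof.
apply: scontM; first exact: scont_dotp.
by apply: scont_sum => i; apply: scontM; [exact: scont_dotp|exact: scont_cst].
Qed.

(** With g = a this is the sum of squares that gives the coupling its sign; with g = 1 or g = K
    every [shear g i] vanishes. *)
Lemma sint_mul_shear_force g a : scont g ->
  sint (fun p => g p * shear_force a p) = \sum_i shear g i * shear a i.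
Proof.
move=> cg; have cS i : scont (fun p => K p * dotp (perp i) p * g p).
  by apply: scontM => //; exact: scont_shear.
transitivity (sint (fun p => \sum_i shear a i * (K p * dotp (perp i) p * g p))).
  apply: eq_sint => // p _; rewrite /shear_force !mulr_sumr.
  by apply: eq_bigr => i _; ring.
rewrite sint_sum//; last by move=> i; apply: scontM => //; exact: scont_cst.
by apply: eq_bigr => i _; rewrite sintZ 1?mulrC//; exact: scont_integrable.
Qed.

End Bounds.

(** * The Lyapunov functional *)

Section LyapunovAlgebra.
Context {R : realType}.
Implicit Types (nu mu c m j r s G D kappa : R).

Lemma young m s (e : R) : 0 < e -> 2 * (m * s) <= e * m ^+ 2 + e^-1 * s ^+ 2.
Proof.
move=> e0; rewrite -subr_ge0.
rewrite (_ : _ - _ = e^-1 * (e * m - s) ^+ 2); last by field; exact: lt0r_neq0.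
by apply: mulr_ge0; [rewrite invr_ge0 ltW|exact: sqr_ge0].
Qed.

Lemma flux_term_le c mu (k2 : R) j G : 0 < c -> 0 < mu -> 0 < k2 ->
  j ^+ 2 <= k2 * G -> 2 * (c * mu / k2) * j ^+ 2 <= 2 * (c * mu * G).
Proof.
move=> c0 mu0 k0 jG; have -> : 2 * (c * mu * G) = 2 * (c * mu / k2) * (k2 * G).
  by field; exact: lt0r_neq0.
by apply: ler_wpM2l => //; rewrite mulr_ge0// ltW// divr_gt0// mulr_gt0.
Qed.

(** Young's inequality with weight 1/12 on the mean; the dual weight 12 falls on the variance. *)
Lemma moment_term_le c mu (k2 : R) r m G : 0 < c -> 0 < mu -> 0 < k2 ->
  r ^+ 2 <= k2 ^+ 2 * G ->
  - (2 * (c * mu / k2) * (r * m)) <= c * mu * (12^-1 * m ^+ 2 + 12 * G).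
Proof.
move=> c0 mu0 k0 rG; have k0' := lt0r_neq0 k0.
pose q := - (r / k2); have qG : q ^+ 2 <= G.
  rewrite /q sqrrN exprMn exprVn ler_pdivrMr ?exprn_gt0//.
  by rewrite mulrC.
have -> : - (2 * (c * mu / k2) * (r * m)) = c * mu * (2 * (m * q)).
  by rewrite /q; field.
apply: ler_wpM2l; first by rewrite mulr_ge0 ?ltW.
apply: le_trans (young m q (_ : 0 < 12^-1)) _; first by rewrite invr_gt0.
by rewrite invrK lerD2l; apply: ler_wpM2l.
Qed.

(** The factor nu may be much larger than mu. The bound mu nu <= k2 gives mu (nu j / k2)^2 <= nu G,
    so the term is charged to diffusion at the cost c nu G. The constant is 48 = 12 * 2^2, since D -
    1 <= 2. *)
Lemma damping_term_le c mu (k2 : R) nu D j m G : 0 < c -> 0 < mu -> 0 < k2 -> 0 < nu ->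
  0 <= G -> mu * nu <= k2 -> 1 <= D <= 3 -> j ^+ 2 <= k2 * G ->
  2 * (c * mu / k2) * (nu * (D - 1) * (m * j)) <=
  c * mu * (12^-1 * m ^+ 2) + 48 * (c * nu * G).
Proof.
move=> c0 mu0 k0 nu0 G0 mn /andP[D1 D3] jG; have k0' := lt0r_neq0 k0.
pose q := (D - 1) * (nu / k2 * j).
have -> : 2 * (c * mu / k2) * (nu * (D - 1) * (m * j)) = c * mu * (2 * (m * q)).
  by rewrite /q; field.
have cm0 : 0 < c * mu by rewrite mulr_gt0.
have q4 : q ^+ 2 <= 4 * (nu / k2 * j) ^+ 2.
  rewrite /q exprMn; apply: ler_wpM2r; first exact: sqr_ge0.
  by rewrite (_ : 4 = 2 ^+ 2 :> R) ?lerXn2r ?nnegrE//; [lra|lra|ring].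
have q5 : mu * (nu / k2 * j) ^+ 2 <= nu * G.
  rewrite exprMn; have -> : nu * G = mu * (nu / k2) ^+ 2 * (k2 * G) +
      nu * G * (1 - mu * nu / k2) by field.
  have h1 : mu * ((nu / k2) ^+ 2 * j ^+ 2) <= mu * (nu / k2) ^+ 2 * (k2 * G).
    rewrite mulrA; apply: ler_wpM2l => //.
    by apply: mulr_ge0; [exact: ltW|exact: sqr_ge0].
  have h2 : 0 <= nu * G * (1 - mu * nu / k2).
    apply: mulr_ge0; first by apply: mulr_ge0 => //; exact: ltW.
    by rewrite subr_ge0 ler_pdivrMr// mul1r.
  by lra.
have y := young m q (_ : 0 < 12^-1).
have {}y : 2 * (m * q) <= 12^-1 * m ^+ 2 + 12 * q ^+ 2.
  by rewrite -[12 in X in _ + X]invrK; apply: y; rewrite invr_gt0.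
have : c * mu * (2 * (m * q)) <= c * mu * (12^-1 * m ^+ 2 + 12 * q ^+ 2).
  by apply: ler_wpM2l => //; exact: ltW.
move=> h; apply: le_trans h _; rewrite mulrDr lerD2l.
apply: (@le_trans _ _ (c * mu * (12 * (4 * (nu / k2 * j) ^+ 2)))).
  by apply: ler_wpM2l; [exact: ltW|apply: ler_wpM2l].
have -> : c * mu * (12 * (4 * (nu / k2 * j) ^+ 2)) =
  48 * (c * (mu * (nu / k2 * j) ^+ 2)) by ring.
apply: ler_wpM2l => //; rewrite -[c * nu * G]mulrA; apply: ler_wpM2l => //.
exact: ltW.
Qed.

(** Balance of constants. On each mean, in units of c mu: the gain is 2 / D >= 2/3, and two errors
    take 1/12 each, leaving 1/2. On each variance, in units of c nu: 2 from the flux, 12 from the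
    moment remainder and 48 from the damping make 62, and the required rate adds 1/2, which stays
    below 63. *)
Lemma lyapunov_dissipation nu (k2 : R) mu kappa D c (ma mb ja jb ra rb Ga Gb : R) (E' : R) :
  0 < nu -> 0 < k2 -> 0 < mu -> mu <= nu -> mu * nu <= k2 -> 2 <= D <= 3 ->
  0 < c -> 63 * c <= kappa -> 0 <= Ga -> 0 <= Gb ->
  ja ^+ 2 <= k2 * Ga -> jb ^+ 2 <= k2 * Gb ->
  ra ^+ 2 <= k2 ^+ 2 * Ga -> rb ^+ 2 <= k2 ^+ 2 * Gb ->
  E' <= - (kappa * (nu * (Ga + Gb))) ->
  E' + 2 * (c * mu / k2) * (ja ^+ 2 + jb ^+ 2 - (k2 / D * ma + ra) * ma
     - (k2 / D * mb + rb) * mb - nu * (D - 1) * (ma * jb - mb * ja)) <=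
  - (c / 2 * mu * (ma ^+ 2 + mb ^+ 2 + (Ga + Gb))).
Proof.
move=> nu0 k0 mu0 mn mnk /andP[D2 D3] c0 ck Ga0 Gb0 hja hjb hra hrb hE.
have D1 : 1 <= D <= 3 by apply/andP; split; lra.
have A1 := flux_term_le c0 mu0 k0 hja; have A2 := flux_term_le c0 mu0 k0 hjb.
have B1 := moment_term_le ma c0 mu0 k0 hra.
have B2 := moment_term_le mb c0 mu0 k0 hrb.
(* The cross term is antisymmetric, so its two halves need opposite signs of the mean. *)
have C1 := damping_term_le (- ma) c0 mu0 k0 nu0 Gb0 mnk D1 hjb.
have C2 := damping_term_le mb c0 mu0 k0 nu0 Ga0 mnk D1 hja.
rewrite sqrrN in C1.
have D0 : 0 < D by lra.
have [k0' D0'] := (lt0r_neq0 k0, lt0r_neq0 D0).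
set g := c * mu / k2 in A1 A2 B1 B2 C1 C2 *.
have gk : g * k2 = c * mu by rewrite /g divfK.
have cm0 : 0 < c * mu by rewrite mulr_gt0.
have M (m : R) : 2 * (c * mu) / 3 * m ^+ 2 <= 2 * g * (k2 / D * m * m).
  have -> : 2 * g * (k2 / D * m * m) = 2 * (c * mu) / D * m ^+ 2.
    by rewrite -gk; field.
  apply: ler_wpM2r; first exact: sqr_ge0.
  by apply: ler_wpM2l; [lra|rewrite lef_pV2// posrE; lra].
have Ma := M ma; have Mb := M mb.
have cn0 : 0 < c * nu by rewrite mulr_gt0.
have G1 : c * mu * (Ga + Gb) <= c * nu * (Ga + Gb).
  by apply: ler_wpM2r; [lra|apply: ler_wpM2l => //; exact: ltW].
have G2 : 63 * c * (nu * (Ga + Gb)) <= kappa * (nu * (Ga + Gb)).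
  by apply: ler_wpM2r => //; apply: mulr_ge0; [exact: ltW|lra].
set lhs := E' + _; set rhs := - _.
have lhsE : lhs = E' + 2 * g * ja ^+ 2 + 2 * g * jb ^+ 2
   - 2 * g * (k2 / D * ma * ma) - 2 * g * (k2 / D * mb * mb)
   - (2 * g * (ra * ma)) - (2 * g * (rb * mb))
   + 2 * g * (nu * (D - 1) * (- ma * jb)) + 2 * g * (nu * (D - 1) * (mb * ja)).
  by rewrite /lhs; ring.
have ub : lhs <= - (kappa * (nu * (Ga + Gb))) + 2 * (c * mu * Ga) + 2 * (c * mu * Gb)
  - 2 * (c * mu) / 3 * ma ^+ 2 - 2 * (c * mu) / 3 * mb ^+ 2
  + c * mu * (12^-1 * ma ^+ 2 + 12 * Ga) + c * mu * (12^-1 * mb ^+ 2 + 12 * Gb)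
  + (c * mu * (12^-1 * ma ^+ 2) + 48 * (c * nu * Gb))
  + (c * mu * (12^-1 * mb ^+ 2) + 48 * (c * nu * Ga)).
  by rewrite lhsE; lra.
apply: le_trans ub _; rewrite /rhs.
have Gc : c * mu * (Ga + Gb) = c * mu * Ga + c * mu * Gb by ring.
have Gd : c * nu * (Ga + Gb) = c * nu * Ga + c * nu * Gb by ring.
have Ge : 63 * c * (nu * (Ga + Gb)) = 63 * (c * nu * Ga) + 63 * (c * nu * Gb) by ring.
have ma0 : 0 <= c * mu * ma ^+ 2 by apply: mulr_ge0; [exact: ltW|exact: sqr_ge0].
have mb0 : 0 <= c * mu * mb ^+ 2 by apply: mulr_ge0; [exact: ltW|exact: sqr_ge0].
have Na : 0 <= c * mu * Ga by apply: mulr_ge0 => //; exact: ltW.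
have Nb : 0 <= c * mu * Gb by apply: mulr_ge0 => //; exact: ltW.
lra.
Qed.

(** Here (mu j / k2)^2 <= G because mu^2 <= mu nu <= k2. The number e is a sign, so one inequality
    bounds the cross term on both sides. Summed over the two pairs of mean and flux it gives half of
    E, which makes the functional comparable to E. *)
Lemma lyapunov_cross_le mu (k2 : R) nu c m j G (e : R) :
  0 < mu -> 0 < k2 -> 0 < c -> c <= 2^-1 -> mu <= nu -> mu * nu <= k2 -> 0 <= G ->
  e ^+ 2 = 1 -> j ^+ 2 <= k2 * G ->
  2 * (c * mu / k2) * (e * (m * j)) <= 2^-1 * (m ^+ 2 + G).
Proof.
move=> mu0 k0 c0 c1 mn mnk G0 e1 jG; have k0' := lt0r_neq0 k0.
pose q := e * (mu / k2 * j).
have -> : 2 * (c * mu / k2) * (e * (m * j)) = c * (2 * (m * q)) by rewrite /q; field.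
have qG : q ^+ 2 <= G.
  rewrite /q exprMn e1 mul1r exprMn.
  apply: (@le_trans _ _ ((mu / k2) ^+ 2 * (k2 * G))).
    by apply: ler_wpM2l => //; exact: sqr_ge0.
  have -> : (mu / k2) ^+ 2 * (k2 * G) = (mu * mu / k2) * G by field.
  rewrite -[leRHS]mul1r; apply: ler_wpM2r => //; rewrite ler_pdivrMr// mul1r.
  by apply: le_trans mnk; apply: ler_wpM2l => //; exact: ltW.
have := young m q ltr01; rewrite invr1 !mul1r => y.
have mq0 : 0 <= m ^+ 2 + q ^+ 2 by rewrite addr_ge0// sqr_ge0.
apply: (@le_trans _ _ (c * (m ^+ 2 + q ^+ 2))).
  by apply: ler_wpM2l => //; exact: ltW.
apply: (@le_trans _ _ (2^-1 * (m ^+ 2 + q ^+ 2))); first exact: ler_wpM2r.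
by apply: ler_wpM2l => //; rewrite lerD2l.
Qed.

End LyapunovAlgebra.

Section TimeC1.
Context {R : realType} {d : nat}.
Implicit Types f : 'rV[R]_d -> R -> R.

Lemma time_C1_is_derive f p (s : R) : time_C1 f -> p != 0 -> 0 < s ->
  is_derive s (1 : R) (f p) ('D_1 (f p) s).
Proof. by move=> fC p0 s0; apply: derivableP; have [] := fC p s p0 s0. Qed.

Lemma cont_fst_coord (g : 'rV[R]_d -> R) (p : 'rV[R]_d) (s : R) :
  {for p, continuous g} ->
  {for (p, s), continuous (fun z : 'rV[R]_d * R => g z.1)}.
Proof.
by move=> cg; apply: (@continuous_comp _ _ _ fst); [exact: cvg_fst|exact: cg].
Qed.

Lemma neq0_pos_near (p : 'rV[R]_d) (s : R) : p != 0 -> 0 < s ->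
  \forall z \near (p, s), z.1 != 0 /\ 0 < z.2.
Proof.
move=> p0 s0; have H1 := neq0_near p0.
have H2 : \forall t \near s, 0 < t by exact: lt_nbhsr.
exists ([set x | x != 0], [set t : R | 0 < t]); first by split.
by move=> [x t] [].
Qed.

Lemma cont_region (f g : 'rV[R]_d * R -> R) p (s : R) : p != 0 -> 0 < s ->
  (forall x t, x != 0 -> 0 < t -> f (x, t) = g (x, t)) ->
  {for (p, s), continuous g} -> {for (p, s), continuous f}.
Proof.
move=> p0 s0 fg cg.
suff : f z @[z --> (p, s)] --> g (p, s) by rewrite -fg.
apply: cvg_trans cg; apply: near_eq_cvg.
change (\forall z \near (p, s), g z = f z).
by apply: filterS (neq0_pos_near p0 s0) => -[x t] /= [x0 t0]; rewrite fg.
Qed.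

Lemma time_C1_mull (g : 'rV[R]_d -> R) f : (forall p, p != 0 -> {for p, continuous g}) ->
  time_C1 f -> time_C1 (fun p s => g p * f p s).
Proof.
move=> cg fC p s p0 s0; have [df cf cdf] := fC p s p0 s0.
have cgp := cont_fst_coord (s := s) (cg p p0).
split.
- by have [] := is_derive_mull (g p) (time_C1_is_derive fC p0 s0).
- exact: contM.
- apply: (@cont_region _ (fun z => g z.1 * 'D_1 (f z.1) z.2)) => //.
    move=> x t x0 t0 /=; apply/derive_val/is_derive_mull.
    exact: time_C1_is_derive.
  exact: contM.
Qed.

Lemma time_C1_sqr f : time_C1 f -> time_C1 (fun p s => f p s ^+ 2).
Proof.
move=> fC p s p0 s0; have [df cf cdf] := fC p s p0 s0.
split.
- by have [] := is_derive_sqr (time_C1_is_derive fC p0 s0).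
- by apply: (@continuous_comp _ _ _ (fun z : 'rV[R]_d * R => f z.1 z.2)
    (fun x => x ^+ 2)) => //; exact: exprn_continuous.
- apply: (@cont_region _ (fun z => 2 * f z.1 z.2 * 'D_1 (f z.1) z.2)) => //.
    move=> x t x0 t0 /=; apply/derive_val/is_derive_sqr.
    exact: time_C1_is_derive.
  by apply: contM => //; apply: contM => //; exact: cont_cst.
Qed.

End TimeC1.

(** * Evolution of the energy, the mean and the first moment *)

Section Evolution.
Context {R : realType} {d : nat} (hd : d = 2%N \/ d = 3%N).
Variable kv : 'rV[R]_d.
Hypothesis kv0 : kv != 0.
Notation sint := (@sphere_int R d).
Notation K := (dotp kv).
Implicit Types (a b g : 'rV[R]_d -> R) (f : 'rV[R]_d -> R -> R).

Lemma scont_lapl a : C2 a -> scont (lapl a).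
Proof. by move=> [_ ca]; apply: scont_sum => j; exact: (@C1_dscont _ _ _ j (ca j)). Qed.

(** Weak form of either equation: s = 1 is the equation of a, and s = -1 that of b with the two
    functions exchanged. Energy, mean and flux are the choices g = a, g = 1 and g = K. *)
Lemma sint_evolution (nu lam s : R) a b (a' : 'rV[R]_d -> R) g :
  C2 a -> scont b -> scont g ->
  (forall p, on_sphere p ->
    a' p = s * (K p * b p) + nu * lapl a p - lam * shear_force kv a p) ->
  sint (fun p => g p * a' p) = s * sint (fun p => K p * g p * b p)
    + nu * sint (fun p => g p * lapl a p)
    - lam * \sum_i shear kv g i * shear kv a i.
Proof.
move=> ca cb cg ha.
have c1 : scont (fun p => K p * g p * b p).
  by apply: scontM => //; apply: scontM => //; exact: scont_dotp.
have c2 : scont (fun p => g p * lapl a p) by apply: scontM => //; exact: scont_lapl.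
have c3 : scont (fun p => g p * shear_force kv a p).
  by apply: scontM => //; exact: scont_shear_force.
transitivity (sint (fun p => s * (K p * g p * b p) + nu * (g p * lapl a p)
    - lam * (g p * shear_force kv a p))).
  by apply: eq_sint => // p sp; rewrite ha//; ring.
have i1 := sphere_integrableZ hd s (scont_integrable hd c1).
have i2 := sphere_integrableZ hd nu (scont_integrable hd c2).
have i3 := sphere_integrableZ hd lam (scont_integrable hd c3).
rewrite sintB//; last exact: sphere_integrableD.
rewrite sintD// !sintZ//; try exact: scont_integrable.
by rewrite sint_mul_shear_force.
Qed.

(** The sum runs over ordered pairs, so this is twice the integral of the squared tangential
    gradient; the factor 2 is the one from differentiating a square. *)
Definition dirichlet a : R :=
  \sum_i \sum_j sint (fun p => angular a i j p ^+ 2).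

Lemma sint_energy (nu lam s : R) a b (a' : 'rV[R]_d -> R) :
  C2 a -> homog0 a -> scont b ->
  (forall p, on_sphere p ->
    a' p = s * (K p * b p) + nu * lapl a p - lam * shear_force kv a p) ->
  sint (fun p => 2 * a p * a' p) = 2 * s * sint (fun p => K p * a p * b p)
    - nu * dirichlet a - 2 * lam * \sum_i shear kv a i ^+ 2.
Proof.
move=> ca ha cb ha'; have sa := C1_scont (C2_C1 ca).
(* [a'] is known only through the equation on unit vectors, so integrability is read off the
   right-hand side. *)
have sc : scont (fun p => a p * (s * (K p * b p) + nu * lapl a p
    - lam * shear_force kv a p)).
  apply: scontM => //; apply: scontB; last first.
    by apply: scontM; [exact: scont_cst|exact: scont_shear_force].
  apply: scontD; last by apply: scontM; [exact: scont_cst|exact: scont_lapl].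
  by apply: scontM; [exact: scont_cst|apply: scontM => //; exact: scont_dotp].
have -> : sint (fun p => 2 * a p * a' p) = 2 * sint (fun p => a p * a' p).
  have -> : sint (fun p => a p * a' p) = sint (fun p => a p * (s * (K p * b p)
      + nu * lapl a p - lam * shear_force kv a p)).
    by apply: eq_sint => // p sp; rewrite ha'.
  rewrite -sintZ//; last exact: scont_integrable.
  by apply: eq_sint => // p sp; rewrite ha'//; ring.
rewrite (sint_evolution ca cb sa ha') sint_lapl//; last exact: C2_C1.
have -> : \sum_i \sum_j sint (fun p => angular a i j p * angular a i j p) =
    dirichlet a by [].
under [X in _ - lam * X]eq_bigr do rewrite -expr2.
by move: (dirichlet a) (\sum_i _) (sint _) => *; field.
Qed.

Lemma sint_mean (nu lam s : R) a b (a' : 'rV[R]_d -> R) :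
  C2 a -> homog0 a -> scont b ->
  (forall p, on_sphere p ->
    a' p = s * (K p * b p) + nu * lapl a p - lam * shear_force kv a p) ->
  sint a' = s * sint (fun p => K p * b p).
Proof.
move=> ca ha cb ha'; have c1 : scont (fun _ : 'rV[R]_d => 1 : R) by exact: scont_cst.
have := sint_evolution ca cb c1 ha'.
have -> : sint (fun p => 1 * a' p) = sint a' by apply: eq_sint => // p _; rewrite mul1r.
have -> : sint (fun p => K p * 1 * b p) = sint (fun p => K p * b p).
  by apply: eq_sint => // p _; rewrite mulr1.
have -> : sint (fun p => 1 * lapl a p) = 0.
  rewrite sint_lapl//; last exact: C1_cst.
  rewrite big1 ?mulr0 ?oppr0// => i _; apply: big1 => j _.
  rewrite -[RHS](sint_cst hd); apply: eq_sint => // p _.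
  have E v : 'D_v (fun _ : 'rV[R]_d => 1 : R) p = 0 by exact: derive_cst.
  by rewrite {1}/angular !E !mulr0 subr0 mul0r.
move=> ->; rewrite big1 ?mulr0 ?addr0 ?subr0// => i _.
have -> : shear kv (fun=> 1) i = 0.
  rewrite -[RHS](sint_shear hd kv0 i) /shear.
  by apply: eq_sint => // p _; rewrite mulr1.
by rewrite mul0r.
Qed.

Lemma sint_flux (nu lam s : R) a b (a' : 'rV[R]_d -> R) :
  C2 a -> homog0 a -> scont b ->
  (forall p, on_sphere p ->
    a' p = s * (K p * b p) + nu * lapl a p - lam * shear_force kv a p) ->
  sint (fun p => K p * a' p) = s * sint (fun p => K p ^+ 2 * b p)
    - nu * (d%:R - 1) * sint (fun p => K p * a p).
Proof.
move=> ca ha cb ha'; have cK := @scont_dotp _ _ kv.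
rewrite (sint_evolution ca cb cK ha') sint_dotp_lapl//.
rewrite [X in _ - lam * X]big1 => [|i _]; last first.
  have -> : shear kv K i = 0.
    rewrite -[RHS](sint_dotpX_perp hd kv0 2 (perp_orthogonal kv0 i)) /shear.
    by apply: eq_sint => // p _; ring.
  by rewrite mul0r.
by rewrite mulr0 subr0 mulrN mulrA; congr (_ * _ - _).
Qed.

End Evolution.

(** * Decay of the energy *)

Section Decay.
Context {R : realType}.

Lemma gronwall (f df : R -> R) (r s t : R) :
  (forall x : R, 0 < x -> is_derive x (1 : R) f (df x)) ->
  (forall x, 0 < x -> df x <= - (r * f x)) -> 0 < s -> s <= t ->
  f t <= expR (- (r * (t - s))) * f s.
Proof.
move=> fdf dfle s0 st.
pose g x := f x * expR (r * x).
have dg (x : R) : 0 < x -> is_derive x (1 : R) g ((df x + r * f x) * expR (r * x)).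
  move=> x0; have de : is_derive x (1 : R) (fun x => expR (r * x)) (r * expR (r * x)).
    have := @is_derive1_comp _ expR (fun x => r * x) x _ _
      (is_derive_expR (r * x)) (is_deriveZ r (is_derive_id x (1 : R))).
    by move=> h; apply: (is_derive_eq h); rewrite /GRing.scale/= mulr1 mulrC.
  apply: (is_derive_eq (is_derive_mul (fdf x x0) de)).
  by move: (expR _) => e; ring.
have : g t <= g s.
  apply: (@ler0_derive1_le_cc _ g s t) => //.
  - by move=> x; rewrite in_itv/= => /andP[sx _]; case: (dg x (lt_trans s0 sx)).
  - move=> x; rewrite in_itv/= => /andP[sx _]; have x0 := lt_trans s0 sx.
    rewrite derive1E (derive_val (is_derive := dg x x0)).
    rewrite pmulr_lle0 ?expR_gt0//; have := dfle x x0; lra.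
  - apply: derivable_within_continuous => x; rewrite in_itv/= => /andP[sx _].
    by case: (dg x (lt_le_trans s0 sx)).
  - by rewrite in_itv/= lexx st.
  - by rewrite in_itv/= lexx st.
rewrite /g => h; have -> : - (r * (t - s)) = r * s + - (r * t) by ring.
have -> : f t = expR (- (r * t)) * (f t * expR (r * t)).
  by rewrite mulrCA -expRD addNr expR0 mulr1.
rewrite expRD [_ * expR (- _)]mulrC -mulrA [_ * f s]mulrC.
by apply: ler_wpM2l => //; exact: ltW (expR_gt0 _).
Qed.

Context {d : nat} (hd : d = 2%N \/ d = 3%N).
Variable kv : 'rV[R]_d.
Hypothesis kv0 : kv != 0.
Notation sint := (@sphere_int R d).
Notation K := (dotp kv).
Notation k2 := (dotp kv kv).

Variables (a b : 'rV[R]_d -> R -> R) (nu lam mu kappa : R).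
Hypotheses (aC : time_C1 a) (bC : time_C1 b).
Hypothesis a2 : forall t, 0 < t -> C2 (a ^~ t) /\ homog0 (a ^~ t).
Hypothesis b2 : forall t, 0 < t -> C2 (b ^~ t) /\ homog0 (b ^~ t).
Hypothesis a_eq : forall t p, 0 < t -> on_sphere p -> 'D_1 (a p) t =
  1 * (K p * b p t) + nu * lapl (a ^~ t) p - lam * shear_force kv (a ^~ t) p.
Hypothesis b_eq : forall t p, 0 < t -> on_sphere p -> 'D_1 (b p) t =
  (-1) * (K p * a p t) + nu * lapl (b ^~ t) p - lam * shear_force kv (b ^~ t) p.
Hypotheses (nu0 : 0 < nu) (mu0 : 0 < mu) (munu : mu <= nu) (munuk : mu * nu <= k2).
Hypothesis kappa0 : 0 < kappa.
Hypothesis gap : forall F : 'rV[R]_d -> R, C1 F ->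
  2 * kappa * sphere_variance F <= dirichlet F.
Hypothesis lam_le : - (2 * lam * k2) <= kappa * nu.

(** The first bound is the one required by [lyapunov_dissipation], the second the one that keeps the
    cross term below half of the energy. *)
Let c : R := Num.min (kappa / 63) 2^-1.
Let E t := sint (fun p => a p t ^+ 2) + sint (fun p => b p t ^+ 2).
Let ma t := sint (a ^~ t).
Let mb t := sint (b ^~ t).
Let ja t := sint (fun p => K p * a p t).
Let jb t := sint (fun p => K p * b p t).
Let Phi t := E t + 2 * (c * mu / k2) * (ma t * jb t - mb t * ja t).

Let c0 : 0 < c.
Proof. by rewrite /c lt_min divr_gt0//= invr_gt0. Qed.
Let c12 : c <= 2^-1.
Proof. by rewrite /c ge_min lexx orbT. Qed.
Let ck : 63 * c <= kappa.
Proof. by rewrite mulrC -ler_pdivlMr// /c ge_min lexx. Qed.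
Let k0 : 0 < k2. Proof. exact: dotp_kv_gt0. Qed.

Let aS t : 0 < t -> scont (a ^~ t). Proof. exact: time_C1_scont. Qed.
Let bS t : 0 < t -> scont (b ^~ t). Proof. exact: time_C1_scont. Qed.

Let EE t : E t = ma t ^+ 2 + mb t ^+ 2 + (sphere_variance (a ^~ t) + sphere_variance (b ^~ t)).
Proof.
rewrite /E /sphere_variance -/(ma t) -/(mb t).
by move: (sint _) (sint (fun p => b p t ^+ 2)) => *; ring.
Qed.

Let Phi_lb t : 0 < t -> E t <= 2 * Phi t /\ 2 * Phi t <= 3 * E t.
Proof.
have m1 : (-1) ^+ 2 = 1 :> R by rewrite sqrrN expr1n.
move=> t0; have Ga := sphere_variance_ge0 hd (aS t0); have Gb := sphere_variance_ge0 hd (bS t0).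
have Ja := first_moment_sqr_le hd kv0 (aS t0); have Jb := first_moment_sqr_le hd kv0 (bS t0).
have p1 := lyapunov_cross_le (ma t) mu0 k0 c0 c12 munu munuk Gb (expr1n _ 2) Jb.
have p2 := lyapunov_cross_le (mb t) mu0 k0 c0 c12 munu munuk Ga (expr1n _ 2) Ja.
have n1 := lyapunov_cross_le (ma t) mu0 k0 c0 c12 munu munuk Gb m1 Jb.
have n2 := lyapunov_cross_le (mb t) mu0 k0 c0 c12 munu munuk Ga m1 Ja.
move: p1 p2 n1 n2; rewrite /Phi EE -/(ja t) -/(jb t).
move: (sphere_variance _) (sphere_variance _) (ma t) (mb t) (ja t) (jb t) (c * mu / k2).
by move=> va vb x1 x2 y1 y2 g; split; lra.
Qed.

Let dsqr f t : time_C1 f -> 0 < t ->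
  is_derive (t : R) (1 : R) (fun s => sint (fun p => f p s ^+ 2))
    (sint (fun p => 2 * f p t * 'D_1 (f p) t)).
Proof.
move=> fC t0; apply: (is_derive_eq (is_derive_sint hd (time_C1_sqr fC) t0)).
apply: eq_sint => // p /sphere_neq0 p0; apply/derive_val/is_derive_sqr.
exact: time_C1_is_derive.
Qed.

Let dflux f t : time_C1 f -> 0 < t ->
  is_derive (t : R) (1 : R) (fun s => sint (fun p => K p * f p s))
    (sint (fun p => K p * 'D_1 (f p) t)).
Proof.
move=> fC t0.
have KC : time_C1 (fun p s => K p * f p s).
  by apply: time_C1_mull => // p _; exact: dotp_continuous.
apply: (is_derive_eq (is_derive_sint hd KC t0)).
apply: eq_sint => // p /sphere_neq0 p0; apply/derive_val/is_derive_mull.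
exact: time_C1_is_derive.
Qed.

Let E' t := - nu * (dirichlet (a ^~ t) + dirichlet (b ^~ t))
  - 2 * lam * (\sum_i shear kv (a ^~ t) i ^+ 2 + \sum_i shear kv (b ^~ t) i ^+ 2).
(** [ra] and [rb] vanish on functions constant on the sphere, hence are bounded by the variance.
    Together with the damping of [ja] and [jb] by nu they are the errors of the overview. *)
Let ra t := sint (fun p => K p ^+ 2 * a p t) - k2 / d%:R * ma t.
Let rb t := sint (fun p => K p ^+ 2 * b p t) - k2 / d%:R * mb t.
Let X' t := ja t ^+ 2 + jb t ^+ 2 - (k2 / d%:R * ma t + ra t) * ma t
     - (k2 / d%:R * mb t + rb t) * mb t
     - nu * (d%:R - 1) * (ma t * jb t - mb t * ja t).

Let dE t : 0 < t -> is_derive (t : R) (1 : R) E (E' t).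
Proof.
move=> t0; apply: (is_derive_eq (is_derive_add (dsqr aC t0) (dsqr bC t0))).
have [[ca ha] [cb hb]] := (a2 t0, b2 t0).
rewrite (sint_energy hd ca ha (bS t0) (fun p sp => a_eq t0 sp)).
rewrite (sint_energy hd cb hb (aS t0) (fun p sp => b_eq t0 sp)).
(* Transport rotates (a, b) pointwise, so its contributions to the energy cancel. *)
have -> : sint (fun p => K p * b p t * a p t) = sint (fun p => K p * a p t * b p t).
  by apply: eq_sint => // p _; rewrite mulrAC.
rewrite /E'; move: (dirichlet _) (dirichlet _) (sint _) => x y z.
by move: (\sum_i _) (\sum_i _) => u v; ring.
Qed.

Let dX t : 0 < t ->
  is_derive (t : R) (1 : R) (fun s => ma s * jb s - mb s * ja s) (X' t).
Proof.
move=> t0; have [[ca ha] [cb hb]] := (a2 t0, b2 t0).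
have dma := is_derive_sint hd aC t0; have dmb := is_derive_sint hd bC t0.
rewrite (sint_mean hd kv0 ca ha (bS t0) (fun p sp => a_eq t0 sp)) in dma.
rewrite (sint_mean hd kv0 cb hb (aS t0) (fun p sp => b_eq t0 sp)) in dmb.
have dja := dflux aC t0; have djb := dflux bC t0.
rewrite (sint_flux hd kv0 ca ha (bS t0) (fun p sp => a_eq t0 sp)) in dja.
rewrite (sint_flux hd kv0 cb hb (aS t0) (fun p sp => b_eq t0 sp)) in djb.
apply: (is_derive_eq (is_derive_sub (is_derive_mul dma djb) (is_derive_mul dmb dja))).
rewrite /X' /ra /rb -/(ma t) -/(mb t) -/(ja t) -/(jb t).
move: (ma t) (mb t) (ja t) (jb t) (k2 / d%:R) => x y z w k.
by move: (sint _) (sint _) (d%:R) => *; ring.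
Qed.

(** Diffusion yields 2 kappa nu times the variances. For lam < 0 the coupling costs at most -2 lam
    k2 times the variances, hence at most kappa nu times them by [lam_le]; for lam >= 0 it only
    helps. One kappa remains in either case. *)
Let dissipation t : 0 < t ->
  E' t + 2 * (c * mu / k2) * X' t <= - (c / 2 * mu * E t).
Proof.
move=> t0; have [[ca ha] [cb hb]] := (a2 t0, b2 t0).
have Ga := sphere_variance_ge0 hd (aS t0); have Gb := sphere_variance_ge0 hd (bS t0).
have D23 : (2 <= d%:R :> R) && (d%:R <= 3 :> R).
  by case: hd => hd1; rewrite hd1; apply/andP; split; rewrite ler_nat.
have Ja : ja t ^+ 2 <= k2 * sphere_variance (a ^~ t) by exact: (first_moment_sqr_le hd kv0 (aS t0)).
have Jb : jb t ^+ 2 <= k2 * sphere_variance (b ^~ t) by exact: (first_moment_sqr_le hd kv0 (bS t0)).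
have Ra : ra t ^+ 2 <= k2 ^+ 2 * sphere_variance (a ^~ t).
  exact: (second_moment_sqr_le hd kv0 (aS t0)).
have Rb : rb t ^+ 2 <= k2 ^+ 2 * sphere_variance (b ^~ t).
  exact: (second_moment_sqr_le hd kv0 (bS t0)).
suff hE : E' t <= - (kappa * (nu * (sphere_variance (a ^~ t) + sphere_variance (b ^~ t)))).
  rewrite EE.
  exact: (lyapunov_dissipation (ma t) (mb t) nu0 k0 mu0 munu munuk D23 c0 ck Ga Gb
    Ja Jb Ra Rb hE).
have Sa := sum_shear_sqr_le hd kv0 (aS t0); have Sb := sum_shear_sqr_le hd kv0 (bS t0).
have Sa0 : 0 <= \sum_i shear kv (a ^~ t) i ^+ 2.
  by apply: sumr_ge0 => i _; exact: sqr_ge0.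
have Sb0 : 0 <= \sum_i shear kv (b ^~ t) i ^+ 2.
  by apply: sumr_ge0 => i _; exact: sqr_ge0.
have Pa := ler_wpM2l (ltW nu0) (gap (C2_C1 ca)).
have Pb := ler_wpM2l (ltW nu0) (gap (C2_C1 cb)).
clear Ja Jb Ra Rb; rewrite /E'; move: Sa Sb Sa0 Sb0 Pa Pb Ga Gb.
move: (sphere_variance _) (sphere_variance _) (dirichlet _) (dirichlet _) => Ga Gb Da Db.
move: (\sum_i _) (\sum_i _) => Sa Sb Sak Sbk Sa0 Sb0 Pa Pb Ga0 Gb0.
suff : - (2 * lam * (Sa + Sb)) <= kappa * nu * (Ga + Gb) by lra.
have [l0|l0] := leP 0 lam.
  apply: (@le_trans _ _ 0).
    by rewrite oppr_le0; apply: mulr_ge0; [lra|lra].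
  by apply: mulr_ge0; [rewrite mulr_ge0 ?ltW|lra].
apply: (@le_trans _ _ (- (2 * lam * k2) * (Ga + Gb))); last first.
  by apply: ler_wpM2r => //; lra.
have -> : - (2 * lam * (Sa + Sb)) = - (2 * lam) * (Sa + Sb) by ring.
have -> : - (2 * lam * k2) * (Ga + Gb) = - (2 * lam) * (k2 * (Ga + Gb)) by ring.
by apply: ler_wpM2l; [lra|rewrite mulrDr; lra].
Qed.

(** Since 2 Phi <= 3 E, the dissipation (c / 2) mu E is at least (c / 3) mu Phi, which is the rate.
    The prefactor 3 comes from comparing Phi with E at both ends. The starting time s is positive
    because the equations hold for positive times only. *)
Lemma energy_decay s t : 0 < s -> s <= t ->
  E t <= 3 * expR (- (c / 3 * mu * (t - s))) * E s.
Proof.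
move=> s0 st; have t0 := lt_le_trans s0 st.
have dPhi (x : R) : 0 < x -> is_derive x (1 : R) Phi
    (E' x + 2 * (c * mu / k2) * X' x).
  by move=> x0; apply: is_derive_add; [exact: dE|exact: (is_derive_mull _ (dX x0))].
have r0 : 0 < c / 3 * mu by rewrite mulr_gt0// divr_gt0.
have le (x : R) : 0 < x ->
    E' x + 2 * (c * mu / k2) * X' x <= - (c / 3 * mu * Phi x).
  move=> x0; apply: le_trans (dissipation x0) _; rewrite lerN2.
  have [_ h] := Phi_lb x0.
  have : c * mu * (2 * Phi x) <= c * mu * (3 * E x).
    by apply: ler_wpM2l => //; rewrite mulr_ge0 ?ltW.
  by move: (E x) (Phi x) => y z; lra.
have G := gronwall dPhi le s0 st.
have [lb _] := Phi_lb t0; have [_ ub] := Phi_lb s0.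
have e0 := expR_gt0 (- (c / 3 * mu * (t - s))).
apply: le_trans lb _; apply: (@le_trans _ _ (2 * (expR (- (c / 3 * mu * (t - s))) * Phi s))).
  by apply: ler_wpM2l.
rewrite mulrCA [3 * _]mulrC -[_ * 3 * _]mulrA.
by apply: ler_wpM2l => //; exact: ltW.
Qed.

End Decay.

(** * Elimination of pressure and velocity *)

Section Trigonometric.
Context {R : realType}.

Lemma is_derive_comp1 (V : normedModType R) (g : R -> R) (f : V -> R) (x v : V)
    (df dg : R) : differentiable f x -> is_derive x v f df ->
  is_derive (f x) (1 : R) g dg -> is_derive x v (fun y => g (f y)) (dg * df).
Proof.
move=> Df [_ dfE] [Dg dgE].
have Dg' : differentiable g (f x) by exact/derivable1_diffP.
have comp : differentiable (g \o f) x by exact: differentiable_comp.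
apply: DeriveDef; first exact: diff_derivable.
rewrite -[fun y => _]/(g \o f) deriveE// diff_comp//=.
have -> : 'd f x v = df by rewrite -deriveE.
by rewrite diff1E// derive1E dgE /GRing.scale/= mulrC.
Qed.

Context {d : nat}.
Implicit Types (kv x v : 'rV[R]_d) (A B : R).

(** The wave is the real part of (A + iB) times the mode. The imaginary part is the same expression
    with (B, -A) in place of (A, B), so one formula serves both. *)
Lemma is_derive_wave kv A B x v :
  is_derive x v (fun y => cos (dotp kv y) * A - sin (dotp kv y) * B)
    (dotp kv v * (- sin (dotp kv x) * A - cos (dotp kv x) * B)).
Proof.
have dd := @dotp_differentiable _ _ kv x; have d1 := is_derive_dotp kv x v.
have dc := is_derive_comp1 dd d1 (is_derive_cos (dotp kv x)).
have ds := is_derive_comp1 dd d1 (is_derive_sin (dotp kv x)).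
apply: (is_derive_eq (is_derive_sub (is_derive_mulr A dc) (is_derive_mulr B ds))).
by move: (sin _) (cos _) (dotp kv v) => *; ring.
Qed.

Lemma laplacian_wave kv A B x :
  lapl (fun y => cos (dotp kv y) * A - sin (dotp kv y) * B) x =
  - (dotp kv kv * (cos (dotp kv x) * A - sin (dotp kv x) * B)).
Proof.
rewrite /lapl; transitivity (\sum_j (- (kv 0 j * kv 0 j *
    (cos (dotp kv x) * A - sin (dotp kv x) * B)))).
  apply: eq_bigr => j _.
  rewrite (_ : 'D_('e_j) _ = (fun y => cos (dotp kv y) * (- (kv 0 j * B)) -
      sin (dotp kv y) * (kv 0 j * A))); last first.
    apply/funext => y; rewrite (derive_val (is_derive := is_derive_wave kv A B y _)).
    by rewrite dotp_basisr; ring.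
  rewrite (derive_val (is_derive := is_derive_wave kv _ _ x _)) dotp_basisr.
  by move: (sin _) (cos _) => *; ring.
by rewrite sumrN -mulr_suml.
Qed.

Lemma eq0_of_derive_eq0 (f : R -> R) (s t : R) :
  (forall x : R, is_derive x (1 : R) f 0) -> f s = f t.
Proof. exact: is_derive_0_is_cst. Qed.

Lemma is_derive_line (Q : 'rV[R]_d -> R) x v (s : R) :
  (forall y, differentiable Q y) ->
  is_derive s (1 : R) (fun r => Q (x + r *: v)) ('D_v Q (x + s *: v)).
Proof.
move=> dQ; apply: is_derive_curve => //; apply: is_derive_rV => j.
rewrite (_ : (fun r => _) = (fun r => x 0 j + r * v 0 j)); last first.
  by apply/funext => r; rewrite !mxE.
apply: (is_derive_eq (is_derive_add (is_derive_cst (x 0 j) s (1 : R))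
  (is_derive_mulr (v 0 j) (is_derive_id s (1 : R))))).
by rewrite add0r mul1r.
Qed.

(* A potential whose gradient is a plane wave in the direction kv is carried by
   that direction: for v orthogonal to kv, the increment Q (s v + t kv) - Q (s v)
   does not depend on s, and its s-derivative at 0 is
   A (cos (t |kv|^2) - 1) - B sin (t |kv|^2). *)
Lemma gradient_wave_orthogonal (Q : 'rV[R]_d -> R) (A B : 'I_d -> R) kv v :
  kv != 0 -> dotp kv v = 0 -> (forall x, differentiable Q x) ->
  (forall x i, 'D_('e_i) Q x = cos (dotp kv x) * A i - sin (dotp kv x) * B i) ->
  \sum_i v 0 i * A i = 0 /\ \sum_i v 0 i * B i = 0.
Proof.
move=> kv0 kv_v dQ gQ.
have k0 : dotp kv kv != 0 by rewrite dotp_eq0.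
pose S (C : 'I_d -> R) (w : 'rV[R]_d) := \sum_i w 0 i * C i.
have DQ (w x : 'rV[R]_d) : 'D_w Q x = cos (dotp kv x) * S A w - sin (dotp kv x) * S B w.
  rewrite derive_sum_basis// /S !mulr_sumr -sumrB.
  by apply: eq_bigr => i _; rewrite gQ; ring.
have d0 : dotp kv 0 = 0.
  by apply: big1 => i _; rewrite mxE mulr0.
have shift s t : Q (s *: v + t *: kv) - Q (t *: kv) = Q (s *: v) - Q 0.
  pose D r := Q (s *: v + r *: kv) - Q (0 + r *: kv).
  have := @eq0_of_derive_eq0 D t 0.
  rewrite /D !scale0r !addr0 add0r; apply => r.
  apply: (is_derive_eq (is_derive_sub (is_derive_line (s *: v) kv r dQ)
    (is_derive_line 0 kv r dQ))).
  by rewrite !DQ !dotpDr !dotpZr kv_v d0 mulr0 subrr.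
have key t : cos (t * dotp kv kv) * S A v - sin (t * dotp kv kv) * S B v = S A v.
  have h1 := is_derive_line (t *: kv) v 0 dQ.
  have h2 := is_derive_sub (is_derive_line 0 v 0 dQ)
    (is_derive_cst (Q 0 - Q (t *: kv)) (0 : R) (1 : R)).
  have e : (fun r => Q (t *: kv + r *: v)) =
      (fun r => Q (0 + r *: v) - cst (Q 0 - Q (t *: kv)) r).
    apply/funext => r; have := shift r t; rewrite add0r [t *: kv + _]addrC /cst.
    by move: (Q _) (Q (t *: kv)) (Q (r *: v)) (Q 0) => *; lra.
  rewrite e in h1; have := derive_val (is_derive := h1).
  rewrite (derive_val (is_derive := h2)) subr0 !DQ !scale0r !addr0.
  by rewrite dotpZr d0 cos0 sin0 mul1r mul0r subr0.
(* The phase pi gives -S A v = S A v, and the phase pi / 2 then gives -S B v = S A v = 0. *)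
have k1 := key (pi / dotp kv kv); have k2 := key (pi / 2 / dotp kv kv).
rewrite divfK// cospi sinpi in k1.
rewrite divfK// cos_pihalf sin_pihalf in k2.
by rewrite -/(S A v) -/(S B v); split; lra.
Qed.

End Trigonometric.

Section Regularity.
Context {R : realType} {d : nat}.
Implicit Types G : 'rV[R]_d -> R -> R.

Lemma C21_time_C1 G : C21 G -> time_C1 G.
Proof. by move=> cG p s p0 s0; have [[dG _ _] [c1 c2 _ _]] := cG p s p0 s0. Qed.

Lemma C21_C2 G t : C21 G -> 0 < t -> C2 (G ^~ t).
Proof.
move=> cG t0; split=> [x x0|j x x0].
  have [[_ dG _] [_ _ c1 _]] := cG x t x0 t0; split => // j.
  exact: (cont_slice (c1 j)).
have [[_ _ dG] [_ _ _ c2]] := cG x t x0 t0; split => // i.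
exact: (cont_slice (c2 i j)).
Qed.

Lemma unit_dir_homog0 (g : 'rV[R]_d -> R) : homog0 (fun x => g (unit_dir x)).
Proof. by move=> s p s0; rewrite unit_dirZ. Qed.

End Regularity.

Section ComplexParts.
Context {R : realType}.
Implicit Types x y z : R[i].

Lemma complex_ReM x y :
  complex.Re (x * y) = complex.Re x * complex.Re y - complex.Im x * complex.Im y.
Proof. by case: x y => [a b] [c d]. Qed.

Lemma complex_ImM x y :
  complex.Im (x * y) = complex.Re x * complex.Im y + complex.Im x * complex.Re y.
Proof. by case: x y => [a b] [c d]. Qed.

Lemma complex_ReD x y : complex.Re (x + y) = complex.Re x + complex.Re y.
Proof. by case: x y => [a b] [c d]. Qed.

Lemma complex_ImD x y : complex.Im (x + y) = complex.Im x + complex.Im y.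
Proof. by case: x y => [a b] [c d]. Qed.

Lemma complex_ReN x : complex.Re (- x) = - complex.Re x.
Proof. by case: x. Qed.

Lemma complex_ImN x : complex.Im (- x) = - complex.Im x.
Proof. by case: x. Qed.

Lemma complex_Re_sum n (F : 'I_n -> R[i]) :
  complex.Re (\sum_i F i) = \sum_i complex.Re (F i).
Proof. exact: (big_morph _ complex_ReD). Qed.

Lemma complex_Im_sum n (F : 'I_n -> R[i]) :
  complex.Im (\sum_i F i) = \sum_i complex.Im (F i).
Proof. exact: (big_morph _ complex_ImD). Qed.

Lemma complex_RemulC (r : R) z : complex.Re (r%:C * z) = r * complex.Re z.
Proof. by rewrite complex_ReM /= mul0r subr0. Qed.

Lemma complex_ImmulC (r : R) z : complex.Im (r%:C * z) = r * complex.Im z.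
Proof. by rewrite complex_ImM /= mul0r addr0. Qed.

End ComplexParts.

Section ComplexCalculus.
Context {R : realType} {d : nat}.
Implicit Types (F : 'rV[R]_d -> R[i]) (x : 'rV[R]_d).

Lemma Re_laplacian F x :
  complex.Re (laplacian F x) = lapl (fun y => complex.Re (F y)) x.
Proof. exact: complex_Re_sum. Qed.

Lemma Im_laplacian F x :
  complex.Im (laplacian F x) = lapl (fun y => complex.Im (F y)) x.
Proof. exact: complex_Im_sum. Qed.

End ComplexCalculus.

(** * The system for the real and imaginary parts *)

Section RealForm.
Context {R : realType} {d : nat} (hd : d = 2%N \/ d = 3%N).
Variables (nu psi iota : R) (kv : 'rV[R]_d) (h : 'rV[R]_d -> R -> R[i])
  (uhat : R -> 'rV[R[i]]_d).
Notation sint := (@sphere_int R d).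
Notation K := (dotp kv).
Notation k2 := (dotp kv kv).

Let f := fun (x p : 'rV[R]_d) (t : R) => h p t * mode kv x.
Let u := fun (x : 'rV[R]_d) (t : R) => mode kv x *: uhat t.
Let a p s := complex.Re (h (unit_dir p) s).
Let b p s := complex.Im (h (unit_dir p) s).

Hypothesis kv0 : kv != 0.
Hypothesis hC : sphere_C21 h.
Hypothesis hstokes : forall t : R, 0 < t ->
  stokes (fun x => stress iota f x t) (fun x => u x t).
Hypothesis hpde : linearized_pde nu psi f u.

Let aS t : 0 < t -> scont (a ^~ t).
Proof. exact: (time_C1_scont (C21_time_C1 hC.1)). Qed.
Let bS t : 0 < t -> scont (b ^~ t).
Proof. exact: (time_C1_scont (C21_time_C1 hC.2)). Qed.

Let Re_wave (z : R[i]) x : complex.Re (z * mode kv x) =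
  cos (K x) * complex.Re z - sin (K x) * complex.Im z.
Proof.
rewrite complex_ReM -[complex.Re (mode kv x)]/(cos (K x)).
rewrite -[complex.Im (mode kv x)]/(sin (K x)).
by move: (cos _) (sin _) (complex.Re _) (complex.Im _) => *; ring.
Qed.

Let Im_wave (z : R[i]) x : complex.Im (z * mode kv x) =
  cos (K x) * complex.Im z - sin (K x) * - complex.Re z.
Proof.
rewrite complex_ImM -[complex.Re (mode kv x)]/(cos (K x)).
rewrite -[complex.Im (mode kv x)]/(sin (K x)).
by move: (cos _) (sin _) (complex.Re _) (complex.Im _) => *; ring.
Qed.

Let Ma t i j := sint (fun p => p 0 i * p 0 j * a p t).
Let Mb t i j := sint (fun p => p 0 i * p 0 j * b p t).

Let Re_stress t x i j : 0 < t -> complex.Re (stress iota f x t i j) =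
  cos (K x) * (iota * Ma t i j) - sin (K x) * (iota * Mb t i j).
Proof.
move=> t0; rewrite mxE complex_RemulC /=.
have cp : scont (fun p : 'rV[R]_d => p 0 i * p 0 j).
  by apply: scontM; exact: scont_coord.
have ia := scont_integrable hd (scontM cp (aS t0)).
have ib := scont_integrable hd (scontM cp (bS t0)).
transitivity (iota * sint (fun p => cos (K x) * (p 0 i * p 0 j * a p t)
    - sin (K x) * (p 0 i * p 0 j * b p t))).
  congr (_ * _); apply: eq_sint => // p sp.
  rewrite complex_RemulC Re_wave /a /b unit_dir_id//.
  by move: (complex.Re _) (complex.Im _) => *; ring.
rewrite sintB ?sintZ//; try exact: sphere_integrableZ.
by rewrite /Ma /Mb; move: (sint _) (sint _) => *; ring.
Qed.

Let U t i := complex.Re (uhat t 0 i).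
Let V t i := complex.Im (uhat t 0 i).

Let Re_u t i : (fun y => complex.Re (u y t 0 i)) =
  (fun y => cos (K y) * U t i - sin (K y) * V t i).
Proof. by apply/funext => y; rewrite /u mxE mulrC Re_wave. Qed.

Let Im_u t i : (fun y => complex.Im (u y t 0 i)) =
  (fun y => cos (K y) * V t i - sin (K y) * - U t i).
Proof. by apply/funext => y; rewrite /u mxE mulrC Im_wave. Qed.

Let K0 : K 0 = 0.
Proof. by apply: big1 => i _; rewrite mxE mulr0. Qed.

Let derive_wave (A B : R) x j :
  'D_('e_j) (fun y => cos (K y) * A - sin (K y) * B) x =
  kv 0 j * (- sin (K x) * A - cos (K x) * B).
Proof.
by rewrite (derive_val (is_derive := is_derive_wave kv A B x _)) dotp_basisr.
Qed.

Let Re_partial_u t i j :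
  complex.Re (partial j (fun y => u y t 0 i) 0) = - (kv 0 j * V t i).
Proof.
have -> : complex.Re (partial j (fun y => u y t 0 i) 0) =
    'D_('e_j) (fun y => complex.Re (u y t 0 i)) 0 by [].
by rewrite Re_u derive_wave K0 sin0 cos0; ring.
Qed.

Let Im_partial_u t i j :
  complex.Im (partial j (fun y => u y t 0 i) 0) = kv 0 j * U t i.
Proof.
have -> : complex.Im (partial j (fun y => u y t 0 i) 0) =
    'D_('e_j) (fun y => complex.Im (u y t 0 i)) 0 by [].
by rewrite Im_u derive_wave K0 sin0 cos0; ring.
Qed.

Let incompressible t : 0 < t ->
  \sum_j kv 0 j * U t j = 0 /\ \sum_j kv 0 j * V t j = 0.
Proof.
move=> t0; have [q [_ [div _]]] := hstokes t0.
have e := div 0; split.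
  have := congr1 (@complex.Im R) e; rewrite complex_Im_sum /= => e0; rewrite -[RHS]e0.
  by apply: eq_bigr => j _; exact: esym (Im_partial_u t j j).
have := congr1 (@complex.Re R) e; rewrite complex_Re_sum /= => e0.
apply: oppr_inj; rewrite oppr0 -[RHS]e0 -sumrN.
by apply: eq_bigr => j _; exact: esym (Re_partial_u t j j).
Qed.

(** The momentum equation expresses the gradient of the pressure as a plane wave, so its components
    orthogonal to kv vanish by [gradient_wave_orthogonal]. The real part alone, taken at all x,
    gives both identities: they are the cosine and the sine coefficients. *)
Let pressure_gradient t v : 0 < t -> dotp kv v = 0 ->
  \sum_i v 0 i * (- (k2 * U t i) - iota * \sum_j kv 0 j * Mb t i j) = 0 /\
  \sum_i v 0 i * (iota * (\sum_j kv 0 j * Ma t i j) - k2 * V t i) = 0.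
Proof.
move=> t0 kvv; have [q [dq [_ mom]]] := hstokes t0.
apply: (@gradient_wave_orthogonal _ _ (fun x => complex.Re (q x)) _ _ kv v kv0 kvv).
  by move=> x; have [] := dq x.
move=> x i; have := congr1 (@complex.Re R) (mom x i).
rewrite complex_ReD complex_ReN Re_laplacian Re_u laplacian_wave complex_Re_sum.
rewrite opprK -[complex.Re (partial i q x)]/('D_('e_i) (fun x => complex.Re (q x)) x).
have -> : \sum_j complex.Re (partial j (fun y => stress iota f y t i j) x) =
    - (sin (K x) * (iota * \sum_j kv 0 j * Ma t i j))
    - cos (K x) * (iota * \sum_j kv 0 j * Mb t i j).
  rewrite !mulr_sumr -sumrN -sumrB; apply: eq_bigr => j _.
  have -> : complex.Re (partial j (fun y => stress iota f y t i j) x) =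
      'D_('e_j) (fun y => complex.Re (stress iota f y t i j)) x by [].
  rewrite (_ : (fun y => _) = (fun y => cos (K y) * (iota * Ma t i j) -
      sin (K y) * (iota * Mb t i j))); last first.
    by apply/funext => y; rewrite Re_stress.
  by rewrite derive_wave; ring.
move: ('D_('e_i) _ x) (\sum_j _) (\sum_j _) (sin _) (cos _) => D sa sb s c.
by lra.
Qed.

Let moment_shear (v : 'rV[R]_d) (g : 'rV[R]_d -> R) : scont g ->
  \sum_i v 0 i * \sum_j kv 0 j * sint (fun p => p 0 i * p 0 j * g p) =
  sint (fun p => dotp v p * K p * g p).
Proof.
move=> cg.
have cp i j : scont (fun p : 'rV[R]_d => p 0 i * p 0 j * g p).
  by apply: scontM => //; apply: scontM; exact: scont_coord.
have cq i j : scont (fun p : 'rV[R]_d => kv 0 j * (p 0 i * p 0 j * g p)).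
  by apply: scontM; [exact: scont_cst|exact: cp].
transitivity (sint (fun p => \sum_i v 0 i * \sum_j kv 0 j * (p 0 i * p 0 j * g p))).
  rewrite sint_sum//; last first.
    by move=> i; apply: scontM; [exact: scont_cst|apply: scont_sum].
  apply: eq_bigr => i _; rewrite sintZ//; last first.
    by apply: scont_integrable => //; exact: scont_sum.
  congr (_ * _); rewrite sint_sum//; apply: eq_bigr => j _.
  by rewrite sintZ//; exact: scont_integrable.
apply: eq_sint => // p _; rewrite /dotp -mulrA mulr_suml; apply: eq_bigr => i _.
rewrite mulr_suml !mulr_sumr; apply: eq_bigr => j _.
by ring.
Qed.

Let sum_shear p (g : 'rV[R]_d -> R) : scont g ->
  sint (fun q => dotp (p - (K p / k2) *: kv) q * K q * g q) =
  \sum_i dotp (perp kv i) p * shear kv g i.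
Proof.
move=> cg; have cS i : scont (fun q => K q * dotp (perp kv i) q * g q).
  by apply: scontM => //; exact: scont_shear.
transitivity (sint (fun q => \sum_i dotp (perp kv i) p *
    (K q * dotp (perp kv i) q * g q))).
  apply: eq_sint => // q _.
  have -> : dotp (p - (K p / k2) *: kv) q =
      \sum_i dotp (perp kv i) p * dotp (perp kv i) q.
    by rewrite sum_perp_mul// dotpDl -scaleNr dotpZl; ring.
  by rewrite -mulrA mulr_suml; apply: eq_bigr => i _; ring.
rewrite sint_sum//; last by move=> i; apply: scontM => //; exact: scont_cst.
by apply: eq_bigr => i _; rewrite sintZ//; exact: scont_integrable.
Qed.

(** This is |kv|^2 uhat = i P Sigmahat kv, with P the projection orthogonal to kv, paired with p and
    split into parts. The vector P p is an admissible direction for [pressure_gradient], and by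
    incompressibility U and V pair with P p as they do with p. *)
Let velocity t (p : 'rV[R]_d) : 0 < t ->
  k2 * (\sum_i U t i * p 0 i) = - iota * \sum_i dotp (perp kv i) p * shear kv (b ^~ t) i /\
  k2 * (\sum_i V t i * p 0 i) = iota * \sum_i dotp (perp kv i) p * shear kv (a ^~ t) i.
Proof.
move=> t0; have [kU kV] := incompressible t0.
have k2n : k2 != 0 by rewrite dotp_eq0.
set v := p - (K p / k2) *: kv.
have kvv : dotp kv v = 0.
  by rewrite /v dotpDr -scaleNr dotpZr mulNr divfK// subrr.
have [e1 e2] := pressure_gradient t0 kvv.
have vW (W : 'I_d -> R) : \sum_i kv 0 i * W i = 0 ->
    \sum_i v 0 i * W i = \sum_i W i * p 0 i.
  move=> W0; transitivity (\sum_i (W i * p 0 i - K p / k2 * (kv 0 i * W i))).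
    by apply: eq_bigr => i _; rewrite !mxE; ring.
  by rewrite sumrB -mulr_sumr W0 mulr0 subr0.
rewrite -(sum_shear _ (aS t0)) -(sum_shear _ (bS t0)) -/v.
rewrite -(moment_shear _ (aS t0)) -(moment_shear _ (bS t0)).
rewrite -(vW _ kU) -(vW _ kV).
have s1 (W S : 'I_d -> R) : \sum_i v 0 i * (- (k2 * W i) - iota * S i) =
    - (k2 * \sum_i v 0 i * W i) - iota * \sum_i v 0 i * S i.
  rewrite !mulr_sumr -sumrN -sumrB; apply: eq_bigr => i _.
  by move: (W i) (S i) => *; ring.
have s2 (W S : 'I_d -> R) : \sum_i v 0 i * (iota * S i - k2 * W i) =
    iota * (\sum_i v 0 i * S i) - k2 * \sum_i v 0 i * W i.
  rewrite !mulr_sumr -sumrB; apply: eq_bigr => i _.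
  by move: (W i) (S i) => *; ring.
rewrite (s1 (U t)) in e1; rewrite (s2 (V t)) in e2.
have gen1 (x y : R) : - x - iota * y = 0 -> x = - iota * y by lra.
have gen2 (x y : R) : iota * y - x = 0 -> x = iota * y by lra.
by split; [exact: gen1 e1|exact: gen2 e2].
Qed.

Let lam := d%:R * psi * iota / k2.

Let Re_transport p t x : on_sphere p ->
  \sum_j p 0 j * complex.Re (partial j (fun y => f y p t) x) =
  K p * (- sin (K x) * a p t - cos (K x) * b p t).
Proof.
move=> sp; rewrite {1}/dotp mulr_suml; apply: eq_bigr => j _.
have -> : complex.Re (partial j (fun y => f y p t) x) =
    'D_('e_j) (fun y => complex.Re (f y p t)) x by [].
rewrite (_ : (fun y => _) = (fun y => cos (K y) * a p t - sin (K y) * b p t)).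
  by rewrite derive_wave; ring.
by apply/funext => y; rewrite Re_wave /a /b unit_dir_id.
Qed.

Let Im_transport p t x : on_sphere p ->
  \sum_j p 0 j * complex.Im (partial j (fun y => f y p t) x) =
  K p * (- sin (K x) * b p t + cos (K x) * a p t).
Proof.
move=> sp; rewrite {1}/dotp mulr_suml; apply: eq_bigr => j _.
have -> : complex.Im (partial j (fun y => f y p t) x) =
    'D_('e_j) (fun y => complex.Im (f y p t)) x by [].
rewrite (_ : (fun y => _) = (fun y => cos (K y) * b p t - sin (K y) * - a p t)).
  by rewrite derive_wave; ring.
by apply/funext => y; rewrite Im_wave /a /b unit_dir_id.
Qed.

(** At x = 0 the contraction of the velocity gradient with p tensor p is i (kv . p)(uhat . p). The
    number e is the sign produced by i: -1 in the real part, 1 in the imaginary part. *)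
Let double_sum_u (p : 'rV[R]_d) (W : 'I_d -> R) (D : 'I_d -> 'I_d -> R) (e : R) :
  (forall i j, D i j = e * (kv 0 j * W i)) ->
  \sum_i \sum_j p 0 i * p 0 j * D i j = e * (K p * \sum_i W i * p 0 i).
Proof.
move=> DE; rewrite mulr_sumr mulr_sumr; apply: eq_bigr => i _.
rewrite /dotp mulr_suml mulr_sumr; apply: eq_bigr => j _.
by rewrite DE; ring.
Qed.

Lemma real_form t p : 0 < t -> on_sphere p ->
  'D_1 (a p) t = 1 * (K p * b p t) + nu * lapl (a ^~ t) p
     - lam * shear_force kv (a ^~ t) p /\
  'D_1 (b p) t = (-1) * (K p * a p t) + nu * lapl (b ^~ t) p
     - lam * shear_force kv (b ^~ t) p.
Proof.
move=> t0 sp; have k2n : k2 != 0 by rewrite dotp_eq0.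
have E := hpde 0 sp t0; have [vU vV] := velocity p t0.
have ae : (fun s => complex.Re (f 0 p s)) = a p.
  by apply/funext => s; rewrite Re_wave K0 cos0 sin0 /a unit_dir_id//; ring.
have be : (fun s => complex.Im (f 0 p s)) = b p.
  by apply/funext => s; rewrite Im_wave K0 cos0 sin0 /b unit_dir_id//; ring.
have al : (fun y => complex.Re (f 0 (unit_dir y) t)) = a ^~ t.
  by apply/funext => y; rewrite Re_wave K0 cos0 sin0 /a; ring.
have bl : (fun y => complex.Im (f 0 (unit_dir y) t)) = b ^~ t.
  by apply/funext => y; rewrite Im_wave K0 cos0 sin0 /b; ring.
split.
  have := congr1 (@complex.Re R) E.
  rewrite !complex_ReD !complex_ReN !complex_RemulC complex_Re_sum Re_laplacian al.
  rewrite -[complex.Re (cderive (f 0 p) t 1)]/('D_1 (fun s => complex.Re (f 0 p s)) t).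
  rewrite ae.
  have -> : \sum_i complex.Re ((p 0 i)%:C * partial i (fun y => f y p t) 0) =
      - (K p * b p t).
    under eq_bigr do rewrite complex_RemulC.
    by rewrite Re_transport// K0 sin0 cos0; ring.
  have -> : complex.Re (\sum_i \sum_j partial j (fun y => u y t 0 i) 0 *
      (p 0 i * p 0 j)%:C) = - (K p * \sum_i V t i * p 0 i).
    rewrite complex_Re_sum; under eq_bigr do rewrite complex_Re_sum.
    under eq_bigr do under eq_bigr do rewrite mulrC complex_RemulC.
    rewrite -mulN1r; apply: double_sum_u => i j.
    by rewrite Re_partial_u mulN1r.
  rewrite /shear_force /lam.
  have -> : \sum_i V t i * p 0 i = (iota * \sum_i dotp (perp kv i) p *
      shear kv (a ^~ t) i) / k2 by rewrite -vV mulrC mulKf.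
  move: k2n; generalize k2 => c c0.
  move: ('D_1 (a p) t) (lapl _ _) (\sum_i _) (K p) (b p t) => D L S k bb h0.
  have -> : D = k * bb + nu * L - d%:R * psi * (k * (iota * S / c)).
    by move: h0; rewrite /=; lra.
  by field.
have := congr1 (@complex.Im R) E.
rewrite !complex_ImD !complex_ImN !complex_ImmulC complex_Im_sum Im_laplacian bl.
rewrite -[complex.Im (cderive (f 0 p) t 1)]/('D_1 (fun s => complex.Im (f 0 p s)) t).
rewrite be.
have -> : \sum_i complex.Im ((p 0 i)%:C * partial i (fun y => f y p t) 0) =
    K p * a p t.
  under eq_bigr do rewrite complex_ImmulC.
  by rewrite Im_transport// K0 sin0 cos0; ring.
have -> : complex.Im (\sum_i \sum_j partial j (fun y => u y t 0 i) 0 *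
    (p 0 i * p 0 j)%:C) = K p * \sum_i U t i * p 0 i.
  rewrite complex_Im_sum; under eq_bigr do rewrite complex_Im_sum.
  under eq_bigr do under eq_bigr do rewrite mulrC complex_ImmulC.
  rewrite -[RHS]mul1r; apply: double_sum_u => i j.
  by rewrite Im_partial_u mul1r.
rewrite /shear_force /lam.
have -> : \sum_i U t i * p 0 i = (- iota * \sum_i dotp (perp kv i) p *
    shear kv (b ^~ t) i) / k2 by rewrite -vU mulrC mulKf.
move: k2n; generalize k2 => c c0.
move: ('D_1 (b p) t) (lapl _ _) (\sum_i _) (K p) (a p t) => D L S k bb h0.
have -> : D = - (k * bb) + nu * L + d%:R * psi * (k * (- iota * S / c)).
  by move: h0; rewrite /=; lra.
by field.
Qed.

End RealForm.

(** * Decay in L2 *)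

Section L2.
Context {R : realType} {d : nat} (hd : d = 2%N \/ d = 3%N).
Notation sint := (@sphere_int R d).
Implicit Types (g : 'rV[R]_d -> R) (G H : 'rV[R]_d -> R[i]).

Lemma sphere_measurableB (g1 g2 : 'rV[R]_d -> R) :
  sphere_measurable g1 -> sphere_measurable g2 ->
  sphere_measurable (fun p => g1 p - g2 p).
Proof.
have [ch] := @sphere_chartP R _ hd; rewrite !(chart_measurable ch).
exact: measurable_funB.
Qed.

Lemma sphere_measurable_sqmod G :
  sphere_measurable (fun p => complex.Re (G p)) ->
  sphere_measurable (fun p => complex.Im (G p)) ->
  sphere_measurable (fun p => sqmod (G p)).
Proof.
have [ch] := @sphere_chartP R _ hd; rewrite !(chart_measurable ch) => m1 m2.
by apply: measurable_funD; exact: measurable_funX.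
Qed.

Lemma eq_sphere_measurable (g1 g2 : 'rV[R]_d -> R) :
  (forall p, on_sphere p -> g1 p = g2 p) ->
  sphere_measurable g1 -> sphere_measurable g2.
Proof.
move=> g12; have [ch] := @sphere_chartP R _ hd; rewrite !(chart_measurable ch).
rewrite (_ : (fun z => g1 _) = (fun z => g2 (chart_pt ch z)))//.
by apply/funext => z; rewrite g12//; exact: chart_sphere.
Qed.

Lemma eq_sphere_integrable (g1 g2 : 'rV[R]_d -> R) :
  (forall p, on_sphere p -> g1 p = g2 p) ->
  sphere_integrable g1 -> sphere_integrable g2.
Proof.
move=> g12; have [ch] := @sphere_chartP R _ hd; rewrite !(chart_integrable ch).
rewrite (_ : (fun z => (g1 _ * _)%:E) =
  (fun z => (g2 (chart_pt ch z) * chart_wt ch z)%:E))//.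
by apply/funext => z; rewrite g12//; exact: chart_sphere.
Qed.

Lemma sqmod_ge0 (z : R[i]) : 0 <= sqmod z.
Proof. by rewrite addr_ge0// sqr_ge0. Qed.

Lemma L2norm_sqr G : L2norm G ^+ 2 = sint (fun p => sqmod (G p)).
Proof.
rewrite /L2norm sqr_sqrtr//; apply: sint_ge0 => // p _; exact: sqmod_ge0.
Qed.

Lemma sqmod_le (z w : R[i]) : sqmod z <= 2 * sqmod w + 2 * sqmod (z - w).
Proof.
case: z w => [a b] [c e]; rewrite /sqmod/= -subr_ge0.
rewrite (_ : _ - _ = (2 * c - a) ^+ 2 + (2 * e - b) ^+ 2); last by ring.
by rewrite addr_ge0// sqr_ge0.
Qed.

Lemma sqmodB_le (z w : R[i]) : sqmod (z - w) <= 2 * sqmod z + 2 * sqmod w.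
Proof.
case: z w => [a b] [c e]; rewrite /sqmod/= -subr_ge0.
rewrite (_ : _ - _ = (a + c) ^+ 2 + (b + e) ^+ 2); last by ring.
by rewrite addr_ge0// sqr_ge0.
Qed.

(** A pointwise inequality with factor 2 stands in for the triangle inequality; the factor is
    absorbed in the final constant. The difference is square integrable by domination, H being
    merely in L^2. *)
Lemma L2norm_sqr_le G H : sphere_L2 G -> sphere_L2 H ->
  L2norm G ^+ 2 <= 2 * L2norm H ^+ 2 + 2 * L2norm (fun p => G p - H p) ^+ 2.
Proof.
move=> [Gr Gi Gs] [Hr Hi Hs]; rewrite !L2norm_sqr.
have s2 := sphere_integrableD hd (sphere_integrableZ hd 2 Gs) (sphere_integrableZ hd 2 Hs).
have iD : sphere_integrable (fun p => sqmod (G p - H p)).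
  apply: (sphere_integrable_le hd _ s2).
    apply: sphere_measurable_sqmod.
      apply: eq_sphere_measurable (sphere_measurableB Gr Hr) => p _.
      by rewrite complex_ReD complex_ReN.
    apply: eq_sphere_measurable (sphere_measurableB Gi Hi) => p _.
    by rewrite complex_ImD complex_ImN.
  by move=> p _; rewrite ger0_norm ?sqmod_ge0//; exact: sqmodB_le.
rewrite -!sintZ// -sintD//; try exact: sphere_integrableZ.
apply: le_sint => //; first by apply: sphere_integrableD => //; exact: sphere_integrableZ.
by move=> p _; exact: sqmod_le.
Qed.

End L2.

(** The rate is the smaller of nu and k^2 / nu, and the decay argument sees it only through these
    three bounds. *)
Lemma rate_bounds (R : realType) (nu k : R) : 0 < nu -> 0 < k ->
  [/\ 0 < rate nu k, rate nu k <= nu & rate nu k * nu <= k ^+ 2].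
Proof.
move=> nu0 k0; rewrite /rate; have [nk|kn] := leP nu k.
  by split => //; rewrite expr2; apply: ler_pM => //; exact: ltW.
split; first by rewrite divr_gt0// exprn_gt0.
  by rewrite ler_pdivrMr// expr2; apply: ler_pM; rewrite ?ltW.
by rewrite divfK// lt0r_neq0.
Qed.

(** Energy decay is available from s to t with s > 0, while the data are attained only in L^2. The
    energy at s is therefore bounded by twice that of [hin] plus twice the squared distance to it,
    and s tends to 0 from the right. *)
Theorem theorem3p1 (R : realType) (d : nat) (hd : d = 2%N \/ d = 3%N) :
  exists c0 m0 C : R, [/\ 0 < c0, 0 < m0 & 0 < C] /\
  forall (nu psi iota : R) (kv : 'rV[R]_d)
    (h : 'rV[R]_d -> R -> R[i]) (hin : 'rV[R]_d -> R[i])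
    (uhat : R -> 'rV[R[i]]_d),
  let f := fun (x p : 'rV[R]_d) (t : R) => h p t * mode kv x in
  let u := fun (x : 'rV[R]_d) (t : R) => mode kv x *: uhat t in
  0 < nu -> 0 <= psi -> (iota = 1 \/ iota = -1) -> kv != 0 ->
  sphere_L2 hin -> sphere_C21 h -> attains h hin ->
  (forall t : R, 0 < t -> stokes (fun x => stress iota f x t) (fun x => u x t)) ->
  linearized_pde nu psi f u ->
  (iota = 1 \/ psi <= m0 * rate nu (enorm kv)) ->
  forall t : R, 0 < t ->
    L2norm (fun p => h p t)
    <= C * expR (- c0 * rate nu (enorm kv) * t) * L2norm hin.
Proof.
have [KP KP0 hP] := @poincare R d hd.
(* The factor 2 divides the Poincare gap into equal shares for the coupling and for the Lyapunov
   errors. *)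
pose kappa := (2 * KP)^-1.
have kappa0 : 0 < kappa by rewrite invr_gt0 mulr_gt0.
have gap (F : 'rV[R]_d -> R) : C1 F -> 2 * kappa * sphere_variance F <= dirichlet F.
  move=> /hP hF; have -> : 2 * kappa = KP^-1.
    by rewrite /kappa; field; exact: lt0r_neq0.
  by rewrite ler_pdivrMl.
pose c := Num.min (kappa / 63) 2^-1.
have c_gt0 : 0 < c by rewrite /c lt_min divr_gt0//= invr_gt0.
(* The norm decays at half the energy rate c / 3. The value kappa / 6 ensures 2 d psi <= kappa mu,
   as d <= 3. The square 9 of the last constant dominates 6 = 3 * 2, the product of the prefactors
   of [energy_decay] and [L2norm_sqr_le]. *)
exists (c / 6), (kappa / 6), 3; split; first by split => //; rewrite divr_gt0.
move=> nu psi iota kv h hin uhat f u nu0 psi0 hiota kv0 hinL hC hatt hst hpde hcond t t0.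
have k0 := enorm_gt0 kv0.
have [] := rate_bounds nu0 k0; set mu := rate nu (enorm kv) in hcond *.
rewrite enorm_sqr => mu0 munu munuk.
have k2n : dotp kv kv != 0 by rewrite dotp_eq0.
pose a p s := complex.Re (h (unit_dir p) s).
pose b p s := complex.Im (h (unit_dir p) s).
have aC : time_C1 a := C21_time_C1 hC.1.
have bC : time_C1 b := C21_time_C1 hC.2.
have lam_le : - (2 * (d%:R * psi * iota / dotp kv kv) * dotp kv kv) <= kappa * nu.
  have -> : 2 * (d%:R * psi * iota / dotp kv kv) * dotp kv kv = 2 * (d%:R * psi * iota).
    by rewrite -mulrA divfK.
  have kn : 0 <= kappa * nu by rewrite mulr_ge0// ltW.
  have d0 : 0 <= d%:R * psi by rewrite mulr_ge0.
  have d3 : d%:R * psi <= 3 * psi.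
    by apply: ler_wpM2r => //; case: hd => ->; rewrite ler_nat.
  case: hiota hcond => -> hcond; first by rewrite mulr1; lra.
  case: hcond => [|hpsi]; first by lra.
  have : kappa * mu <= kappa * nu by apply: ler_wpM2l => //; exact: ltW.
  by rewrite mulrN1; lra.
have a2 (s : R) : 0 < s -> C2 (a ^~ s) /\ homog0 (a ^~ s).
  move=> s0; split; first exact: (C21_C2 hC.1 s0).
  exact: (unit_dir_homog0 (fun p => complex.Re (h p s))).
have b2 (s : R) : 0 < s -> C2 (b ^~ s) /\ homog0 (b ^~ s).
  move=> s0; split; first exact: (C21_C2 hC.2 s0).
  exact: (unit_dir_homog0 (fun p => complex.Im (h p s))).
have decay := energy_decay hd kv0 aC bC a2 b2
  (fun s p s0 sp => (real_form hd kv0 hC hst hpde s0 sp).1)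
  (fun s p s0 sp => (real_form hd kv0 hC hst hpde s0 sp).2)
  nu0 mu0 munu munuk kappa0 gap lam_le.
have hL s : 0 < s -> sphere_L2 (fun p => h p s).
  move=> s0; have [sa sb] := (time_C1_scont aC s0, time_C1_scont bC s0).
  split.
  - apply: (eq_sphere_measurable hd) (scont_measurable hd sa) => p sp.
    by rewrite /a unit_dir_id.
  - apply: (eq_sphere_measurable hd) (scont_measurable hd sb) => p sp.
    by rewrite /b unit_dir_id.
  - have := scont_integrable hd (scontD (@scontX _ _ _ 2 sa) (@scontX _ _ _ 2 sb)).
    by apply: (eq_sphere_integrable hd) => p sp; rewrite /sqmod /a /b unit_dir_id.
have EL s : 0 < s -> L2norm (fun p => h p s) ^+ 2 =
    sphere_int (fun p => a p s ^+ 2) + sphere_int (fun p => b p s ^+ 2).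
  move=> s0; have [sa sb] := (time_C1_scont aC s0, time_C1_scont bC s0).
  rewrite (L2norm_sqr hd) -(sintD hd); last 2 first.
  - exact/scont_integrable/scontX.
  - exact/scont_integrable/scontX.
  by apply: (eq_sint hd) => p sp; rewrite /sqmod /a /b unit_dir_id.
pose r := c / 3 * mu.
pose del s := L2norm (fun p => h p s - hin p).
have step s : 0 < s -> s <= t -> L2norm (fun p => h p t) ^+ 2 <=
    3 * expR (- (r * (t - s))) * (2 * L2norm hin ^+ 2 + 2 * del s ^+ 2).
  move=> s0 st; rewrite (EL t t0); apply: le_trans (decay s t s0 st) _.
  rewrite -(EL s s0); apply: ler_wpM2l.
    by apply: mulr_ge0 => //; exact: ltW (expR_gt0 _).
  exact: (L2norm_sqr_le hd (hL s s0) hinL).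
have lim : 3 * expR (- (r * (t - s))) * (2 * L2norm hin ^+ 2 + 2 * del s ^+ 2)
    @[s --> (0 : R)^'+] --> 3 * expR (- (r * (t - 0))) *
      (2 * L2norm hin ^+ 2 + 2 * 0 ^+ 2).
  apply: cvgM.
    apply: cvg_at_right_filter.
    have : {for (0 : R), continuous (fun s => 3 * expR (- (r * (t - s))))}.
      apply: contM; first exact: cont_cst.
      apply: (@continuous_comp _ _ _ (fun s => - (r * (t - s))) expR); last first.
        exact: continuous_expR.
      apply: (@continuousN _ _ _ (fun s => r * (t - s))).
      apply: contM; first exact: cont_cst.
      by apply: contB; [exact: cont_cst|exact: cvg_id].
    by [].
  apply: cvgD; first exact: cvg_cst.
  apply: cvgM; first exact: cvg_cst.
  by rewrite expr2; apply: cvgM; exact: hatt.2.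
have main : L2norm (fun p => h p t) ^+ 2 <=
    6 * expR (- (r * t)) * L2norm hin ^+ 2.
  have -> : 6 * expR (- (r * t)) * L2norm hin ^+ 2 = 3 * expR (- (r * (t - 0))) *
      (2 * L2norm hin ^+ 2 + 2 * 0 ^+ 2).
    by rewrite subr0; move: (expR _) (L2norm _) => *; ring.
  apply: (ler_cvg_to (cvg_cst _) lim).
  near=> s; apply: step; first by near: s; exact: nbhs_right_gt.
  by near: s; exact: nbhs_right_le.
have Lin0 : 0 <= L2norm hin by exact: sqrtr_ge0.
have e0 := expR_gt0 (- (c / 6) * mu * t).
rewrite -(@ler_pXn2r _ 2)// ?nnegrE; last 2 first.
- exact: sqrtr_ge0.
- by rewrite !mulr_ge0// ltW.
apply: le_trans main _.
have -> : (3 * expR (- (c / 6) * mu * t) * L2norm hin) ^+ 2 =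
    9 * expR (- (r * t)) * L2norm hin ^+ 2.
  have -> : - (r * t) = - (c / 6) * mu * t + - (c / 6) * mu * t.
    by rewrite /r; field.
  by rewrite expRD; ring.
apply: ler_wpM2r; first exact: sqr_ge0.
by apply: ler_wpM2r; [exact: ltW (expR_gt0 _)|rewrite ler_nat].
Unshelve. all: by end_near.
Qed.
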